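(* Let $n\ge2$. The jewel space $\mathcal J_n$ is $\mathrm{Out}(F_n)$-equivariantly homeomorphic to the Bestvina–Feighn bordification $b\mathcal O_n$ of Outer space.
   Context: **Outer space.** Let $n\ge2$, $F_n$ the free group of rank $n$, and $R_n$ a rose with $n$ petals, with $\pi_1(R_n)$ identified with $F_n$. A marked graph $(G,g)$ consists of a finite connected metric graph $G$ with no univalent or bivalent vertices and no separating edges, with positive edge lengths summing to $1$, together with a homotopy equivalence $g:R_n\to G$ (the marking). Two marked graphs are identified if there is an isometry between them commuting with the markings up to homotopy. $\mathcal O_n$ is the set of equivalence classes. Fixing the combinatorial type of $(G,g)$ and varying the positive edge lengths with sum $1$ gives an open simplex $\mathring\sigma(G,g)$, and $\mathcal O_n$ is the disjoint union of these. $\mathring\sigma(G',g')$ is a face of $\mathring\sigma(G,g)$ when $(G',g')$ is obtained from $(G,g)$ by collapsing each component of a forest of $G$ to a point; $\mathcal O_n$ is topologized by gluing the simplices-with-missing-faces $\bar\sigma(G,g)$ (the union of $\mathring\sigma(G,g)$ and all such faces) along these face relations. $\mathrm{Out}(F_n)$ acts by changing the marking. **Core subgraphs.** A subgraph of $G$ is the closure of a set of edges. A subgraph $H$ is core if no edge $e$ of $H$ separates $H$, i.e. removing the open edge $e$ never increases the number of components of $H$; core subgraphs may be disconnected, and $G$ itself is core. For a graph $A$, $\sigma(A)$ is the closed simplex of nonnegative edge-length functions on $A$ of total sum $1$. **Jewel space.** If $G$ has edges $e_0,\dots,e_m$, then $\sigma(G)=\{(x_0,\dots,x_m): x_i\ge0,\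 \sum x_i=1\}$, and $\bar\sigma(G,g)$ is the subset of $\sigma(G)$ obtained by removing those faces in which the edges of coordinate $0$ contain a loop. Fix constants $0<c_1<c_2<\dots<c_n\ll1$ (sufficiently small depending on $n$) with $c_{r+1}>2c_r$, and for a nonempty core subgraph $A$ put $c_A=c_r$, $r=\operatorname{rank}H_1(A)$. The jewel is $J(G)=\{x\in\sigma(G): \sum_{e_i\in A}x_i\ge c_A\ \text{for all nonempty core subgraphs }A\subseteq G\}$, and $J(G,g)\subset\bar\sigma(G,g)\subset\mathcal O_n$ is the corresponding set for $(G,g)$. $\mathcal J_n$ is the union of all $J(G,g)$ in $\mathcal O_n$, with the induced action of $\mathrm{Out}(F_n)$. **The Bestvina–Feighn bordification.** For a marked graph $(G,g)$ let $i_G:\mathring\sigma(G)\to\prod_A\sigma(A)$, the product over all nonempty core subgraphs $A$ of $G$ (including $G$), be the map whose $A$-component restricts a metric on $G$ to $A$ and rescales it to total volume $1$. $\Sigma(G,g)$ is the closure of the image of $i_G$. If $\kappa:G\to G'$ collapses a forest and $g'=\kappa\circ g$, then each core subgraph $A$ of $G$ maps to a core subgraph $A'=\kappa(A)$ of $G'$ whose edges are identified with edges of $A$, so $\sigma(A')$ is a face of $\sigma(A)$; the map $\prod_{A'}\sigma(A')\to\prod_A\sigma(A)$ whose $A$-component is the $\kappa(A)$-component followed by the inclusion $\sigma(\kappa(A))\subseteq\sigma(A)$ restricts to an inclusion $\Sigma(G',g')\hookrightarrow\Sigma(G,g)$. $b\mathcal O_n$ is the space obtained by gluing all $\Sigma(G,g)$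 along these inclusions, i.e. the colimit of $(G,g)\mapsto\Sigma(G,g)$ over the category of (combinatorial) marked graphs and forest collapses; $\mathrm{Out}(F_n)$ acts on it by changing markings. *)

(* Defs.v *)
From HB Require Import structures.
From Stdlib Require Import Relation_Operators.
From mathcomp Require Import all_boot all_order all_algebra.
From mathcomp Require Import all_classical all_reals all_analysis.
Import numFieldNormedType.Exports.

Set Implicit Arguments.
Unset Strict Implicit.
Unset Printing Implicit Defensive.

Import Order.TTheory GRing.Theory Num.Theory.
Local Open Scope classical_set_scope.
Local Open Scope ring_scope.
Local Open Scope quotient_scope.

Section GeneratedEquivalence.
Variables (T : Type) (r : T -> T -> Prop).

Definition gen_rel : rel T := fun x y => `[< clos_refl_sym_trans T r x y >].

Lemma gen_rel_refl : reflexive gen_rel.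
Proof. by move=> x; apply/asboolP; exact: rst_refl. Qed.

Lemma gen_rel_sym : symmetric gen_rel.
Proof. by move=> x y; apply/asboolP/asboolP; exact: rst_sym. Qed.

Lemma gen_rel_trans : transitive gen_rel.
Proof.
by move=> y x z /asboolP xy /asboolP yz; apply/asboolP; exact: rst_trans yz.
Qed.

Canonical gen_equiv := EquivRel gen_rel gen_rel_refl gen_rel_sym gen_rel_trans.
End GeneratedEquivalence.

Notation "{ 'quot' r }" := {eq_quot (gen_equiv r)}
  (at level 0, format "{ 'quot'  r }") : type_scope.

Lemma quotP (T : choiceType) (r : T -> T -> Prop) (x y : T) :
  \pi_({quot r}) x = \pi_({quot r}) y <-> clos_refl_sym_trans T r x y.
Proof.
split; first by move=> /eqmodP /asboolP.
by move=> xy; apply/eqmodP/asboolP.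
Qed.

Lemma quot_repr (T : choiceType) (r : T -> T -> Prop) (x : T) :
  clos_refl_sym_trans T r (repr (\pi_({quot r}) x)) x.
Proof. by apply/quotP; rewrite reprK. Qed.

Lemma clos_map (T U : Type) (r : T -> T -> Prop) (s : U -> U -> Prop)
    (f : T -> U) (x y : T) :
  (forall a b, r a b -> clos_refl_sym_trans U s (f a) (f b)) ->
  clos_refl_sym_trans T r x y -> clos_refl_sym_trans U s (f x) (f y).
Proof.
move=> rs; elim=> {x y} [x y|x|x y _|x y z _ xy _ yz].
- exact: rs.
- exact: rst_refl.
- exact: rst_sym.
- exact: rst_trans yz.
Qed.

Section Words.
Variable T : Type.

(* (a, false) is the letter a, and (a, true) is its inverse. *)
Definition word := seq (T * bool).
Definition inv_letter (d : T * bool) := (d.1, ~~ d.2).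
Definition inv_word (w : word) : word := rev (map inv_letter w).

Definition cancels (u v : word) : Prop :=
  exists p d q, u = p ++ d :: inv_letter d :: q /\ v = p ++ q.

Definition word_eq : word -> word -> Prop := clos_refl_sym_trans word cancels.

Lemma weq_refl w : word_eq w w. Proof. exact: rst_refl. Qed.
Lemma weq_sym u v : word_eq u v -> word_eq v u. Proof. exact: rst_sym. Qed.
Lemma weq_trans v u w : word_eq u v -> word_eq v w -> word_eq u w.
Proof. exact: rst_trans. Qed.

Lemma weq_cat2l p u v : word_eq u v -> word_eq (p ++ u) (p ++ v).
Proof.
apply: clos_map => {u v} _ _ [a [d [q [-> ->]]]]; apply: rst_step.
by exists (p ++ a), d, q; rewrite !catA.
Qed.

Lemma weq_cat2r p u v : word_eq u v -> word_eq (u ++ p) (v ++ p).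
Proof.
apply: (clos_map (f := cat^~ p)) => {u v} _ _ [a [d [q [-> ->]]]].
by apply: rst_step; exists a, d, (q ++ p); rewrite -!catA.
Qed.

Lemma weq_cat u v u' v' :
  word_eq u u' -> word_eq v v' -> word_eq (u ++ v) (u' ++ v').
Proof.
by move=> uu vv; apply: weq_trans (weq_cat2l _ vv); exact: weq_cat2r.
Qed.

Lemma inv_letterK : involutive inv_letter.
Proof. by case=> a b; rewrite /inv_letter /= negbK. Qed.

Lemma inv_wordK : involutive inv_word.
Proof.
move=> w; rewrite /inv_word map_rev revK -map_comp -[RHS]map_id.
by apply: eq_map => d /=; exact: inv_letterK.
Qed.

Lemma inv_word_cat u v : inv_word (u ++ v) = inv_word v ++ inv_word u.
Proof. by rewrite /inv_word map_cat rev_cat. Qed.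

Lemma inv_word_cons d w : inv_word (d :: w) = inv_word w ++ [:: inv_letter d].
Proof. by rewrite /inv_word /= rev_cons cats1. Qed.

Lemma weq_mulV w : word_eq (w ++ inv_word w) [::].
Proof.
elim: w => [|d w IHw]; first exact: weq_refl.
rewrite inv_word_cons /= catA -cat1s.
apply: (weq_trans (v := [:: d; inv_letter d])).
  rewrite -[X in word_eq _ X]/([:: d] ++ ([::] ++ [:: inv_letter d])).
  exact/weq_cat2l/weq_cat2r.
by apply: rst_step; exists [::], d, [::].
Qed.

Lemma weq_mulVl w : word_eq (inv_word w ++ w) [::].
Proof. by rewrite -{2}[w]inv_wordK; exact: weq_mulV. Qed.

Lemma weq_inv u v : word_eq u v -> word_eq (inv_word u) (inv_word v).
Proof.
apply: clos_map => {u v} _ _ [a [d [q [-> ->]]]]; apply: rst_step.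
exists (inv_word q), d, (inv_word a).
by rewrite !inv_word_cat !inv_word_cons inv_letterK -!catA.
Qed.

End Words.

Section FreeGroup.
Variable n : nat.

Definition free_group : Type := {quot @cancels 'I_n}.

HB.instance Definition _ := EqQuotient.on free_group.
HB.instance Definition _ := Choice.on free_group.

Local Notation F := free_group.
Local Notation cls := (\pi_F).

Definition free_mul (x y : F) : F := cls (repr x ++ repr y).
Definition free_inv (x : F) : F := cls (inv_word (repr x)).

Lemma clsP (u v : word 'I_n) : cls u = cls v <-> word_eq u v.
Proof. exact: quotP. Qed.

Lemma repr_cls (u : word 'I_n) : word_eq (repr (cls u)) u.
Proof. exact: quot_repr. Qed.

Lemma free_mulE u v : free_mul (cls u) (cls v) = cls (u ++ v).
Proof. by apply/clsP; apply: weq_cat; exact: repr_cls. Qed.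

Lemma free_invE u : free_inv (cls u) = cls (inv_word u).
Proof. by apply/clsP; apply: weq_inv; exact: repr_cls. Qed.

Lemma free_mulA : associative free_mul.
Proof.
move=> x y z; elim/quotW: x => x; elim/quotW: y => y; elim/quotW: z => z.
by rewrite (free_mulE y z) (free_mulE x y) !free_mulE catA.
Qed.

Lemma free_mul1 : left_id (cls [::]) free_mul.
Proof. by elim/quotW=> x; rewrite free_mulE. Qed.

Lemma free_mulr1 : right_id (cls [::]) free_mul.
Proof. by elim/quotW=> x; rewrite free_mulE cats0. Qed.

Lemma free_mulV : left_inverse (cls [::]) free_inv free_mul.
Proof.
by elim/quotW=> x; rewrite free_invE free_mulE; apply/clsP/weq_mulVl.
Qed.

Lemma free_mulrV : right_inverse (cls [::]) free_inv free_mul.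
Proof.
by elim/quotW=> x; rewrite free_invE free_mulE; apply/clsP/weq_mulV.
Qed.

HB.instance Definition _ :=
  isGroup.Build F free_mulA free_mul1 free_mulr1 free_mulV free_mulrV.

Definition free_gen (i : 'I_n) : F := cls [:: (i, false)].

Record aut := Aut {
  aut_fun :> {multiplicative F -> F};
  aut_bij : bijective aut_fun }.

HB.instance Definition _ := gen_eqMixin aut.
HB.instance Definition _ := gen_choiceMixin aut.

Definition inner_related (f g : aut) : Prop :=
  exists y : F, forall x, g x = (f x ^ y)%g.

Definition out : Type := {quot inner_related}.

HB.instance Definition _ := EqQuotient.on out.
HB.instance Definition _ := Choice.on out.

End FreeGroup.

(* Loops and multiple edges are allowed. The orientation of each edge only    *)
(* serves to name its two ends.                                               *)
Record graph := Graph {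
  nv : nat;
  ne : nat;
  src : 'I_ne -> 'I_nv;
  tgt : 'I_ne -> 'I_nv }.

Section EdgePaths.
Variable G : graph.

(* Oriented edges (equivalently, half-edges) of G. *)
Local Notation dart := ('I_(ne G) * bool)%type.

Definition org (d : dart) : 'I_(nv G) := if d.2 then tgt d.1 else src d.1.
Definition dst (d : dart) : 'I_(nv G) := if d.2 then src d.1 else tgt d.1.

Fixpoint epath (u : 'I_(nv G)) (p : word 'I_(ne G)) (v : 'I_(nv G)) : bool :=
  if p is d :: p' then (org d == u) && epath (dst d) p' v else u == v.

Lemma epath_cat u v w p q : epath u p v -> epath v q w -> epath u (p ++ q) w.
Proof.
elim: p u => [|d p IHp] u /=; first by move/eqP->.
by move=> /andP[-> pv] qw; exact: IHp.
Qed.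

Lemma org_inv d : org (inv_letter d) = dst d.
Proof. by rewrite /org /dst /=; case: d.2. Qed.

Lemma dst_inv d : dst (inv_letter d) = org d.
Proof. by rewrite /org /dst /=; case: d.2. Qed.

Lemma epath_inv u v p : epath u p v -> epath v (inv_word p) u.
Proof.
elim: p u => [|d p IHp] u /=; first by rewrite eq_sym.
move=> /andP[/eqP du /IHp pv]; rewrite inv_word_cons.
by apply: epath_cat pv _; rewrite /= org_inv dst_inv du !eqxx.
Qed.

End EdgePaths.

(* Cellular maps. Up to homotopy every continuous map of finite graphs is of  *)
(* this form.                                                                 *)
Record cmap (G H : graph) := CMap {
  fv : 'I_(nv G) -> 'I_(nv H);
  fe : 'I_(ne G) -> word 'I_(ne H);
  fe_path : forall e, epath (fv (src e)) (fe e) (fv (tgt e)) }.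

Definition fletter G H (f : cmap G H) (d : 'I_(ne G) * bool) :=
  if d.2 then inv_word (fe f d.1) else fe f d.1.

Definition fword G H (f : cmap G H) (w : word 'I_(ne G)) : word 'I_(ne H) :=
  flatten (map (fletter f) w).

Lemma fword_cat G H (f : cmap G H) u v :
  fword f (u ++ v) = fword f u ++ fword f v.
Proof. by rewrite /fword map_cat flatten_cat. Qed.

Lemma fletter_inv G H (f : cmap G H) d :
  fletter f (inv_letter d) = inv_word (fletter f d).
Proof. by rewrite /fletter /=; case: d.2 => //=; rewrite inv_wordK. Qed.

Lemma fword_inv G H (f : cmap G H) w :
  fword f (inv_word w) = inv_word (fword f w).
Proof.
elim: w => [|d w IHw] //.
by rewrite inv_word_cons fword_cat IHw /fword /= cats0 fletter_inv inv_word_cat.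
Qed.

Lemma fword_weq G H (f : cmap G H) u v :
  word_eq u v -> word_eq (fword f u) (fword f v).
Proof.
apply: clos_map => {u v} _ _ [a [d [q [-> ->]]]].
rewrite !fword_cat; apply: weq_cat2l.
rewrite /fword /= fletter_inv catA -[X in word_eq _ X]cat0s.
exact/weq_cat2r/weq_mulV.
Qed.

Lemma fletter_path G H (f : cmap G H) d :
  epath (fv f (org d)) (fletter f d) (fv f (dst d)).
Proof.
rewrite /org /dst /fletter; case: d.2; last exact: fe_path.
exact/epath_inv/fe_path.
Qed.

Lemma fword_path G H (f : cmap G H) u p v :
  epath u p v -> epath (fv f u) (fword f p) (fv f v).
Proof.
elim: p u => [|d p IHp] u /=; first by move/eqP->.
by move=> /andP[/eqP <- /IHp]; apply: epath_cat; exact: fletter_path.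
Qed.

Definition id_cmap G : cmap G G.
Proof.
exists id (fun e => [:: (e, false)]).
abstract by move=> e; rewrite /= /org /dst /= !eqxx.
Defined.

Definition comp_cmap G H K (g : cmap H K) (f : cmap G H) : cmap G K.
Proof.
exists (fv g \o fv f) (fun e => fword g (fe f e)).
abstract by move=> e; apply: fword_path; exact: fe_path.
Defined.

(* The image of the vertex v moves along the edge path h v.                   *)
(* Edge paths with the same end points are homotopic relative to their end    *)
(* points iff they are equal modulo cancellation of backtrackings; inserting  *)
(* d :: inv_letter d where it does not form a path is harmless because        *)
(* reduced words are unique.                                                  *)
Definition homotopic G H (f g : cmap G H) : Prop :=
  exists h : 'I_(nv G) -> word 'I_(ne H),
    (forall v, epath (fv f v) (h v) (fv g v)) /\
    (forall e, word_eq (fe f e ++ h (tgt e)) (h (src e) ++ fe g e)).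

Definition homotopy_equivalence G H (f : cmap G H) : Prop :=
  exists g : cmap H G, homotopic (comp_cmap g f) (id_cmap G) /\
                       homotopic (comp_cmap f g) (id_cmap H).

Lemma homotopic_word G H (f g : cmap G H) (h : 'I_(nv G) -> word 'I_(ne H)) :
  (forall e, word_eq (fe f e ++ h (tgt e)) (h (src e) ++ fe g e)) ->
  forall u p v, epath u p v ->
    word_eq (fword f p ++ h v) (h u ++ fword g p).
Proof.
move=> he.
have hd d : word_eq (fletter f d ++ h (dst d)) (h (org d) ++ fletter g d).
  rewrite /fletter /org /dst; case: d => e [] /=; last exact: he.
  have := he e; set a := fe f e; set b := fe g e.
  set x := h (tgt e); set y := h (src e) => axyb.
  apply: (weq_trans (v := inv_word a ++ (y ++ b) ++ inv_word b)).
    apply/weq_cat2l/weq_sym; rewrite -catA -[X in word_eq _ X]cats0.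
    exact/weq_cat2l/weq_mulV.
  apply: (weq_trans (v := inv_word a ++ (a ++ x) ++ inv_word b)).
    exact/weq_cat2l/weq_cat2r/weq_sym.
  rewrite -catA catA -[X in word_eq _ X]cat0s.
  exact/weq_cat2r/weq_mulVl.
move=> u p; elim: p u => [|d p IHp] u v /=.
  by move/eqP->; rewrite cats0; exact: weq_refl.
move=> /andP[/eqP <- /IHp pv]; rewrite /fword /= -!/(fword _ _) -catA.
apply: (weq_trans (weq_cat2l _ pv)); rewrite !catA.
exact/weq_cat2r.
Qed.

Lemma homotopic_eq G H (f g : cmap G H) :
  fv f =1 fv g -> (forall e, word_eq (fe f e) (fe g e)) -> homotopic f g.
Proof.
move=> fgv fge; exists (fun=> [::]); split=> [v|e] /=; first by rewrite fgv.
by rewrite cats0.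
Qed.

Lemma homotopic_trans G H (f g k : cmap G H) :
  homotopic f g -> homotopic g k -> homotopic f k.
Proof.
move=> [h [hv he]] [h' [hv' he']]; exists (fun v => h v ++ h' v).
split=> [v|e]; first exact: epath_cat (hv v) (hv' v).
rewrite catA; apply: (weq_trans (weq_cat2r _ (he e))).
by rewrite -!catA; exact: weq_cat2l.
Qed.

Lemma homotopic_compr G H K (f g : cmap H K) (k : cmap G H) :
  homotopic f g -> homotopic (comp_cmap f k) (comp_cmap g k).
Proof.
move=> [h [hv he]]; exists (fun v => h (fv k v)); split=> [v|e]; first exact: hv.
by apply: homotopic_word (fe_path k e).
Qed.

Lemma homotopic_compl G H K (f g : cmap G H) (k : cmap H K) :
  homotopic f g -> homotopic (comp_cmap k f) (comp_cmap k g).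
Proof.
move=> [h [hv he]]; exists (fun v => fword k (h v)); split=> [v|e] /=.
  exact/fword_path/hv.
by rewrite -!fword_cat; exact/fword_weq/he.
Qed.

Lemma fword_comp G H K (g : cmap H K) (f : cmap G H) w :
  fword (comp_cmap g f) w = fword g (fword f w).
Proof.
elim: w => [|d w IHw] //.
rewrite /fword /= -!/(fword _ _) IHw fword_cat; congr (_ ++ _).
by rewrite /fletter /=; case: d.2 => //=; rewrite fword_inv.
Qed.

Lemma fword_id G w : fword (id_cmap G) w = w.
Proof.
elim: w => [|[e b] w IHw] //.
by rewrite /fword /= -!/(fword _ _) IHw /fletter /=; case: b.
Qed.

Lemma comp_cmapA G H K L (f : cmap K L) (g : cmap H K) (k : cmap G H) :
  homotopic (comp_cmap f (comp_cmap g k)) (comp_cmap (comp_cmap f g) k).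
Proof.
by apply: homotopic_eq => // e /=; rewrite fword_comp; exact: weq_refl.
Qed.

Lemma comp_cmapA' G H K L (f : cmap K L) (g : cmap H K) (k : cmap G H) :
  homotopic (comp_cmap (comp_cmap f g) k) (comp_cmap f (comp_cmap g k)).
Proof.
by apply: homotopic_eq => // e /=; rewrite fword_comp; exact: weq_refl.
Qed.

Lemma comp_id_cmap G H (f : cmap G H) :
  homotopic (comp_cmap (id_cmap H) f) f.
Proof. by apply: homotopic_eq => // e /=; rewrite fword_id; exact: weq_refl. Qed.

Lemma heq_cancel G H K (f : cmap G H) (f' : cmap H G) (g : cmap H K)
    (g' : cmap K H) :
  homotopic (comp_cmap f f') (id_cmap H) ->
  homotopic (comp_cmap g g') (id_cmap K) ->
  homotopic (comp_cmap (comp_cmap g f) (comp_cmap f' g')) (id_cmap K).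
Proof.
move=> ff gg; apply: homotopic_trans gg.
apply: homotopic_trans (comp_cmapA' _ _ _) _; apply: homotopic_compl.
apply: homotopic_trans (comp_cmapA _ _ _) _.
by apply: homotopic_trans (homotopic_compr _ ff) _; exact: comp_id_cmap.
Qed.

Lemma heq_comp G H K (g : cmap H K) (f : cmap G H) :
  homotopy_equivalence g -> homotopy_equivalence f ->
  homotopy_equivalence (comp_cmap g f).
Proof.
move=> [g' [gg1 gg2]] [f' [ff1 ff2]]; exists (comp_cmap f' g').
by split; apply: heq_cancel.
Qed.

(* The rose with n petals; edge paths are words, so that free_group n is its  *)
(* fundamental group.                                                         *)
Definition rose (n : nat) : graph :=
  @Graph 1 n (fun=> ord0) (fun=> ord0).

Lemma epath_rose n u p v : @epath (rose n) u p v.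
Proof.
elim: p u => [|d p IHp] u /=; first by rewrite (ord1 u) (ord1 v).
by rewrite IHp andbT (ord1 u); apply/eqP; exact: ord1.
Qed.

(* The self-map of the rose inducing f on the fundamental group. *)
Definition rose_map n (f : free_group n -> free_group n) :
  cmap (rose n) (rose n).
Proof.
exists id (fun i => repr (f (free_gen i))).
abstract by move=> e; exact: epath_rose.
Defined.

Lemma rose_map_word n (f : {multiplicative free_group n -> free_group n})
    (w : word 'I_n) :
  \pi_(free_group n) (fword (rose_map f) w) = f (\pi_(free_group n) w).
Proof.
have clsM (u v : word 'I_n) : \pi_(free_group n) (u ++ v) =
    (\pi_(free_group n) u * \pi_(free_group n) v)%g.
  exact/esym/free_mulE.
have clsV (u : word 'I_n) : \pi_(free_group n) (inv_word u) =
    (\pi_(free_group n) u)^-1%g.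
  exact/esym/free_invE.
have cls1 : \pi_(free_group n) [::] = 1%g by [].
have f1 : f 1%g = 1%g.
  by apply: (@mulgI _ (f 1%g)); rewrite -gmulfM !mulg1.
have fV x : f (x^-1)%g = (f x)^-1%g.
  by apply: (@mulgI _ (f x)); rewrite -gmulfM !mulgV.
elim: w => [|d w IHw]; first by rewrite cls1 f1.
rewrite -cat1s clsM gmulfM -IHw /fword /= clsM; congr (_ * _)%g.
rewrite /fletter; case: d => i [] /=; last by rewrite reprK.
rewrite clsV reprK -fV; congr (f _).
by rewrite /free_gen -clsV.
Qed.

Lemma rose_map_comp n (f g : {multiplicative free_group n -> free_group n})
    (k : free_group n -> free_group n) :
  (forall x, f (g x) = k x) ->
  homotopic (comp_cmap (rose_map f) (rose_map g)) (rose_map k).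
Proof.
move=> fgk; apply: homotopic_eq => // e /=.
by apply/clsP; rewrite rose_map_word !reprK fgk.
Qed.

Lemma rose_map_id n : homotopic (@rose_map n id) (id_cmap (rose n)).
Proof. by apply: homotopic_eq => // e /=; exact: repr_cls. Qed.

Lemma rose_map_heq n (f : aut n) : homotopy_equivalence (rose_map f).
Proof.
have [g fK gK] := aut_bij f.
have gM : {morph g : x y / (x * y)%g}.
  by move=> x y; apply: (bij_inj (aut_bij f)); rewrite gmulfM !gK.
pose g' : {multiplicative free_group n -> free_group n} :=
  HB.pack g (isMultiplicative.Build _ _ g gM).
exists (rose_map g'); split.
  by apply: homotopic_trans (rose_map_id n); exact: (@rose_map_comp n g' f id).
by apply: homotopic_trans (rose_map_id n); exact: (@rose_map_comp n f g' id).
Qed.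

Lemma rose_map_inner n (f g : aut n) :
  inner_related f g -> homotopic (rose_map f) (rose_map g).
Proof.
move=> [y gE]; exists (fun=> repr y); split=> [v|e]; first exact: epath_rose.
apply/clsP; rewrite /= -!free_mulE !reprK gE.
by change ((f (free_gen e) * y)%g = (y * (f (free_gen e) ^ y))%g);
  rewrite conjgE mulgA mulgV mul1g.
Qed.

(* A set H of edges stands for the subgraph that is its closure, with vertex  *)
(* set [support H].                                                           *)
Section Subgraphs.
Variable G : graph.
Implicit Types H F : {set 'I_(ne G)}.

Definition adjacent H : rel 'I_(nv G) := fun u v =>
  [exists e in H, ((src e == u) && (tgt e == v)) ||
                  ((src e == v) && (tgt e == u))].

Definition support H : {set 'I_(nv G)} :=
  [set v | [exists e in H, (src e == v) || (tgt e == v)]]%SET.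

Definition components (W : {set 'I_(nv G)}) H : nat := n_comp (adjacent H) W.

Definition core H : bool :=
  [forall e in H, components (support H) (H :\ e) <= components (support H) H]%N.

(* Rank of H_1(H) = ker (boundary : C_1(H) -> C_0), with the edges of H       *)
(* listed by enum_val.                                                        *)
Definition boundary_mx H : 'M[rat]_(#|H|, nv G) :=
  \matrix_(i, v) ((tgt (enum_val i) == v)%:R - (src (enum_val i) == v)%:R).

Definition h1_rank H : nat := \rank (kermx (boundary_mx H)).

Definition loop_in F (v : 'I_(nv G)) (p : word 'I_(ne G)) : bool :=
  [&& p != [::], epath v p v, all (fun d => d.1 \in F) p,
      uniq (map fst p) & uniq (map (@org G) p)].

Definition forest F : Prop := forall v p, ~~ loop_in F v p.

Definition valence (v : 'I_(nv G)) : nat :=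
  #|[set d : 'I_(ne G) * bool | org d == v]%SET|.

Definition admissible : Prop :=
  [/\ components [set: 'I_(nv G)]%SET [set: 'I_(ne G)]%SET = 1%N,
      (forall v, valence v != 1%N /\ valence v != 2%N)
    & (forall e, components [set: 'I_(nv G)]%SET [set~ e]%SET = 1%N)].

Definition cores : Type :=
  {A : {set 'I_(ne G)} | core A && (A != finset.set0)}.

End Subgraphs.

Section Collapses.
Variables (G H : graph) (k : cmap G H).

Definition collapsed : {set 'I_(ne G)} := [set e | fe k e == [::]]%SET.

Definition image_edges (A : {set 'I_(ne G)}) : {set 'I_(ne H)} :=
  [set e' | [exists e in A, e' \in map fst (fe k e)]]%SET.

(* k shrinks each component of the forest of collapsed edges to a vertex and  *)
(* identifies the other edges with the edges of H.                            *)
Definition forest_collapse : Prop :=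
  [/\ forest collapsed,
      (forall u v, (fv k u == fv k v) = connect (adjacent collapsed) u v),
      (forall v', exists v, fv k v = v'),
      (forall e, (size (fe k e) <= 1)%N)
    & (forall e', exists! e, e' \in map fst (fe k e))].

(* The length function of G obtained from one of H by giving length 0 to the  *)
(* collapsed edges: the sum has at most one term when k is a collapse.        *)
Definition pull_lengths (R : realType) (x : 'rV[R]_(ne H)) : 'rV[R]_(ne G) :=
  \row_e \sum_(d <- fe k e) x 0 d.1.

End Collapses.

Record mgraph (n : nat) := MGraph {
  mg_graph :> graph;
  mg_admissible : admissible mg_graph;
  mg_marking : cmap (rose n) mg_graph;
  mg_heq : homotopy_equivalence mg_marking }.

HB.instance Definition _ n := gen_eqMixin (mgraph n).
HB.instance Definition _ n := gen_choiceMixin (mgraph n).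

(* Morphisms of the category of marked graphs and forest collapses; those     *)
(* that collapse nothing are the isomorphisms.                                *)
Definition mg_collapse n (X Y : mgraph n) (k : cmap X Y) : Prop :=
  forest_collapse k /\
  homotopic (comp_cmap k (mg_marking X)) (mg_marking Y).

Definition mg_act n (X : mgraph n) (f : aut n) : mgraph n :=
  MGraph (mg_admissible X) (heq_comp (mg_heq X) (rose_map_heq f)).

Lemma mg_act_collapse n (X Y : mgraph n) (k : cmap X Y) (f : aut n) :
  mg_collapse k -> @mg_collapse n (mg_act X f) (mg_act Y f) k.
Proof.
move=> [kf kh]; split=> //=.
by apply: homotopic_trans (comp_cmapA _ _ _) _; exact: homotopic_compr.
Qed.

Section Simplices.
Variables (R : realType) (G : graph).
Local Notation lengths := 'rV[R]_(ne G).

Definition open_simplex : set lengths :=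
  [set x | (forall e, 0 < x 0 e) /\ \sum_e x 0 e = 1].

(* sigma(A), as a face of sigma(G): functions on A are extended by 0. *)
Definition simplex (A : {set 'I_(ne G)}) : set lengths :=
  [set x | [/\ forall e, 0 <= x 0 e, forall e, e \notin A -> x 0 e = 0
             & \sum_(e in A) x 0 e = 1]].

Definition simplex_bar : set lengths :=
  [set x | simplex [set: 'I_(ne G)]%SET x /\ forest [set e | x 0 e == 0]%SET].

Definition jewel (c : nat -> R) : set lengths :=
  [set x | simplex [set: 'I_(ne G)]%SET x /\
     forall A, core A -> A != finset.set0 ->
       c (h1_rank A) <= \sum_(e in A) x 0 e].

Definition rescale (A : {set 'I_(ne G)}) (x : lengths) : lengths :=
  \row_e (if e \in A then x 0 e / \sum_(e' in A) x 0 e' else 0).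

Definition core_product : Type := prod_topology (fun _ : cores G => lengths).
HB.instance Definition _ := Topological.on core_product.

Definition core_simplices : set core_product :=
  [set s | forall A : cores G, simplex (val A) (s A)].

Definition core_embedding (x : lengths) : core_product :=
  fun A => rescale (val A) x.

(* Closure in the subspace core_simplices. *)
Definition Sigma_space : set core_product :=
  core_simplices `&` closure (core_embedding @` open_simplex).

End Simplices.

Lemma collapsed_id G : collapsed (id_cmap G) = finset.set0.
Proof. by apply/setP=> e; rewrite !inE. Qed.

Lemma forest0 G : forest (finset.set0 : {set 'I_(ne G)}).
Proof. by move=> v [|d p]; rewrite /loop_in //= finset.in_set0 !andbF. Qed.

Lemma forest_collapse_id G : forest_collapse (id_cmap G).
Proof.
rewrite /forest_collapse collapsed_id; split=> [|u v|v|e|e] //=.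
- exact: forest0.
- apply/idP/idP => [/eqP->|/connectP[[|w p] /= + ->]] //.
  by move=> /andP[/existsP[e]]; rewrite finset.in_set0.
- by exists v.
- by exists e; split=> [|e']; rewrite inE // => /eqP.
Qed.

Lemma pull_id (R : realType) G (x : 'rV[R]_(ne G)) :
  pull_lengths (id_cmap G) x = x.
Proof. by apply/rowP=> e; rewrite mxE big_seq1. Qed.

Lemma mg_act_inner n (X : mgraph n) (f g : aut n) :
  inner_related f g -> @mg_collapse n (mg_act X f) (mg_act X g) (id_cmap X).
Proof.
move=> fg; split; first exact: forest_collapse_id.
apply: homotopic_trans (comp_id_cmap _) _.
exact/homotopic_compl/rose_map_inner.
Qed.

Section OuterSpace.
Variables (R : realType) (n : nat).

Record metric_mgraph := MetricMGraph {
  mm_mgraph :> mgraph n;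
  mm_length : 'rV[R]_(ne mm_mgraph);
  mm_open : open_simplex mm_length }.

HB.instance Definition _ := gen_eqMixin metric_mgraph.
HB.instance Definition _ := gen_choiceMixin metric_mgraph.

(* There are no bivalent vertices, so isometries map vertices to vertices.    *)
Definition isometric (X Y : metric_mgraph) : Prop :=
  exists k : cmap X Y,
    [/\ mg_collapse k, collapsed k = finset.set0
      & mm_length X = pull_lengths k (mm_length Y)].

Definition outer_space : Type := {quot isometric}.

HB.instance Definition _ := EqQuotient.on outer_space.
HB.instance Definition _ := Choice.on outer_space.

(* p is the point of outer space that x in simplex_bar X stands for, namely   *)
(* the marked graph obtained by collapsing the edges of X of length 0.        *)
Definition represents (X : mgraph n) (x : 'rV[R]_(ne X)) (p : outer_space) :
    Prop :=
  exists (Y : metric_mgraph) (k : cmap X Y),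
    [/\ p = \pi_outer_space Y, mg_collapse k
      & x = pull_lengths k (mm_length Y)].

(* Final topology for the maps simplex_bar X -> outer_space. *)
Definition outer_open (U : set outer_space) : Prop :=
  forall X : mgraph n, exists2 W : set 'rV[R]_(ne X), open W &
    forall x p, simplex_bar x -> represents x p -> (U p <-> W x).

Lemma outer_openT : outer_open setT.
Proof. by move=> X; exists setT => //; exact: openT. Qed.

Lemma outer_openI (U V : set outer_space) :
  outer_open U -> outer_open V -> outer_open (U `&` V).
Proof.
move=> oU oV X; have [A oA UA] := oU X; have [B oB VB] := oV X.
exists (A `&` B); first exact: openI.
by move=> x p bx xp; split=> -[] /(UA _ _ bx xp) ? /(VB _ _ bx xp).
Qed.

Lemma outer_open_bigU (I : Type) (f : I -> set outer_space) :
  (forall i, outer_open (f i)) -> outer_open (\bigcup_i f i).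
Proof.
move=> of_ X.
have /choice[W hW] (i : I) : exists A : set 'rV[R]_(ne X), open A /\
    forall x p, simplex_bar x -> represents x p -> (f i p <-> A x).
  by have [A oA fA] := of_ i X; exists A.
exists (\bigcup_i W i); first by apply: bigcup_open => i _; exact: (hW i).1.
move=> x p bx xp; split=> -[i _ /((hW i).2 _ _ bx xp) ?]; by exists i.
Qed.

HB.instance Definition _ :=
  isOpenTopological.Build outer_space outer_openT outer_openI outer_open_bigU.

Definition mm_act (X : metric_mgraph) (f : aut n) : metric_mgraph :=
  @MetricMGraph (mg_act X f) (mm_length X) (mm_open X).

(* Right action (G, g) . w = (G, g o w); outer_actE shows that it does not    *)
(* depend on the representatives.                                             *)
Definition outer_act (p : outer_space) (w : out n) : outer_space :=
  \pi_outer_space (mm_act (repr p) (repr w)).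

Lemma outer_actE (X : metric_mgraph) (f : aut n) :
  outer_act (\pi_outer_space X) (\pi_(out n) f) =
  \pi_outer_space (mm_act X f).
Proof.
apply/quotP; rewrite /outer_act.
have step1 (Y Z : metric_mgraph) g :
    isometric Y Z -> isometric (mm_act Y g) (mm_act Z g).
  by move=> [k [kc k0 kl]]; exists k; split=> //; exact: mg_act_collapse.
apply: (rst_trans _ _ _ (mm_act X (repr (\pi_(out n) f)))).
  apply: (clos_map (f := mm_act^~ _)) (quot_repr _ X) => Y Z YZ.
  by apply: rst_step; exact: step1.
apply: clos_map (quot_repr _ f) => g h gh; apply: rst_step.
exists (id_cmap X); rewrite collapsed_id pull_id; split=> //.
exact: mg_act_inner.
Qed.

End OuterSpace.

Section JewelSpace.
Variables (R : realType) (n : nat) (c : nat -> R).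

Definition jewel_set : set (outer_space R n) :=
  [set p | exists (X : mgraph n) (x : 'rV[R]_(ne X)),
             jewel c x /\ represents x p].

Definition jewel_space : Type := set_type jewel_set.
HB.instance Definition _ := Topological.on jewel_space.

Lemma jewel_set_act (p : outer_space R n) (w : out n) :
  jewel_set p -> jewel_set (outer_act p w).
Proof.
move=> [X [x [jx [Y [k [-> kc xE]]]]]].
exists (mg_act X (repr w)), x; split=> //.
exists (mm_act Y (repr w)), k; split; last exact: xE.
  by rewrite -outer_actE reprK.
exact: mg_act_collapse.
Qed.

Definition jewel_act (p : jewel_space) (w : out n) : jewel_space :=
  SigSub (mem_set (jewel_set_act w (set_mem (valP p)))).

End JewelSpace.

Section Bordification.
Variables (R : realType) (n : nat).

Definition bord_pieces : Type :=
  {X : mgraph n & set_type (@Sigma_space R X)}.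
HB.instance Definition _ := Topological.on bord_pieces.

(* s in Sigma(X) is the image of t in Sigma(Y) under the inclusion induced by *)
(* a collapse k : X -> Y. Each core A of X has exactly one B = k(A) here.     *)
Definition bord_glue (s t : bord_pieces) : Prop :=
  exists k : cmap (tag s) (tag t), mg_collapse k /\
    forall (A : cores (tag s)) (B : cores (tag t)),
      image_edges k (val A) = val B ->
      val (tagged s) A = pull_lengths k (val (tagged t) B).

Definition bordification : Type := quotient_topology {quot bord_glue}.
HB.instance Definition _ := Topological.on bordification.
HB.instance Definition _ := Quotient.on bordification.

Definition piece_act (s : bord_pieces) (f : aut n) : bord_pieces :=
  existT (fun X : mgraph n => set_type (@Sigma_space R X))
    (mg_act (tag s) f) (tagged s).

Definition bord_act (p : bordification) (w : out n) : bordification :=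
  \pi_bordification (piece_act (repr p) (repr w)).

Lemma bord_actE (s : bord_pieces) (f : aut n) :
  bord_act (\pi_bordification s) (\pi_(out n) f) =
  \pi_bordification (piece_act s f).
Proof.
apply/quotP.
apply: (rst_trans _ _ _ (piece_act s (repr (\pi_(out n) f)))).
  apply: (clos_map (f := piece_act^~ _)) (quot_repr _ s) => a b [k [kc ab]].
  by apply: rst_step; exists k; split=> //; exact: mg_act_collapse.
apply: clos_map (quot_repr _ f) => g h gh; apply: rst_step.
exists (id_cmap (tag s)); split; first exact: mg_act_inner.
move=> A B; rewrite pull_id => AB; congr (val (tagged s) _).
apply: val_inj; rewrite -AB; apply/setP=> e; rewrite inE.
by apply/idP/existsP => [eA|[e' /andP[e'A]]];
  [exists e; rewrite eA inE/= eqxx|rewrite inE/= => /eqP->].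
Qed.

End Bordification.

Definition homeomorphism (S T : topologicalType) (h : S -> T) : Prop :=
  continuous h /\
  exists g : T -> S, [/\ continuous g, cancel h g & cancel g h].

(* c_n < eps renders c_n << 1; only the values c 1, ..., c n matter. *)
Definition jewel_constants (R : realType) (n : nat) (eps : R) (c : nat -> R) :
    Prop :=
  [/\ 0 < c 1%N, c n < eps
    & forall r, (1 <= r < n)%N -> c r < c r.+1 /\ 2 * c r < c r.+1].

(* Main.v *)
(** Let f(S) = c_r for an edge set S of G with r = rank H_1(S) < n, where c_0 = 0,
    and f(S) = 1 if r = n.  The condition c_(r+1) > 2 c_r makes f supermodular, and
      J(G) = {x >= 0 | x(E) = 1, x(A) >= f(A) for every core A}.
    Let w be the Moebius inverse of f: f(S) is the sum of w_A over A <= S.  It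
    is supported on cores (but may be negative), and J(G) is the signed
    Minkowski sum of the simplices w_A sigma(A).  As in toric geometry, the
    moment map
      s |-> sum_A w_A s_A
    is a homeomorphism from Sigma(G) onto J(G).  Indeed, on positive lengths
      sum_i u_i (mu_i(y) - mu_i(x)) =
        1/2 sum_(i,j) (u_i - u_j) (y_i x_j - x_i y_j) K_ij,
      K_ij = sum_(A containing i, j) w_A / (x(A) y(A)),
    and K_ij is bounded below by a positive multiple of 1 / (x(E) y(E)), because
    A |-> 1 / (x(A) y(A)) is completely monotone and the second differences of f
    are >= 0.  Taking for u the indicator of {y >= x} gives a Lipschitz bound for
    the inverse that survives passage to the closure, hence injectivity; taking
    for u the vector from mu(x) to a target point shows that the nearest point
    to an interior target cannot differ from it, hence surjectivity.  Finally f
    depends on ranks only, so that the moment map commutes with forest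
    collapses, and the homeomorphisms J(G) = Sigma(G) glue. *)
From Stdlib Require Import Relation_Operators.
From mathcomp Require Import all_boot all_order all_algebra.
From mathcomp Require Import all_classical all_reals all_analysis.
From mathcomp Require Import ring lra zify.
Require Import Defs.
Import Order.TTheory GRing.Theory Num.Theory.
Import numFieldNormedType.Exports.
Local Open Scope ring_scope.

Set Implicit Arguments.
Unset Strict Implicit.
Unset Printing Implicit Defensive.

(** * Set functions *)

Section SetFunctions.
Import mathcomp.boot.fintype mathcomp.boot.finset.
Variables (R : realFieldType) (I : finType).
Implicit Types (A B D S T : {set I}) (f g v w : {set I} -> R) (x : I -> R).

(** Homeomorphisms chosen cell by cell would have to be matched on all common faces. A closed
    formula avoids this: agreement on faces reduces to the weights of a graph pushing forward to
    those of its quotient. The price is that the weights have no sign, so nothing can be estimated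
    summand by summand. Sign information is available only for sums of weights over all subsets of a
    set, that is for [f] and its differences, and is exploited by summation by parts. This is why
    [f] lives on all edge sets: supermodularity speaks of intersections, and two cores need not meet
    in a core, while the inequalities added for other sets follow from those for cores. The second
    obstacle is the boundary of [Sigma_space], where metrics on small cores are not determined by
    the metric of the graph. Injectivity has to recover them stratum by stratum, each time from the
    core on which the previous metric vanishes. For surjectivity, descent works only at honest
    metrics, so a target is approached along a segment through the interior of the polytope. *)

Lemma sum_subsetU1 (V : nmodType) (F : {set I} -> V) e D : e \notin D ->
  \sum_(A : {set I} | A \subset e |: D) F A =
  \sum_(A : {set I} | A \subset D) F A +
  \sum_(A : {set I} | A \subset D) F (e |: A).
Proof.
move=> eD; rewrite (bigID (fun A : {set I} => e \in A)) /= addrC; congr (_ + _).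
  apply: eq_bigl => A; apply/andP/idP => [[AD eA]|AD].
    apply/subsetP => i iA; have := subsetP AD i iA; rewrite !inE.
    by case/orP => // /eqP ie; rewrite -ie iA in eA.
  split; first by apply: subset_trans AD _; exact: subsetUr.
  by apply: contra eD => /(subsetP AD).
rewrite (reindex_onto (fun A => e |: A) (fun A => A :\ e)) /=; last first.
  by move=> A /andP[_ eA]; rewrite setD1K.
apply: eq_bigl => A; apply/idP/idP => [/andP[/andP[AD _] /eqP AE]|AD].
  apply/subsetP => i; rewrite -AE !inE => /andP[ie /orP[/eqP ei|iA]].
    by rewrite ei eqxx in ie.
  have := subsetP AD i; rewrite !inE iA orbT => /(_ isT).
  by rewrite (negbTE ie).
have eA : e \notin A by apply: contra eD => /(subsetP AD).
by rewrite setUS //= setU11 setU1K // eqxx.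
Qed.

Lemma mobius_exists f :
  exists w, forall S, \sum_(A : {set I} | A \subset S) w A = f S.
Proof.
suff H k : exists w, forall S, (#|S| <= k)%N ->
    \sum_(A : {set I} | A \subset S) w A = f S.
  have [w wf] := H #|I|; exists w => S; apply: wf; exact: max_card.
elim: k => [|k [w wf]].
  exists f => S; rewrite leqn0 cards_eq0 => /eqP->.
  by rewrite (big_pred1 set0) // => A /=; rewrite subset0.
(* Values on sets of at most [k] elements are final; the larger sets follow the recursion, which
   replaces the alternating formula. *)
pose w' A := if (#|A| <= k)%N then w A
  else f A - \sum_(B : {set I} | B \proper A) w B.
exists w' => S; rewrite leq_eqVlt => /orP[/eqP cS|]; last first.
  rewrite ltnS => cS; rewrite -(wf S cS); apply: eq_bigr => A AS.
  by rewrite /w' (leq_trans (subset_leq_card AS)).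
rewrite (bigD1 S) //= {1}/w' cS ltnn.
rewrite -[RHS]addr0 -addrA; congr (_ + _); apply/eqP.
rewrite addrC subr_eq0; apply/eqP.
transitivity (\sum_(A : {set I} | (A \subset S) && (A != S)) w A).
  apply: eq_bigr => A /andP[AS nAS]; rewrite /w'.
  have : (#|A| < #|S|)%N by apply: proper_card; rewrite properEneq nAS.
  by rewrite cS ltnS => ->.
by apply: eq_bigl => A; rewrite properEneq andbC.
Qed.

Lemma mobius_unique v w :
  (forall S, \sum_(A : {set I} | A \subset S) v A =
             \sum_(A : {set I} | A \subset S) w A) -> v =1 w.
Proof.
move=> vw A; have [k] := ubnP #|A|; elim: k A => // k IH A; rewrite ltnS => cA.
have := vw A; rewrite (bigD1 A) //= [in RHS](bigD1 A) //=.
rewrite (eq_bigr w); first by move/addIr.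
move=> B /andP[BA nBA]; apply: IH.
by apply: leq_trans cA; apply: proper_card; rewrite properEneq nBA.
Qed.

(* Generators of the set functions all of whose iterated differences           *)
(* f A - f (e |: A) are >= 0.                                                  *)
Inductive cmono : ({set I} -> R) -> Prop :=
| CMconst c : 0 <= c -> cmono (fun=> c)
| CMnotin e : cmono (fun A => (e \notin A)%:R)
| CMinv a x : 0 < a -> (forall i, 0 <= x i) ->
    cmono (fun A => (a + \sum_(i in A) x i)^-1)
| CMmul f g : cmono f -> cmono g -> cmono (fun A => f A * g A)
| CMadd f g : cmono f -> cmono g -> cmono (fun A => f A + g A)
| CMext f g : f =1 g -> cmono f -> cmono g.

Lemma cmono_ge0 g : cmono g -> forall A, 0 <= g A.
Proof.
elim=> {g} [c c0 _|e A|a x a0 x0 A|f g _ f0 _ g0 A|f g _ f0 _ g0 A|f g fg _ f0 A] //.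
- by rewrite invr_ge0 addr_ge0 ?(ltW a0) // sumr_ge0.
- exact: mulr_ge0.
- exact: addr_ge0.
- by rewrite -fg.
Qed.

Lemma sum_setU1_split x e A :
  \sum_(i in e |: A) x i = x e + \sum_(i in A) (if i == e then 0 else x i).
Proof.
rewrite (bigD1 e) ?setU11 //=; congr (_ + _).
rewrite [RHS](bigID (fun i => i == e)) /= [X in _ = X + _]big1 ?add0r; last first.
  by move=> i /andP[_ ->].
apply: eq_big => [i|i /andP[_ /negbTE->] //].
by rewrite !inE; case: (i == e); rewrite ?andbF ?andbT.
Qed.

Lemma cmono_shift e g : cmono g -> cmono (fun A => g (e |: A)).
Proof.
elim=> {g} [c c0|d|a x a0 x0|f g _ ff _ gg|f g _ ff _ gg|f g fg _ ff].
- exact: CMconst.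
- apply: (CMext (f := fun A => (d != e)%:R * (d \notin A)%:R)).
    by move=> A; rewrite !inE negb_or -natrM mulnb.
  by apply: CMmul; [apply: CMconst; rewrite ler0n|exact: CMnotin].
- apply: (CMext (f := fun A => (a + x e +
      \sum_(i in A) (if i == e then 0 else x i))^-1)).
    by move=> A; rewrite sum_setU1_split addrA.
  by apply: CMinv => [|i]; [exact: ltr_wpDr|case: ifP].
- exact: (CMmul ff gg).
- exact: (CMadd ff gg).
- by apply: CMext ff => A; rewrite fg.
Qed.

(** The generators are chosen to make this an induction: products obey a Leibniz rule, and the
    difference of a reciprocal is a product of generators. *)
Lemma cmono_diff e g : cmono g -> cmono (fun A => g A - g (e |: A)).
Proof.
elim=> {g} [c c0|d|a x a0 x0|f g cf ff cg gg|f g _ ff _ gg|f g fg _ ff].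
- by apply: (CMext (f := fun=> 0)); [move=> A; rewrite subrr|exact: CMconst].
- apply: (CMext (f := fun A => (d == e)%:R * (d \notin A)%:R)).
    move=> A; rewrite !inE negb_or; case: eqP => /= _;
    by rewrite ?mul0r ?mul1r ?subrr ?subr0.
  by apply: CMmul; [apply: CMconst; rewrite ler0n|exact: CMnotin].
- pose P A := (a + \sum_(i in A) x i)^-1.
  have cP : cmono P by exact: CMinv.
  (* The indicator of [e \notin A] is a generator for the sake of this case: the difference vanishes
     once [e] is in [A]. *)
  apply: (CMext (f := fun A => x e * (e \notin A)%:R * (P A * P (e |: A)))).
    move=> A; rewrite /P; have [eA|eA] := boolP (e \in A) => /=.
      by rewrite mulr0 mul0r (setUidPr _) ?subrr // sub1set.
    rewrite mulr1 big_setU1 //=.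
    have s0 : 0 < a + \sum_(i in A) x i by rewrite ltr_wpDr // sumr_ge0.
    have := x0 e; move: s0; move: (\sum_(i in A) x i) (x e) => s y s0 y0.
    by field; rewrite !lt0r_neq0 //; lra.
  apply: CMmul; last by apply: CMmul => //; exact: (cmono_shift e cP).
  by apply: CMmul; [exact: CMconst|exact: CMnotin].
- apply: (CMext (f := fun A => (f A - f (e |: A)) * g A +
      f (e |: A) * (g A - g (e |: A)))) => [A|]; first by ring.
  by apply: CMadd; apply: CMmul => //; exact: cmono_shift.
- by apply: CMext (CMadd ff gg) => A; ring.
- by apply: CMext ff => A; rewrite !fg.
Qed.

(** Abel summation on the lattice of subsets. Individual weights [v A] may be negative; only their
    sums over all subsets of each [S] have a sign. *)
Lemma cmono_sum_ge D g v : cmono g ->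
  (forall S, S \subset D -> 0 <= \sum_(A : {set I} | A \subset S) v A) ->
  (\sum_(A : {set I} | A \subset D) v A) * g D <=
  \sum_(A : {set I} | A \subset D) v A * g A.
Proof.
have [k] := ubnP #|D|; elim: k D g v => // k IH D g v; rewrite ltnS => cD cg v0.
have [->|[e eD]] := set_0Vmem D.
  by rewrite !(big_pred1 set0) // => A /=; rewrite subset0.
have ne : e \notin D :\ e by rewrite !inE eqxx.
have cD' : (#|D :\ e| < k)%N.
  by apply: leq_trans cD; rewrite (cardsD1 e D) eD.
rewrite -(setD1K eD); set D' := D :\ e in ne cD' *.
rewrite !sum_subsetU1 // -big_split /=.
have D'D : D' \subset D by exact: subD1set.
have H1 := IH D' _ (fun A => v A + v (e |: A)) cD' (cmono_shift e cg).
have H2 := IH D' _ v cD' (cmono_diff e cg).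
have {}H1 := H1 _; have {}H2 := H2 _.
(* Pair [A] with [A' = e |: A] and write v_A g_A + v_A' g_A' = (v_A + v_A') g_A' + v_A (g_A - g_A').
   By induction the first part is at least the claimed bound and the second is nonnegative. *)
apply: le_trans (_ : \sum_(A : {set I} | A \subset D') (v A + v (e |: A)) * g (e |: A) +
   \sum_(A : {set I} | A \subset D') v A * (g A - g (e |: A)) <= _); last first.
  rewrite -!big_split /=; apply: ler_sum => A _; rewrite le_eqVlt.
  by apply/orP; left; apply/eqP; ring.
rewrite -[leLHS]addr0; apply: lerD.
  apply: H1 => S SD; rewrite big_split /= -sum_subsetU1.
    by apply: v0; rewrite subUset sub1set eD (subset_trans SD).
  by apply: contra ne => /(subsetP SD).
apply: le_trans (H2 _) => [|S SD]; last first.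
  by apply: v0; exact: subset_trans D'D.
by apply: mulr_ge0; [exact: v0|exact: (cmono_ge0 (cmono_diff e cg))].
Qed.

End SetFunctions.

(** * The moment map on positive lengths *)

Section MomentMap.
Import mathcomp.boot.fintype mathcomp.boot.finset.
Variables (R : realFieldType) (I : finType) (f w : {set I} -> R).
Implicit Types (A B D S T : {set I}) (x y u : I -> R).

Hypothesis f_super : forall S T, f S + f T <= f (S :|: T) + f (S :&: T).
Hypothesis f0 : f finset.set0 = 0.
Hypothesis wf : forall S, \sum_(A : {set I} | A \subset S) w A = f S.

(** The map of interest has [D = setT]. Smaller [D] occur at the boundary, where edges whose length
    tends to 0 see only the sets inside a subgraph. *)
Definition moment D x e : R :=
  \sum_(A : {set I} | A \subset D) w A * (e \in A)%:R * (x e / \sum_(i in A) x i).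

Lemma mobius_notin i S :
  \sum_(A : {set I} | A \subset S) w A * (i \notin A)%:R = f (S :\ i).
Proof.
rewrite -wf (bigID (fun A => i \in A)) /= big1 ?add0r; last first.
  by move=> A /andP[_ ->]; rewrite mulr0.
apply: eq_big => [A|A /andP[_ ->]]; last by rewrite mulr1.
by rewrite subsetD1.
Qed.

Lemma mobius_in i S :
  \sum_(A : {set I} | A \subset S) w A * (i \in A)%:R = f S - f (S :\ i).
Proof.
apply/eqP; rewrite eq_sym subr_eq -mobius_notin -big_split /= -wf.
by apply/eqP/eq_bigr => A _; case: (i \in A); rewrite /=; ring.
Qed.

Lemma mobius_in2 i j S :
  \sum_(A : {set I} | A \subset S) w A * (i \in A)%:R * (j \in A)%:R =
  f S - f (S :\ i) - f (S :\ j) + f (S :\ i :\ j).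
Proof.
have -> : f S - f (S :\ i) - f (S :\ j) + f (S :\ i :\ j) =
  (f S - f (S :\ i)) - (f (S :\ j) - f (S :\ j :\ i)).
  by rewrite [S :\ j :\ i]setDDl [S :\ i :\ j]setDDl finset.setUC; ring.
rewrite -!mobius_in.
rewrite (bigID (fun A : {set I} => j \in A)) /= [X in _ = X - _](bigID (fun A : {set I} => j \in A)) /=.
rewrite [X in _ + X]big1 ?addr0 => [|A /andP[_ /negbTE->]]; last by rewrite mulr0.
rewrite [X in _ + X - _](_ : _ =
    \sum_(A : {set I} | A \subset S :\ j) w A * (i \in A)%:R).
  by rewrite addrK; apply: eq_bigr => A /andP[_ ->]; rewrite mulr1.
by apply: eq_bigl => A; rewrite subsetD1.
Qed.

(** Supermodularity for [S] and [T :\ i], whose union is [T] and whose intersection is [S :\ i]. *)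
Lemma marginal_mono i S T : S \subset T -> i \in S ->
  f S - f (S :\ i) <= f T - f (T :\ i).
Proof.
move=> ST iS; have := f_super S (T :\ i).
have -> : S :|: T :\ i = T.
  apply/setP=> k; rewrite !inE; case: eqP => [->|_] /=.
    by rewrite iS (subsetP ST).
  by case kS: (k \in S) => //=; rewrite (subsetP ST).
have -> : S :&: (T :\ i) = S :\ i.
  apply/setP=> k; rewrite !inE; case: eqP => //= _; rewrite ?andbF //.
  by case kS: (k \in S) => //=; rewrite (subsetP ST).
lra.
Qed.

Lemma second_diff_ge0 i j S : i != j ->
  0 <= f S - f (S :\ i) - f (S :\ j) + f (S :\ i :\ j).
Proof.
move=> ij; have [iS|iS] := boolP (i \in S); last first.
  by rewrite [S :\ i](setDidPl _) 1?disjoint_sym ?disjoints1 //; lra.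
have := @marginal_mono i (S :\ j) S (subD1set _ _); rewrite !inE ij iS => /(_ isT).
by rewrite [S :\ j :\ i]setDDl [S :\ i :\ j]setDDl finset.setUC; lra.
Qed.

Section Positive.
Variables (x : I -> R).
Hypothesis x0 : forall i, 0 < x i.

(** Adjoining [i] keeps the sum positive for empty [A], with [x i] as the constant of [CMinv]. It
    changes nothing for the sets containing [i], the only ones weighted in [weighted_inv_ge]. *)
Lemma cmono_inv_sum i : cmono (fun A => (\sum_(j in i |: A) x j)^-1).
Proof.
apply: (CMext (f := fun A => (x i + \sum_(j in A) (if j == i then 0 else x j))^-1)).
  by move=> A; rewrite sum_setU1_split.
by apply: CMinv => // j; case: ifP => // _; exact: ltW.
Qed.

Lemma sum_pos_gt0 i A : i \in A -> 0 < \sum_(j in A) x j.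
Proof.
move=> iA; rewrite (bigD1 i) //= ltr_pwDl // sumr_ge0 // => j _; exact: ltW.
Qed.

Lemma weighted_inv_ge (v : {set I} -> R) (g : {set I} -> R) i D :
  cmono g -> i \in D ->
  (forall S, S \subset D ->
     0 <= \sum_(A : {set I} | A \subset S) v A * (i \in A)%:R) ->
  (\sum_(A : {set I} | A \subset D) v A * (i \in A)%:R) * (g D / \sum_(j in D) x j) <=
  \sum_(A : {set I} | A \subset D) v A * (i \in A)%:R * (g A / \sum_(j in A) x j).
Proof.
move=> cg iD v0; have := cmono_sum_ge (CMmul cg (cmono_inv_sum i)) v0.
rewrite (setUidPr _) ?sub1set //= => /le_trans; apply.
rewrite le_eqVlt; apply/orP; left; apply/eqP; apply: eq_bigr => A _.
have [iA|] := boolP (i \in A); last by rewrite mulr0 !mul0r.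
by rewrite (setUidPr _) ?sub1set.
Qed.

End Positive.

Lemma marginal_ge0 i S : (forall T, 0 <= f T) -> 0 <= f S - f (S :\ i).
Proof.
move=> fge0; have [iS|iS] := boolP (i \in S); last first.
  by rewrite [S :\ i](setDidPl _) 1?disjoint_sym ?disjoints1 ?subrr.
have := @marginal_mono i [set i]%SET S.
rewrite sub1set iS inE eqxx => /(_ isT isT).
have -> : [set i]%SET :\ i = finset.set0.
  by apply/setP => k; rewrite !inE; case: eqP.
by have := fge0 [set i]%SET; rewrite f0; lra.
Qed.

Lemma moment_ge D x i : (forall j, 0 < x j) -> (forall T, 0 <= f T) ->
  i \in D ->
  (f D - f (D :\ i)) * (x i / \sum_(j in D) x j) <= moment D x i.
Proof.
move=> x0 fge0 iD; have := @weighted_inv_ge x x0 w (fun=> x i) i D _ iD.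
rewrite mobius_in; apply; first by apply: CMconst; exact: ltW.
by move=> S _; rewrite mobius_in; exact: marginal_ge0.
Qed.

(** The weights of sets not inside [B] have as partial sums the increase of the marginal of [i] from
    [S :&: B] to [S], nonnegative by supermodularity. Summed over [i] in a core [B], the bound
    yields the inequality of the polytope for [B]. *)
Lemma moment_sub_ge D B x i : (forall j, 0 < x j) ->
  B \subset D -> i \in B ->
  ((f D - f (D :\ i)) - (f B - f (B :\ i))) * (x i / \sum_(j in D) x j) <=
  moment D x i - moment B x i.
Proof.
move=> x0 BD iB; have iD := subsetP BD i iB.
pose v A := w A * (~~ (A \subset B))%:R.
have vE S : \sum_(A : {set I} | A \subset S) v A * (i \in A)%:R =
    (f S - f (S :\ i)) - (f (S :&: B) - f ((S :&: B) :\ i)).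
  rewrite -!mobius_in (bigID (fun A : {set I} => A \subset B)) /=.
  rewrite [X in _ = X - _](bigID (fun A : {set I} => A \subset B)) /=.
  rewrite big1 ?add0r => [|A /andP[_ AB]]; last by rewrite /v AB mulr0 mul0r.
  rewrite addrC -[LHS]addr0 -[RHS]addrA; congr (_ + _).
    by apply: eq_bigr => A /andP[_ AB]; rewrite /v AB mulr1.
  apply/esym/eqP; rewrite subr_eq0; apply/eqP.
  by apply: eq_bigl => A; rewrite subsetI.
have := @weighted_inv_ge x x0 v (fun=> x i) i D _ iD.
rewrite vE (setIidPr BD) => /(_ _ _)/le_trans; apply.
- by apply: CMconst; exact: ltW.
- move=> S _; rewrite vE subr_ge0; have [iS|iS] := boolP (i \in S).
    by apply: marginal_mono; rewrite ?subsetIl // inE iS.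
  rewrite [S :\ i](setDidPl _) 1?disjoint_sym ?disjoints1 //.
  by rewrite [(S :&: B) :\ i](setDidPl _) 1?disjoint_sym ?disjoints1 ?inE ?(negbTE iS) // !subrr.
- rewrite /moment (bigID (fun A : {set I} => A \subset B)) /=.
  rewrite big1 ?add0r => [|A /andP[_ AB]]; last by rewrite /v AB mulr0 !mul0r.
  rewrite [X in _ <= X - _](bigID (fun A : {set I} => A \subset B)) /=.
  rewrite le_eqVlt; apply/orP; left; apply/eqP.
  rewrite [RHS]addrAC -[LHS]add0r; congr (_ + _).
    apply/esym/eqP; rewrite subr_eq0; apply/eqP; apply: eq_bigl => A.
    by rewrite andb_idl // => /subset_trans; apply.
  by apply: eq_bigr => A /andP[_ AB]; rewrite /v AB mulr1.
Qed.

Lemma sum_moment D x : (forall j, 0 < x j) -> \sum_(i in D) moment D x i = f D.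
Proof.
move=> x0; rewrite exchange_big /= -wf; apply: eq_bigr => A AD.
have [->|[i iA]] := set_0Vmem A.
  (* The empty set contributes nothing on the left, in agreement with its weight
     [f finset.set0 = 0]. *)
  rewrite big1 => [|i _]; last by rewrite inE mulr0 mul0r.
  rewrite -f0 -wf (big_pred1 finset.set0) // => B /=; exact: subset0.
rewrite (bigID (fun i => i \in A)) /= [X in _ + X]big1 ?addr0; last first.
  by move=> j /andP[_ /negbTE->]; rewrite mulr0 mul0r.
rewrite (eq_bigl (mem A)); last first.
  by move=> j; rewrite andb_idl //; exact: (subsetP AD).
rewrite (eq_bigr (fun j => (w A / \sum_(i in A) x i) * x j)); last first.
  by move=> j jA; rewrite (_ : j \in A)// mulr1 mulrA mulrAC.
by rewrite -mulr_sumr divfK // gt_eqF // (sum_pos_gt0 x0 iA).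
Qed.

Lemma antisym_sum (D : {set I}) (h : I -> I -> R) u :
  (forall i j, h j i = - h i j) ->
  \sum_(i in D) \sum_(j in D) (u i - u j) * h i j =
  2 * \sum_(i in D) \sum_(j in D) u i * h i j.
Proof.
move=> hN.
have -> : \sum_(i in D) \sum_(j in D) (u i - u j) * h i j =
  \sum_(i in D) \sum_(j in D) u i * h i j +
  \sum_(i in D) \sum_(j in D) - (u j * h i j).
  rewrite -big_split; apply: eq_bigr => i _; rewrite -big_split.
  by apply: eq_bigr => j _; rewrite mulrBl.
rewrite [X in _ + X]exchange_big /= mulr2n mulrDl !mul1r; congr (_ + _).
by apply: eq_bigr => i _; apply: eq_bigr => j _; rewrite hN mulrN opprK.
Qed.

(* Injectivity and surjectivity both rest on this identity; the inner sum is   *)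
(* >= 0 although the weights w A may be negative, see kernel_ge.               *)
Lemma moment_diff D x y u : (forall j, 0 < x j) -> (forall j, 0 < y j) ->
  2 * \sum_(i in D) u i * (moment D y i - moment D x i) =
  \sum_(i in D) \sum_(j in D) (u i - u j) * (y i * x j - x i * y j) *
    \sum_(A : {set I} | A \subset D) w A * (i \in A)%:R * (j \in A)%:R *
      ((\sum_(k in A) x k)^-1 * (\sum_(k in A) y k)^-1).
Proof.
move=> x0 y0.
pose c A := (\sum_(k in A) x k)^-1 * (\sum_(k in A) y k)^-1.
transitivity (\sum_(A : {set I} | A \subset D) w A * c A *
    (2 * \sum_(i in A) \sum_(j in A) u i * (y i * x j - x i * y j))).
  rewrite (eq_bigr (fun i => \sum_(A : {set I} | A \subset D)
    w A * (i \in A)%:R * (u i * (y i / \sum_(k in A) y k - x i / \sum_(k in A) x k)))).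
    rewrite exchange_big /= mulr_sumr; apply: eq_bigr => A AD.
    rewrite [in RHS]mulrCA; congr (_ * _).
    rewrite (bigID (fun i => i \in A)) /= [X in _ + X]big1 ?addr0; last first.
      by move=> j /andP[_ /negbTE->]; rewrite mulr0 mul0r.
    rewrite (eq_bigl (mem A)); last first.
      by move=> j; rewrite andb_idl //; exact: (subsetP AD).
    rewrite mulr_sumr; apply: eq_bigr => i iA; rewrite (_ : i \in A) // mulr1.
    rewrite -mulr_sumr sumrB -!mulr_sumr /c.
    have := sum_pos_gt0 x0 iA; have := sum_pos_gt0 y0 iA.
    move: (\sum_(k in A) x k) (\sum_(k in A) y k) => X Y Y0 X0.
    by field; rewrite !gt_eqF.
  move=> i _; rewrite /moment -sumrB mulr_sumr; apply: eq_bigr => A _; ring.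
transitivity (\sum_(A : {set I} | A \subset D) w A * c A *
   \sum_(i in A) \sum_(j in A) (u i - u j) * (y i * x j - x i * y j)).
  apply: eq_bigr => A _; congr (_ * _); rewrite antisym_sum // => i j; ring.
transitivity (\sum_(A : {set I} | A \subset D) \sum_(i in D) \sum_(j in D)
   (u i - u j) * (y i * x j - x i * y j) *
   (w A * (i \in A)%:R * (j \in A)%:R * c A)).
  apply: eq_bigr => A AD; rewrite mulr_sumr.
  rewrite [RHS](bigID (fun i => i \in A)) /= [X in _ = _ + X]big1 ?addr0; last first.
    by move=> i /andP[_ /negbTE->]; rewrite big1 // => j _; rewrite mulr0 !mul0r mulr0.
  apply: eq_big => [i|i iA]; first by rewrite andb_idl //; exact: (subsetP AD).
  rewrite mulr_sumr.
  rewrite [RHS](bigID (fun i => i \in A)) /= [X in _ = _ + X]big1 ?addr0; last first.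
    by move=> j /andP[_ /negbTE->]; rewrite mulr0 mul0r mulr0.
  apply: eq_big => [j|j jA]; first by rewrite andb_idl //; exact: (subsetP AD).
  by rewrite iA jA !mulr1 mulrC -!mulrA; congr (_ * _); rewrite mulrC -mulrA.
rewrite exchange_big /=; apply: eq_bigr => i _.
rewrite exchange_big /=; apply: eq_bigr => j _.
by rewrite mulr_sumr.
Qed.

(** With [j] put into the weights and the reciprocal of the [x]-length of [i |: A] as monotone
    factor, the partial sums to check are the second differences of [f]. *)
Lemma kernel_ge D x y i j : (forall j, 0 < x j) -> (forall j, 0 < y j) ->
  i \in D -> i != j ->
  (f D - f (D :\ i) - f (D :\ j) + f (D :\ i :\ j)) *
    ((\sum_(k in D) x k)^-1 * (\sum_(k in D) y k)^-1) <=
  \sum_(A : {set I} | A \subset D) w A * (i \in A)%:R * (j \in A)%:R *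
      ((\sum_(k in A) x k)^-1 * (\sum_(k in A) y k)^-1).
Proof.
move=> x0 y0 iD ij.
have := @weighted_inv_ge y y0 (fun A => w A * (j \in A)%:R)
  (fun A => (\sum_(k in i |: A) x k)^-1) i D (cmono_inv_sum x0 i) iD.
have E S : \sum_(A : {set I} | A \subset S) w A * (j \in A)%:R * (i \in A)%:R =
   f S - f (S :\ i) - f (S :\ j) + f (S :\ i :\ j).
  by rewrite -mobius_in2; apply: eq_bigr => A _; rewrite mulrAC.
rewrite E (setUidPr _) ?sub1set // => /(_ _)/le_trans; apply.
  by move=> S _; rewrite E; exact: second_diff_ge0.
rewrite le_eqVlt; apply/orP; left; apply/eqP; apply: eq_bigr => A _.
have [iA|] := boolP (i \in A); last by rewrite mulr0 !(mulr0, mul0r).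
by rewrite (setUidPr _) ?sub1set //; ring.
Qed.

(** The normalised lengths times [c] are the moment map of the single weight [c] on [D]. Both sides
    therefore have the same symmetrised expansion and differ only in their kernels. *)
Lemma moment_monotone D x y u (c : R) :
  (forall j, 0 < x j) -> (forall j, 0 < y j) ->
  (forall i j, i \in D -> j \in D -> i != j ->
     c <= f D - f (D :\ i) - f (D :\ j) + f (D :\ i :\ j)) ->
  (forall i j, i \in D -> j \in D -> 0 <= (u i - u j) * (y i * x j - x i * y j)) ->
  c * \sum_(i in D) u i * (y i / \sum_(k in D) y k - x i / \sum_(k in D) x k) <=
  \sum_(i in D) u i * (moment D y i - moment D x i).
Proof.
move=> x0 y0 cF uxy; rewrite -(@ler_pM2l _ 2) // moment_diff //.
have [->|[e eD]] := set_0Vmem D; first by rewrite !big_set0 !mulr0.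
have X0 := sum_pos_gt0 x0 eD; have Y0 := sum_pos_gt0 y0 eD.
have -> : 2 * (c * \sum_(i in D) u i *
    (y i / \sum_(k in D) y k - x i / \sum_(k in D) x k)) =
  \sum_(i in D) \sum_(j in D) (u i - u j) * (y i * x j - x i * y j) *
    (c * ((\sum_(k in D) x k)^-1 * (\sum_(k in D) y k)^-1)).
  rewrite -[RHS](eq_bigr _ (fun i _ => mulr_suml _ _ _ _)) -mulr_suml.
  rewrite antisym_sum; last by move=> i j; ring.
  rewrite -[RHS]mulrA; congr (_ * _); rewrite mulr_sumr [RHS]mulr_suml.
  apply: eq_bigr => i _.
  rewrite -mulr_sumr sumrB -!mulr_sumr; move: X0 Y0.
  move: (\sum_(k in D) x k) (\sum_(k in D) y k) => X Y X0 Y0.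
  by field; rewrite !gt_eqF.
apply: ler_sum => i iD; apply: ler_sum => j jD.
have [->|ij] := eqVneq i j; first by rewrite subrr !mul0r.
apply: ler_wpM2l; first exact: uxy.
apply: le_trans (kernel_ge x0 y0 iD ij); apply: ler_wpM2r; last exact: cF.
by apply: mulr_ge0; rewrite invr_ge0 ltW.
Qed.

Lemma moment_inverse_bound D x y (c : R) i :
  (forall j, 0 < x j) -> (forall j, 0 < y j) -> 0 <= c ->
  (forall i j, i \in D -> j \in D -> i != j ->
     c <= f D - f (D :\ i) - f (D :\ j) + f (D :\ i :\ j)) ->
  i \in D ->
  c * (y i / \sum_(k in D) y k - x i / \sum_(k in D) x k) <=
  \sum_(j in D) `|moment D y j - moment D x j|.
Proof.
move=> x0 y0 c0 cF iD.
have X0 := sum_pos_gt0 x0 iD; have Y0 := sum_pos_gt0 y0 iD.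
set X := \sum_(k in D) x k in X0 *; set Y := \sum_(k in D) y k in Y0 *.
(* If [u j = 1] and [u k = 0], the normalised length does not decrease from [x] to [y] at [j] and
   decreases at [k], which fixes the sign of [y j * x k - x j * y k]. *)
pose u j : R := if x j / X <= y j / Y then 1 else 0.
have xE j : x j = (x j / X) * X by rewrite divfK ?gt_eqF.
have yE j : y j = (y j / Y) * Y by rewrite divfK ?gt_eqF.
have uxy j k : 0 <= (u j - u k) * (y j * x k - x j * y k).
  rewrite (xE j) (xE k) (yE j) (yE k) /u.
  have : 0 <= x k / X by rewrite divr_ge0 ?ltW.
  have : 0 <= y k / Y by rewrite divr_ge0 ?ltW.
  have : 0 <= x j / X by rewrite divr_ge0 ?ltW.
  have : 0 <= y j / Y by rewrite divr_ge0 ?ltW.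
  move: (x j / X) (x k / X) (y j / Y) (y k / Y) => a b a' b' a'0 a0 b'0 b0.
  have -> : a' * Y * (b * X) - a * X * (b' * Y) = (a' * b - a * b') * (X * Y).
    by ring.
  rewrite mulrA; apply: mulr_ge0; last by rewrite mulr_ge0 // ltW.
  case: (leP a a') => h; case: (leP b b') => h'; rewrite ?subrr ?mul0r // ?subr0 ?mul1r ?sub0r ?mulN1r.
    by rewrite subr_ge0; apply: ler_pM => //; exact: ltW.
  by rewrite oppr_ge0 subr_le0; apply: ler_pM => //; exact: ltW.
have uge0 j : 0 <= u j * (y j / Y - x j / X).
  by rewrite /u; case: (leP (x j / X)) => h; rewrite ?mul1r ?mul0r ?lexx // subr_ge0.
have ule j : y j / Y - x j / X <= u j * (y j / Y - x j / X).
  by rewrite /u; case: (leP (x j / X)) => h; rewrite ?mul1r ?mul0r ?lexx // subr_le0 ltW.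
apply: le_trans (ler_wpM2l c0 (ule i)) _.
apply: le_trans (_ : c * \sum_(j in D) u j * (y j / Y - x j / X) <= _).
  by apply: ler_wpM2l => //; rewrite (bigD1 i) //= ler_wpDr // sumr_ge0.
apply: le_trans (moment_monotone x0 y0 cF (fun j k _ _ => uxy j k)) _.
apply: ler_sum => j _; rewrite /u; case: (leP (x j / X)) => _; rewrite ?mul1r ?mul0r ?ler_norm //.
Qed.

(** Multiplicative steps make the bound independent of [x]. With X = x(A) and W the sum of the x_i
    v_i, the 4 comes from |v_e X - W| <= 2 V X and a denominator at least X / 2. *)
Lemma ratio_perturb x (v : I -> R) A e (t V : R) :
  (forall j, 0 < x j) -> (forall j, `|v j| <= V) -> 0 <= t -> t * V <= 2^-1 ->
  e \in A ->
  `|x e * (1 + t * v e) / (\sum_(i in A) x i * (1 + t * v i)) -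
    x e / \sum_(i in A) x i| <= t * (4 * V).
Proof.
move=> x0 vV t0 tV eA; have X0 := sum_pos_gt0 x0 eA.
have V0 : 0 <= V by apply: le_trans (vV e); exact: normr_ge0.
have -> : \sum_(i in A) x i * (1 + t * v i) =
    \sum_(i in A) x i + t * \sum_(i in A) x i * v i.
  by rewrite mulr_sumr -big_split; apply: eq_bigr => i _ /=; ring.
have S1 : `|\sum_(i in A) x i * v i| <= V * \sum_(i in A) x i.
  apply: le_trans (ler_norm_sum _ _ _) _; rewrite mulr_sumr; apply: ler_sum => i _.
  by rewrite normrM (gtr0_norm (x0 i)) [leRHS]mulrC ler_pM2l.
have xeX : x e <= \sum_(i in A) x i.
  by rewrite (bigD1 e) //= lerDl sumr_ge0 // => j _; exact: ltW.
move: X0 S1 xeX; move: (\sum_(i in A) x i) (\sum_(i in A) x i * v i) => X W X0.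
rewrite ler_norml => /andP[W1 W2] xeX.
have := vV e; rewrite ler_norml => /andP[v1 v2].
have Y0 : X / 2 <= X + t * W.
  have : t * (- (V * X)) <= t * W by exact: ler_wpM2l.
  have : t * V * X <= 2^-1 * X by rewrite ler_pM2r.
  lra.
have Y1 : 0 < X + t * W by apply: lt_le_trans Y0; rewrite divr_gt0.
have -> : x e * (1 + t * v e) / (X + t * W) - x e / X =
   t * ((x e / X) * ((v e * X - W) / (X + t * W))).
  by field; rewrite !gt_eqF.
rewrite normrM ger0_norm //; apply: ler_wpM2l => //.
rewrite normrM -[leRHS]mul1r; apply: ler_pM => //.
  by rewrite ger0_norm ?ler_pdivrMr ?mul1r // divr_ge0 // ltW.
rewrite normrM [X in _ * X]gtr0_norm ?invr_gt0 // ler_pdivrMr //.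
apply: le_trans (_ : 2 * V * X <= _).
  rewrite ler_norml; apply/andP; split.
    have : - V * X <= v e * X by rewrite ler_pM2r.
    lra.
  have : v e * X <= V * X by rewrite ler_pM2r.
  lra.
have : 4 * V * (X / 2) <= 4 * V * (X + t * W) by apply: ler_wpM2l => //; lra.
lra.
Qed.

(** Up to the total weight this is the variance of [v] under the weights [x], and a nonzero vector
    of sum 0 is not constant. *)
Lemma variance_gt0 x (v : I -> R) : (forall j, 0 < x j) ->
  \sum_i v i = 0 -> (exists i, v i != 0) ->
  0 < \sum_i v i * (x i * (v i - (\sum_j x j * v j) / \sum_j x j)).
Proof.
move=> x0 v0 [e ve].
have X0 : 0 < \sum_j x j.
  by rewrite (bigD1 e) //= ltr_pwDl // sumr_ge0 // => j _; exact: ltW.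
set m := _ / _.
have mX : m * \sum_j x j = \sum_j x j * v j by rewrite divfK // gt_eqF.
have E : \sum_i v i * (x i * (v i - m)) = \sum_i x i * (v i - m) ^+ 2.
  apply/eqP; rewrite -subr_eq0 -sumrB.
  rewrite (eq_bigr (fun i => m * (x i * v i - m * x i))); last by move=> i _; ring.
  by rewrite -mulr_sumr sumrB -mulr_sumr mX subrr mulr0.
rewrite E lt_neqAle sumr_ge0 ?andbT => [|i _]; last first.
  by apply: mulr_ge0; [exact: ltW|exact: sqr_ge0].
apply/eqP => /esym/eqP; rewrite psumr_eq0 => [|i _]; last first.
  by apply: mulr_ge0; [exact: ltW|exact: sqr_ge0].
move=> /allP vm.
have {}vm i : v i = m.
  have := vm i (mem_index_enum _); rewrite mulf_eq0 gt_eqF //= sqrf_eq0 subr_eq0.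
  by move/eqP.
move: v0; rewrite (eq_bigr (fun=> m)) // big_const iter_addr_0 => /eqP.
rewrite mulrn_eq0 -(vm e) (negbTE ve) orbF => /eqP c0.
by have /card0_eq/(_ e) := c0; rewrite inE.
Qed.

(** The step from x_i to x_i (1 + t v_i), with v the vector from the moments to [p], turns each term
    of the symmetrised sum into a nonnegative multiple of (v_i - v_j)^2. The moments approach [p] at
    a rate linear in [t], with a quadratic error. *)
Lemma moment_descent x (p : I -> R) (c : R) :
  (forall j, 0 < x j) -> 0 < c ->
  (forall i j, i != j -> c <= f setT - f (setT :\ i) - f (setT :\ j) + f (setT :\ i :\ j)) ->
  \sum_i p i = f setT -> (exists i, p i != moment setT x i) ->
  exists2 y : I -> R, (forall j, 0 < y j) &
    \sum_i (moment setT y i - p i) ^+ 2 < \sum_i (moment setT x i - p i) ^+ 2.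
Proof.
move=> x0 c0 cF sp [e pe].
have TE (F : I -> R) : \sum_(i in setT) F i = \sum_i F i.
  by apply: eq_bigl => i; rewrite inE.
pose v i := p i - moment setT x i.
have sv : \sum_i v i = 0.
  by rewrite sumrB sp -(sum_moment setT x0) TE subrr.
have ve : exists i, v i != 0 by exists e; rewrite subr_eq0.
have := variance_gt0 x0 sv ve; set q := \sum_i _ => q0.
pose V := \sum_i `|v i|.
have vV j : `|v j| <= V by rewrite /V (bigD1 j) //= lerDl sumr_ge0.
have V0 : 0 < V by apply: lt_le_trans (vV e); rewrite normr_gt0 subr_eq0.
have X0 : 0 < \sum_j x j.
  by rewrite (bigD1 e) //= ltr_pwDl // sumr_ge0 // => j _; exact: ltW.
set X := \sum_j x j in X0 q q0.
pose L := 4 * V * \sum_(A : {set I}) `|w A|.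
have L0 : 0 <= L by rewrite /L mulr_ge0 ?sumr_ge0 // mulr_ge0 // ltW.
pose N : R := #|I|%:R.
have N0 : 0 <= N by rewrite ler0n.
(* The first bound gives t V <= 1/2, which keeps [y] positive and its total at most 2 X. The second
   makes the error t^2 N L^2 smaller than twice the gain t c q / (2 X); the added 1 keeps the
   denominator positive. *)
pose t := Num.min (2 * V)^-1 (c * (q / (2 * X)) / (N * L ^+ 2 + 1)).
have k0 : 0 < c * (q / (2 * X)) by rewrite mulr_gt0 // divr_gt0 // mulr_gt0.
have M0 : 0 < N * L ^+ 2 + 1 by rewrite ltr_wpDl // mulr_ge0 // sqr_ge0.
have t0 : 0 < t by rewrite lt_min invr_gt0 mulr_gt0 //= divr_gt0.
have tV : t * V <= 2^-1.
  have : t <= (2 * V)^-1 by rewrite ge_min lexx.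
  by move=> /(ler_wpM2r (ltW V0))/le_trans; apply; rewrite invfM mulfVK // gt_eqF.
have tM : t * (N * L ^+ 2) < 2 * (c * (q / (2 * X))).
  have : t <= c * (q / (2 * X)) / (N * L ^+ 2 + 1) by rewrite ge_min lexx orbT.
  rewrite ler_pdivlMr // mulrDr mulr1; lra.
pose y i := x i * (1 + t * v i).
have tv j : - 2^-1 <= t * v j <= 2^-1.
  rewrite -ler_norml normrM gtr0_norm //; apply: le_trans tV.
  by rewrite ler_pM2l.
have y0 j : 0 < y j.
  by rewrite /y mulr_gt0 //; have := tv j; lra.
exists y => //.
have dy j : `|moment setT y j - moment setT x j| <= t * L.
  rewrite /moment -sumrB; apply: le_trans (ler_norm_sum _ _ _) _.
  rewrite /L mulrA mulr_sumr.
  rewrite (eq_bigl xpredT) => [|A]; last exact: subsetT.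
  apply: ler_sum => A _; have [jA|] := boolP (j \in A); last first.
    by rewrite mulr0 !mul0r subrr normr0 mulr_ge0 // mulr_ge0 ?ltW ?mulr_gt0.
  rewrite mulr1 -mulrBr normrM mulrC; apply: ler_wpM2r => //.
  by apply: ratio_perturb => //; exact: ltW.
have Y2 : \sum_i y i <= 2 * X.
  rewrite mulr_sumr; apply: ler_sum => i _; rewrite mulrC /y ler_pM2l //.
  by have := tv i; lra.
have Y0 : 0 < \sum_i y i.
  by rewrite (bigD1 e) //= ltr_pwDl // sumr_ge0 // => j _; exact: ltW.
have := @moment_monotone setT x y v c x0 y0.
rewrite !TE => /(_ _ _)H.
have {H} : c * (t * (q / (2 * X))) <= \sum_i v i * (moment setT y i - moment setT x i).
  apply: le_trans (H _ _); last 2 first.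
  - by move=> i j _ _ ij; exact: cF.
  - move=> i j _ _; rewrite /y.
    have -> : (v i - v j) * (x i * (1 + t * v i) * x j - x i * (x j * (1 + t * v j)))
      = t * (x i * x j) * (v i - v j) ^+ 2 by ring.
    by rewrite mulr_ge0 ?sqr_ge0 // mulr_ge0 ?ltW // mulr_gt0.
  rewrite ler_pM2l //.
  have YE : \sum_i y i = X + t * \sum_i x i * v i.
    by rewrite /X mulr_sumr -big_split; apply: eq_bigr => i _ /=; rewrite /y; ring.
  have -> : \sum_i v i * (y i / \sum_i y i - x i / X) = t * (q / \sum_i y i).
    rewrite mulrCA [RHS]mulr_suml; apply: eq_bigr => i _.
    rewrite -/X /y; move: Y0; rewrite YE; move: (\sum_j x j * v j) => W Y0.
    by field; rewrite !gt_eqF.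
  by rewrite ler_pM2l // ler_pM2l // lef_pV2 // ?posrE // mulr_gt0.
set S := \sum_i v i * _ => HS.
have -> : \sum_i (moment setT x i - p i) ^+ 2 = \sum_i v i ^+ 2.
  by apply: eq_bigr => i _; rewrite /v; ring.
have -> : \sum_i (moment setT y i - p i) ^+ 2 =
   \sum_i v i ^+ 2 - 2 * S + \sum_i (moment setT y i - moment setT x i) ^+ 2.
  rewrite /S mulr_sumr -sumrB -big_split; apply: eq_bigr => i _ /=.
  by rewrite /v; ring.
have : \sum_i (moment setT y i - moment setT x i) ^+ 2 <= t * (t * (N * L ^+ 2)).
  have -> : t * (t * (N * L ^+ 2)) = \sum_(i : I) (t * L) ^+ 2.
    by rewrite big_const iter_addr_0 -mulr_natl /N; ring.
  apply: ler_sum => i _; rewrite -real_normK ?num_real //.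
  by rewrite ler_sqr ?nnegrE // mulr_ge0 // ltW.
have : t * (t * (N * L ^+ 2)) < t * (2 * (c * (q / (2 * X)))) by rewrite ltr_pM2l.
move: HS; rewrite mulrCA; lra.
Qed.

End MomentMap.

(** * The moment map on the closed cells *)

Section Continuity.
Variables (R : realType) (T : topologicalType).

Lemma continuous_bigsum (J : Type) (r : seq J) (P : pred J) (F : J -> T -> R) :
  (forall j, P j -> continuous (F j)) ->
  continuous (fun t => \sum_(j <- r | P j) F j t).
Proof.
move=> cF; elim: r => [|j r IH].
  rewrite (_ : (fun _ => _) = fun=> 0); first exact: cst_continuous.
  by apply/boolp.funext => t; rewrite big_nil.
have [Pj|Pj] := boolP (P j); last first.
  rewrite (_ : (fun _ => _) = fun t => \sum_(j <- r | P j) F j t) //.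
  by apply/boolp.funext => t; rewrite big_cons (negbTE Pj).
rewrite (_ : (fun _ => _) = fun t => F j t + \sum_(j <- r | P j) F j t); last first.
  by apply/boolp.funext => t; rewrite big_cons Pj.
by move=> t; apply: (@continuousD _ R^o _ (F j)); [exact: cF|exact: IH].
Qed.

Lemma continuous_at_rV n (f : T -> 'rV[R]_n) t :
  (forall e, {for t, continuous (fun t => f t 0 e)}) -> {for t, continuous f}.
Proof.
move=> cf A [P Pf PA].
have : \forall s \near t, forall e : 'I_n, P 0 e (f s 0 e).
  by apply: filter_forall => e; apply: (cf e); exact: Pf.
by apply: filterS => s Ps; apply: PA => i j; rewrite (ord1 i).
Qed.

Lemma continuous_rV n (f : T -> 'rV[R]_n) :
  (forall e, continuous (fun t => f t 0 e)) -> continuous f.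
Proof. by move=> cf t; apply: continuous_at_rV => e; exact: cf. Qed.

Lemma continuous_at_product (I : Type) (U : topologicalType)
    (f : T -> prod_topology (fun _ : I => U)) t :
  (forall i, {for t, continuous (fun t => f t i)}) -> {for t, continuous f}.
Proof.
move=> cf; apply/cvg_sup => i A [_ [[D oD <-] Dt] /filterS]; apply.
exact: (cf i D (open_nbhs_nbhs (conj oD Dt))).
Qed.

Lemma closed_le_continuous (f g : T -> R) : continuous f -> continuous g ->
  closed [set t | f t <= g t]%classic.
Proof.
move=> cf cg; have -> : [set t | f t <= g t]%classic =
    ((fun t => g t - f t) @^-1` [set x | 0 <= x])%classic.
  by apply/seteqP; split=> t /=; rewrite subr_ge0.
apply: (iffLR (continuous_closedP _)); last exact: closed_ge.
by move=> t; apply: (@continuousB _ R^o _ g f); [exact: cg|exact: cf].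
Qed.

Lemma closed_forall (J : Type) (A : J -> set T) :
  (forall j, closed (A j)) -> closed [set t | forall j, A j t]%classic.
Proof.
move=> cA; have -> : [set t | forall j, A j t]%classic = (\bigcap_j A j)%classic.
  by apply/seteqP; split=> t /= h j => [_|]; exact: h.
by apply: closed_bigI => j _; exact: cA.
Qed.

End Continuity.

Lemma affine_continuous (R : realType) (a b : R) :
  continuous (fun t : R => (1 - t) * a + t * b).
Proof.
move=> t; apply: cvgD; apply: cvgMl; last exact: cvg_id.
by apply: cvgB; [exact: cvg_cst|exact: cvg_id].
Qed.

(** * Limits of rescaled metrics and their moments *)

Definition iscore (G : graph) (A : {set 'I_(ne G)}) : bool :=
  core A && (A != finset.set0).

(** Families extended by 0 to all edge sets, so that they can be summed against the weights, which
    vanish outside the cores. *)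
Definition component (R : realType) (G : graph) (s : core_product R G)
    (A : {set 'I_(ne G)}) : 'rV[R]_(ne G) :=
  if insub A is Some B then s B else 0.

Definition partial_moment (R : realType) (G : graph)
    (w : {set 'I_(ne G)} -> R) (D : {set 'I_(ne G)}) (s : core_product R G) e : R :=
  \sum_(A : {set 'I_(ne G)} | A \subset D) w A * component s A 0 e.

Definition moment_map (R : realType) (G : graph)
    (w : {set 'I_(ne G)} -> R) (s : core_product R G) : 'rV[R]_(ne G) :=
  \row_e \sum_(A : {set 'I_(ne G)}) w A * component s A 0 e.

Definition moment_polytope (R : realType) (G : graph)
    (f : {set 'I_(ne G)} -> R) (p : 'rV[R]_(ne G)) : Prop :=
  [/\ forall e, 0 <= p 0 e, \sum_e p 0 e = 1 &
      forall A, iscore A -> f A <= \sum_(e in A) p 0 e].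

Section BlowUp.
Import mathcomp.boot.fintype mathcomp.boot.finset.
Variables (R : realType) (G : graph) (f w : {set 'I_(ne G)} -> R).
Local Notation E := 'I_(ne G).
Local Notation lengths := 'rV[R]_(ne G).
Implicit Types (A B C D S T : {set E}) (s : core_product R G) (x p : lengths).

Lemma component_core s A (cA : iscore A) : component s A = s (exist _ A cA).
Proof.
rewrite /component; case: insubP => [B _ BA|]; last by rewrite -/(iscore A) cA.
by congr (s _); apply: val_inj.
Qed.

Lemma component_embedding x A e : iscore A ->
  component (core_embedding x) A 0 e =
  if e \in A then x 0 e / \sum_(i in A) x 0 i else 0.
Proof. by move=> cA; rewrite component_core mxE. Qed.

Lemma component_continuous A e :
  continuous (fun s : core_product R G => component s A 0 e).
Proof.
rewrite /component; case: insubP => [B _ _|_]; last first.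
  by move=> s; rewrite mxE; exact: cst_continuous.
move=> s; apply: (@continuous_comp _ _ _ (fun s : core_product R G => s B)
  (fun x : lengths => x 0 e)).
  exact: (@proj_continuous _ (fun=> lengths) B).
exact: coord_continuous.
Qed.

(** Closed conditions pass from metrics to their limits; this is how weak inequalities and
    identities reach [Sigma_space]. *)
Lemma Sigma_ge0 (h : core_product R G -> R) : continuous h ->
  (forall x, open_simplex x -> 0 <= h (core_embedding x)) ->
  forall s, Sigma_space s -> 0 <= h s.
Proof.
move=> ch h0 s [_]; rewrite closureEbigcap.
move=> /(_ [set s | 0 <= h s]%classic); apply; split; last by move=> _ [x ox <-]; exact: h0.
by apply: closed_le_continuous ch; exact: cst_continuous.
Qed.

Lemma Sigma_eq0 (h : core_product R G -> R) : continuous h ->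
  (forall x, open_simplex x -> h (core_embedding x) = 0) ->
  forall s, Sigma_space s -> h s = 0.
Proof.
move=> ch h0 s sS; apply/eqP; rewrite eq_le -oppr_ge0; apply/andP; split.
  apply: (Sigma_ge0 (h := fun s => - h s)) sS => [|x /h0->]; last by rewrite oppr0.
  by move=> t; apply: (@continuousN _ R^o _ h); exact: ch.
by apply: Sigma_ge0 sS => // x /h0->.
Qed.

Section Facts.
Variable s : core_product R G.
Hypothesis sS : Sigma_space s.

Lemma component_simplex A : iscore A -> simplex A (component s A).
Proof. by move=> cA; rewrite (component_core _ cA); case: sS => h _; exact: (h (exist _ A cA)). Qed.

Lemma component_ge0 A e : 0 <= component s A 0 e.
Proof.
have [cA|cA] := boolP (iscore A); first by case: (component_simplex cA) => + _ _; exact.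
by rewrite /component insubN // mxE.
Qed.

Lemma component_out A e : e \notin A -> component s A 0 e = 0.
Proof.
have [cA|cA] := boolP (iscore A); first by case: (component_simplex cA) => _ + _; exact.
by rewrite /component insubN // mxE.
Qed.

Lemma component_sum A : iscore A -> \sum_(e in A) component s A 0 e = 1.
Proof. by case/component_simplex. Qed.

(** Stated without a quotient to survive in the limit: if [A] has length 0 in the metric of [B], it
    leaves the metric of [A] unconstrained. *)
Lemma component_restrict A B e : iscore A -> iscore B -> A \subset B ->
  e \in A ->
  component s B 0 e = (\sum_(i in A) component s B 0 i) * component s A 0 e.
Proof.
move=> cA cB AB eA; apply/eqP; rewrite -subr_eq0; apply/eqP.
apply: (Sigma_eq0 (h := fun s => component s B 0 e -
  (\sum_(i in A) component s B 0 i) * component s A 0 e)) sS => [t|x [x0 _]].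
  apply: (@continuousB _ R^o _ (fun s => component s B 0 e)
    (fun s => (\sum_(i in A) component s B 0 i) * component s A 0 e)).
    exact: component_continuous.
  apply: (@continuousM _ _ (fun s => \sum_(i in A) component s B 0 i)
    (fun s => component s A 0 e)); last exact: component_continuous.
  by apply: continuous_bigsum => i _; exact: component_continuous.
rewrite (eq_bigr (fun i => x 0 i / \sum_(k in B) x 0 k)); last first.
  by move=> i iA; rewrite component_embedding // (subsetP AB).
rewrite -mulr_suml !component_embedding // eA (subsetP AB e eA).
have X0 := sum_pos_gt0 x0 eA; have Y0 := sum_pos_gt0 x0 (subsetP AB e eA).
by field; rewrite !gt_eqF.
Qed.

End Facts.

Lemma partial_momentT s e :
  partial_moment w setT s e = moment_map w s 0 e.
Proof. by rewrite mxE; apply: eq_bigl => A; rewrite subsetT. Qed.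

Lemma partial_moment_continuous D e :
  continuous (fun s : core_product R G => partial_moment w D s e).
Proof.
apply: continuous_bigsum => A _ s.
apply: (@continuousM _ _ (fun=> w A) (fun s => component s A 0 e)).
  exact: cst_continuous.
exact: component_continuous.
Qed.

Lemma moment_map_continuous : continuous (moment_map w).
Proof.
apply: continuous_rV => e.
rewrite (_ : (fun _ => _) = fun s => partial_moment w setT s e).
  exact: partial_moment_continuous.
by apply/boolp.funext => s; rewrite partial_momentT.
Qed.

Lemma simplex_compact A : compact (@simplex R G A).
Proof.
have K : compact [set v : lengths | forall i, (`[0, 1]%classic : set R) (v ord0 i)]%classic.
  by apply: (@rV_compact R _ (fun=> `[0, 1]%classic)) => i; exact: segment_compact.
apply: (subclosed_compact _ K); last first.
  move=> x [x0 xA x1] i /=; rewrite in_itv /= x0 /=.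
  have [iA|/xA->] := boolP (i \in A); last exact: ler01.
  by rewrite -x1 (bigD1 i) //= lerDl sumr_ge0.
have -> : @simplex R G A = ([set x : lengths | forall e, 0 <= x 0 e] `&`
   ([set x : lengths | forall e, (e \notin A -> x 0 e <= 0)] `&`
   ([set x : lengths | \sum_(e in A) x 0 e <= 1] `&` [set x | 1 <= \sum_(e in A) x 0 e])))%classic.
  apply/seteqP; split=> x /=.
    by move=> [x0 xA x1]; rewrite x1 lexx; split=> //; split=> // e /xA->.
  move=> [x0 [xA [x1 x1']]]; split=> // [e eA|]; apply/eqP; rewrite eq_le.
    by rewrite x0 xA.
  by rewrite x1 x1'.
have cs : continuous (fun x : lengths => \sum_(e in A) x 0 e).
  by apply: continuous_bigsum => e _; exact: coord_continuous.
do !apply: closedI.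
- apply: closed_forall => e; apply: closed_le_continuous; last exact: coord_continuous.
  exact: cst_continuous.
- apply: closed_forall => e; apply: closed_forall => _.
  by apply: closed_le_continuous; [exact: coord_continuous|exact: cst_continuous].
- by apply: closed_le_continuous => //; exact: cst_continuous.
- by apply: closed_le_continuous => //; exact: cst_continuous.
Qed.

Lemma Sigma_compact : compact (@Sigma_space R G).
Proof.
apply: compact_closedI; last exact: closed_closure.
by apply: (@tychonoff _ (fun=> lengths) (fun c : cores G => @simplex R G (val c))) => c;
exact: simplex_compact.
Qed.

End BlowUp.

(** * The moment map is a bijection onto its polytope *)

Section MomentHomeomorphism.
Import mathcomp.boot.fintype mathcomp.boot.finset.
Variables (R : realType) (G : graph) (f w : {set 'I_(ne G)} -> R).
Variable gap : {set 'I_(ne G)} -> R.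
Local Notation E := 'I_(ne G).
Local Notation lengths := 'rV[R]_(ne G).
Implicit Types (A B C D S T : {set E}) (s : core_product R G) (x p : lengths).

Hypothesis f_super : forall S T, f S + f T <= f (S :|: T) + f (S :&: T).
Hypothesis f0 : f finset.set0 = 0.
Hypothesis f_ge0 : forall S, 0 <= f S.
Hypothesis fT : f setT = 1.
Hypothesis wf : forall S, \sum_(A : {set E} | A \subset S) w A = f S.
Hypothesis w_core : forall A, ~~ iscore A -> w A = 0.
Hypothesis gap_gt0 : forall A, iscore A -> 0 < gap A.
Hypothesis gapP : forall A i j, iscore A -> i \in A -> j \in A -> i != j ->
  gap A <= f A - f (A :\ i) - f (A :\ j) + f (A :\ i :\ j).
Hypothesis f_lt : forall A i, iscore A -> i \in A -> f (A :\ i) < f A.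
Hypothesis core_setT : iscore [set: E].
Hypothesis core_cover : forall P : pred {set E}, (forall A, P A -> iscore A) ->
  \bigcup_(A | P A) A != finset.set0 -> iscore (\bigcup_(A | P A) A).

Local Notation Phi := (moment_map w).
Local Notation PhiD := (partial_moment w).

Lemma partial_moment_embedding D x e :
  PhiD D (core_embedding x) e = moment w D (x 0) e.
Proof.
apply: eq_bigr => A _; have [cA|cA] := boolP (iscore A); last first.
  by rewrite w_core // !mul0r.
by rewrite component_embedding // -mulrA; congr (_ * _); case: ifP; rewrite ?mul1r ?mul0r.
Qed.

Lemma partial_moment_out D s e : Sigma_space s -> e \notin D -> PhiD D s e = 0.
Proof.
move=> sS eD; rewrite /partial_moment big1 // => A AD.
by rewrite component_out ?mulr0 //; apply: contra eD => /(subsetP AD).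
Qed.

Lemma simplex_pos x : open_simplex x -> forall j, 0 < x 0 j.
Proof. by case. Qed.

(** The constant in [moment_inverse_bound] contains no lengths, so the bound extends to limits, one
    argument at a time. *)
Lemma component_bound C s s' i : Sigma_space s -> Sigma_space s' ->
  iscore C -> i \in C ->
  gap C * (component s' C 0 i - component s C 0 i) <=
  \sum_(j in C) `|PhiD C s' j - PhiD C s j|.
Proof.
move=> sS sS' cC iC.
pose h s s' := \sum_(j in C) `|PhiD C s' j - PhiD C s j| -
  gap C * (component s' C 0 i - component s C 0 i).
rewrite -subr_ge0 -/(h s s').
have ch1 t : continuous (h^~ t).
  move=> u; apply: (@continuousB _ R^o _ (fun u => \sum_(j in C) `|PhiD C t j - PhiD C u j|)
    (fun u => gap C * (component t C 0 i - component u C 0 i))).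
    apply: continuous_bigsum => j _ {}u.
    apply: (@continuous_comp _ _ _ (fun u => PhiD C t j - PhiD C u j) Num.norm);
      last exact: norm_continuous.
    apply: (@continuousB _ R^o _ (fun=> PhiD C t j) (fun u => PhiD C u j)).
      exact: cst_continuous.
    exact: partial_moment_continuous.
  apply: (@continuousM _ _ (fun=> gap C) (fun u => component t C 0 i - component u C 0 i)).
    exact: cst_continuous.
  apply: (@continuousB _ R^o _ (fun=> component t C 0 i) (fun u => component u C 0 i)).
    exact: cst_continuous.
  exact: component_continuous.
have ch2 t : continuous (h t).
  move=> u; apply: (@continuousB _ R^o _ (fun u => \sum_(j in C) `|PhiD C u j - PhiD C t j|)
    (fun u => gap C * (component u C 0 i - component t C 0 i))).
    apply: continuous_bigsum => j _ {}u.
    apply: (@continuous_comp _ _ _ (fun u => PhiD C u j - PhiD C t j) Num.norm);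
      last exact: norm_continuous.
    apply: (@continuousB _ R^o _ (fun u => PhiD C u j) (fun=> PhiD C t j)).
      exact: partial_moment_continuous.
    exact: cst_continuous.
  apply: (@continuousM _ _ (fun=> gap C) (fun u => component u C 0 i - component t C 0 i)).
    exact: cst_continuous.
  apply: (@continuousB _ R^o _ (fun u => component u C 0 i) (fun=> component t C 0 i)).
    exact: component_continuous.
  exact: cst_continuous.
apply: (Sigma_ge0 (ch1 s')) sS => x ox.
apply: (Sigma_ge0 (ch2 _)) sS' => y oy; rewrite subr_ge0.
rewrite (eq_bigr (fun j => `|moment w C (y 0) j - moment w C (x 0) j|)); last first.
  by move=> j _; rewrite !partial_moment_embedding.
rewrite !component_embedding // iC.
apply: (moment_inverse_bound f_super wf) => //.
- exact: simplex_pos.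
- exact: simplex_pos.
- exact/ltW/gap_gt0.
- by move=> j k jC kC jk; exact: gapP.
Qed.

(** The next stratum: unions of cores are cores, so when nonempty this is the largest core inside
    [C] that a nonnegative [x] shrinks to length 0. *)
Definition null_core C x : {set E} :=
  \bigcup_(A : {set E} | [&& iscore A, A \subset C & \sum_(e in A) x 0 e == 0]) A.

(** For the last part, let [A] inside [C] contain [e] and not lie in [C']. In the metric of [C], the
    core [A] has nonzero length and [e] has length 0; so [e] has length 0 in the metric of [A] too,
    and the summand of [A] vanishes. *)
Lemma null_coreP C s : Sigma_space s -> iscore C ->
  let C' := null_core C (component s C) in
  [/\ C' \proper C, (forall e, e \in C' -> component s C 0 e = 0) &
      forall e, e \in C' -> PhiD C' s e = PhiD C s e].
Proof.
move=> sS cC C'.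
have z e : e \in C' -> component s C 0 e = 0.
  case/bigcupP => A /and3P[cA AC /eqP sA eA]; apply/eqP.
  rewrite eq_le component_ge0 // andbT -sA (bigD1 e) //= lerDl sumr_ge0 // => j _.
  exact: component_ge0.
have C'C : C' \subset C by apply/bigcupsP => A /and3P[].
split=> //.
  rewrite properEneq C'C andbT; apply/eqP => CC.
  have := component_sum sS cC; rewrite big1 => [/eqP|e eC].
    by rewrite eq_sym oner_eq0.
  by apply: z; rewrite CC.
move=> e eC'; rewrite /partial_moment [RHS](bigID (fun A => A \subset C')) /=.
rewrite [X in _ = _ + X]big1 ?addr0 => [|A /andP[AC AC']].
  by apply: eq_bigl => A; rewrite andb_idl // => /subset_trans; apply.
have [cA|/w_core->] := boolP (iscore A); last by rewrite mul0r.
have [eA|eA] := boolP (e \in A); last by rewrite component_out ?mulr0.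
have := component_restrict sS cA cC AC eA; rewrite z // => /esym/eqP.
rewrite mulf_eq0 => /orP[sA|/eqP->]; last by rewrite mulr0.
case/negP: AC'; apply: (bigcup_max A) => //; by rewrite cA AC.
Qed.

Lemma moment_map_inj s s' : Sigma_space s -> Sigma_space s' ->
  Phi s = Phi s' -> s = s'.
Proof.
move=> sS sS' pE.
(* Induction down the strata. Equal partial moments for [C] give equal metrics on [C]. A core [B] of
   nonzero length there inherits its metric; otherwise [B] lies in the null core, which is common to
   both points and again has equal partial moments. *)
suff H k C B : (#|C| < k)%N -> iscore C -> iscore B -> B \subset C ->
    (forall e, PhiD C s e = PhiD C s' e) -> component s B = component s' B.
  apply/boolp.functional_extensionality_dep => -[A cA].
  have := H #|[set: E]|.+1 setT A (ltnSn _) core_setT cA (subsetT _).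
  rewrite !component_core; apply => e.
  by rewrite !partial_momentT pE.
elim: k C B => // k IH C B; rewrite ltnS => cardC cC cB BC good.
have sC : component s C = component s' C.
  apply/rowP => i; have [iC|iC] := boolP (i \in C); last by rewrite !component_out.
  have le t t' : Sigma_space t -> Sigma_space t' ->
      (forall e, PhiD C t e = PhiD C t' e) -> component t' C 0 i <= component t C 0 i.
    move=> tS tS' tt; rewrite -subr_le0 -(pmulr_rle0 _ (gap_gt0 cC)).
    apply: le_trans (component_bound tS tS' cC iC) _; rewrite big1 // => j _.
    by rewrite tt subrr normr0.
  by apply/eqP; rewrite eq_le !le.
have [sB|sB] := eqVneq (\sum_(i in B) component s C 0 i) 0; last first.
  apply/rowP => i; have [iB|iB] := boolP (i \in B); last by rewrite !component_out.
  apply: (mulfI sB); rewrite -component_restrict // {1}sC.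
  by rewrite (component_restrict sS' cB cC BC iB) sC.
have := null_coreP sS cC; have := null_coreP sS' cC; rewrite -sC.
set C' := null_core _ _ => -[_ _ g'] [C'C _ g].
have BC' : B \subset C' by apply: (bigcup_max B) => //; rewrite cB BC sB /=.
apply: (IH C') => //.
- exact: leq_trans (proper_card C'C) cardC.
- apply: core_cover => [A /and3P[]//|].
  apply/eqP => C'0; move: BC'; rewrite /C' /null_core C'0 subset0.
  by case/andP: cB => _ /negP.
- move=> e; have [eC'|eC'] := boolP (e \in C'); last by rewrite !partial_moment_out.
  by rewrite g // g'.
Qed.

Lemma moment_polytope_map s : Sigma_space s -> moment_polytope f (Phi s).
Proof.
move=> sS; have TE (F : E -> R) : \sum_(i in setT) F i = \sum_i F i.
  by apply: eq_bigl => i; rewrite inE.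
split.
- move=> e; rewrite -partial_momentT.
  apply: (Sigma_ge0 (h := fun s => PhiD setT s e)) sS => [|x ox].
    exact: partial_moment_continuous.
  rewrite partial_moment_embedding.
  apply: le_trans (moment_ge f_super f0 wf (simplex_pos ox) f_ge0 (in_setT e)).
  rewrite mulr_ge0 //; first exact: marginal_ge0.
  by rewrite divr_ge0 ?ltW ?(sum_pos_gt0 (simplex_pos ox) (in_setT e)) ?simplex_pos.
- apply/eqP; rewrite -subr_eq0; apply/eqP.
  rewrite (eq_bigr (fun e => PhiD setT s e)); last by move=> e _; rewrite partial_momentT.
  apply: (Sigma_eq0 (h := fun s => \sum_e PhiD setT s e - 1)) sS => [u|x ox].
    apply: (@continuousB _ R^o _ (fun s => \sum_e PhiD setT s e) (fun=> 1)).
      by apply: continuous_bigsum => e _; exact: partial_moment_continuous.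
    exact: cst_continuous.
  rewrite (eq_bigr (moment w setT (x 0))); last by move=> e _; rewrite partial_moment_embedding.
  by rewrite -TE (sum_moment f0 wf _ (simplex_pos ox)) fT subrr.
- move=> A cA; rewrite -subr_ge0.
  rewrite (eq_bigr (fun e => PhiD setT s e)); last by move=> e _; rewrite partial_momentT.
  apply: (Sigma_ge0 (h := fun s => \sum_(e in A) PhiD setT s e - f A)) sS => [u|x ox].
    apply: (@continuousB _ R^o _ (fun s => \sum_(e in A) PhiD setT s e) (fun=> f A)).
      by apply: continuous_bigsum => e _; exact: partial_moment_continuous.
    exact: cst_continuous.
  rewrite (eq_bigr (moment w setT (x 0))); last by move=> e _; rewrite partial_moment_embedding.
  rewrite -(sum_moment f0 wf _ (simplex_pos ox)) -sumrB sumr_ge0 // => e eA.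
  apply: le_trans (moment_sub_ge f_super wf (simplex_pos ox) (subsetT A) eA).
  rewrite mulr_ge0 //; last first.
    by rewrite divr_ge0 ?ltW ?(sum_pos_gt0 (simplex_pos ox) (in_setT e)) ?simplex_pos.
  by rewrite subr_ge0; apply: marginal_mono => //; exact: subsetT.
Qed.

(** The total is left free, which makes this set open among all vectors. The whole graph is excluded
    because its inequality is an equality on the polytope. *)
Definition inner_polytope p : Prop :=
  (forall e, 0 < p 0 e) /\
  forall A, iscore A -> A != setT -> f A < \sum_(e in A) p 0 e.

Lemma inner_polytope_embedding x : open_simplex x -> inner_polytope (Phi (core_embedding x)).
Proof.
move=> ox; have x0 := simplex_pos ox; split.
  move=> e; rewrite -partial_momentT partial_moment_embedding.
  apply: lt_le_trans (moment_ge f_super f0 wf x0 f_ge0 (in_setT e)).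
  rewrite mulr_gt0 // ?divr_gt0 // ?subr_gt0.
    by apply: f_lt => //; rewrite inE.
  exact: (sum_pos_gt0 x0 (in_setT e)).
move=> A cA AT; rewrite -subr_gt0.
rewrite (eq_bigr (moment w setT (x 0))); last first.
  by move=> e _; rewrite -partial_momentT partial_moment_embedding.
rewrite -(sum_moment f0 wf _ x0) -sumrB.
(* Strictness comes from an edge [i] in [A] and an edge [j] outside: the marginal of [i] at [A] is
   at most that at [setT :\ j], which the positive gap separates from that at [setT]. *)
have [i iA] : exists i, i \in A by apply/set0Pn; case/andP: cA.
have [j jA] : exists j, j \notin A.
  by move: AT; rewrite -finset.subTset => /subsetPn[j _ jA]; exists j.
have ij : i != j by apply: contraNneq jA => <-.
have pos e : 0 < x 0 e / \sum_(k in [set: E]) x 0 k.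
  by rewrite divr_gt0 // (sum_pos_gt0 x0 (in_setT e)).
rewrite (bigD1 i) //= ltr_pwDl //.
  apply: lt_le_trans (moment_sub_ge f_super wf x0 (subsetT A) iA).
  rewrite mulr_gt0 // subr_gt0.
  have := @gapP setT i j core_setT (in_setT i) (in_setT j) ij.
  have := gap_gt0 core_setT.
  have := @marginal_mono _ _ f f_super i A (setT :\ j) _ iA.
  have -> : A \subset setT :\ j by rewrite subsetD1 subsetT.
  rewrite [setT :\ j :\ i]setDDl [setT :\ i :\ j]setDDl [_ :|: [set i]]finset.setUC => /(_ isT).
  lra.
rewrite sumr_ge0 // => e /andP[eA _].
apply: le_trans (moment_sub_ge f_super wf x0 (subsetT A) eA).
apply: mulr_ge0; last exact: ltW.
by rewrite subr_ge0; apply: marginal_mono => //; exact: subsetT.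
Qed.

(** Suppose that [e] has length 0 in the top metric. Either [e] lies in the null core, whose
    inequality is then an equality, or [e] has length 0 in the metric of every core, and its moment
    is 0. Both contradict strictness. *)
Lemma inner_polytope_preimage s : Sigma_space s -> inner_polytope (Phi s) ->
  open_simplex (component s setT) /\ s = core_embedding (component s setT).
Proof.
move=> sS [p0 pA]; set x := component s setT.
have x1 : \sum_e x 0 e = 1.
  rewrite -(component_sum sS core_setT); apply: eq_bigl => e; by rewrite inE.
have x0 e : 0 < x 0 e.
  rewrite lt_neqAle component_ge0 // andbT; apply/eqP => xe.
  have [C'T z g] := null_coreP sS core_setT.
  set C' := null_core _ _ in C'T z g.
  have [eC'|eC'] := boolP (e \in C').
    have cC' : iscore C'.
      apply: core_cover => [A /and3P[]//|]; apply/set0Pn; by exists e.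
    have := pA _ cC' (proper_neq C'T).
    rewrite (eq_bigr (fun i => PhiD C' s i)); last first.
      by move=> i iC'; rewrite g // partial_momentT.
    rewrite exchange_big /= (eq_bigr w) ?wf ?ltxx // => A AC'.
    have [cA|/w_core->] := boolP (iscore A); last by rewrite big1 // => i _; rewrite mul0r.
    rewrite -mulr_sumr (bigID (fun i => i \in A)) /= [X in _ + X]big1 ?addr0 => [|i /andP[_ iA]].
      rewrite (eq_bigl (mem A)) ?component_sum ?mulr1 // => i.
      by rewrite andb_idl //; exact: (subsetP AC').
    exact: component_out.
  have := p0 e; rewrite -partial_momentT /partial_moment big1 ?ltxx // => A _.
  have [cA|/w_core->] := boolP (iscore A); last by rewrite mul0r.
  have [eA|eA] := boolP (e \in A); last by rewrite component_out ?mulr0.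
  have := component_restrict sS cA core_setT (subsetT A) eA.
  rewrite -/x -xe => /esym/eqP; rewrite mulf_eq0 => /orP[sA|/eqP->]; last by rewrite mulr0.
  case/negP: eC'; apply/bigcupP; exists A => //; by rewrite cA subsetT.
split; first by split.
apply/boolp.functional_extensionality_dep => -[A cA]; rewrite -component_core.
apply/rowP => e; rewrite mxE /=; case: ifP => [eA|/negbT eA]; last by rewrite component_out.
have := component_restrict sS cA core_setT (subsetT A) eA; rewrite -/x => ->.
by rewrite mulrAC divff ?mul1r // gt_eqF // (sum_pos_gt0 x0 eA).
Qed.

Lemma Sigma_embedding x : open_simplex x -> Sigma_space (core_embedding x).
Proof.
move=> ox; have x0 := simplex_pos ox; split; last by apply: subset_closure; exists x.
move=> [A cA] /=; have [i iA] : exists i, i \in A by apply/set0Pn; case/andP: cA.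
have X0 := sum_pos_gt0 x0 iA; split.
- by move=> e; rewrite mxE /=; case: ifP => // _; rewrite divr_ge0 // ltW.
- by move=> e eA; rewrite mxE /= (negbTE eA).
- rewrite (eq_bigr (fun e => x 0 e / \sum_(e' in A) x 0 e')) => [|e eA].
    by rewrite -mulr_suml divff // gt_eqF.
  by rewrite mxE /= (_ : e \in A).
Qed.

Lemma moment_scale D (y : E -> R) c e : c != 0 ->
  moment w D (fun i => y i * c) e = moment w D y e.
Proof.
move=> c0; apply: eq_bigr => A _; congr (_ * _).
by rewrite -mulr_suml invfM [_^-1 / _]mulrC -mulrA mulVKf.
Qed.

Lemma open_simplex_normalize (y : E -> R) : (forall e, 0 < y e) ->
  let x := \row_e (y e / \sum_i y i) in
  open_simplex x /\ Phi (core_embedding x) = \row_e moment w setT y e.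
Proof.
move=> y0 x.
have [i _] : exists i : E, i \in [set: E] by apply/set0Pn; case/andP: core_setT.
have Y0 : 0 < \sum_i y i.
  by rewrite (bigD1 i) //= ltr_pwDl // sumr_ge0 // => j _; exact: ltW.
split.
  split=> [e|]; first by rewrite mxE divr_gt0.
  rewrite (eq_bigr (fun e => y e / \sum_i y i)) => [|e _]; last by rewrite mxE.
  by rewrite -mulr_suml divff // gt_eqF.
apply/rowP => e; rewrite -partial_momentT partial_moment_embedding mxE.
rewrite -[RHS](@moment_scale _ _ (\sum_i y i)^-1) ?invr_eq0 ?gt_eqF //.
by congr moment; apply/boolp.funext => j; rewrite mxE.
Qed.

Lemma inner_polytope_near p : inner_polytope p ->
  exists2 eps : R, 0 < eps &
    forall q : lengths, (forall e, `|p 0 e - q 0 e| < eps) -> inner_polytope q.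
Proof.
move=> [p0 pA].
have pos (h : lengths -> R) : continuous h -> 0 < h p -> \forall q \near p, 0 < h q.
  by move=> ch hp; exact: (cvgr_gt (h p) (ch p)).
have near_p : \forall q \near p, inner_polytope q.
  have near1 : nbhs p (fun q : lengths => forall e, 0 < q 0 e).
    apply: (@filter_forall _ _ (fun (e : E) (q : lengths) => 0 < q 0 e) (nbhs p) _) => e.
    apply: (pos (fun q : lengths => q 0 e)) => //.
    exact: coord_continuous.
  suff near2 : nbhs p (fun q : lengths => forall A, iscore A -> A != setT ->
      f A < \sum_(e in A) q 0 e) by apply: filterS2 near1 near2 => q; split.
  apply: (@filter_forall _ _ (fun A (q : lengths) => iscore A -> A != setT ->
      f A < \sum_(e in A) q 0 e) (nbhs p) _) => A.
  have [/andP[cA AT]|nA] := boolP (iscore A && (A != setT)); last first.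
    by apply: nearW => q cA AT; rewrite cA AT in nA.
  have := pos (fun q : lengths => \sum_(e in A) q 0 e - f A); rewrite subr_gt0 => h.
  apply: filterS (h _ (pA A cA AT)) => [q|q]; first by rewrite subr_gt0.
  apply: (@continuousB _ R^o _ (fun q : lengths => \sum_(e in A) q 0 e) (fun=> f A)).
    by apply: continuous_bigsum => e _; exact: coord_continuous.
  exact: cst_continuous.
have [eps eps0 h] := (iffLR (nbhs_ballP _ _) near_p).
by exists eps => // q pq; apply: h; split => // i j; rewrite (ord1 i); exact: pq.
Qed.

Let dist2 (p q : lengths) : R := \sum_e (q 0 e - p 0 e) ^+ 2.

Lemma dist2_continuous p : continuous (dist2 p).
Proof.
apply: continuous_bigsum => e _ q; apply: (@continuous_comp _ _ _
  (fun q : lengths => q 0 e - p 0 e) (fun x : R => x ^+ 2)); last exact: exprn_continuous.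
apply: (@continuousB _ R^o _ (fun q : lengths => q 0 e) (fun=> p 0 e)).
  exact: coord_continuous.
exact: cst_continuous.
Qed.

Lemma dist2_eq0 p q : dist2 p q = 0 -> q = p.
Proof.
move=> /eqP; rewrite psumr_eq0 => [/allP h|e _]; last exact: sqr_ge0.
apply/rowP => e; apply/eqP; rewrite -subr_eq0 -sqrf_eq0.
exact: h (mem_index_enum e).
Qed.

(** An interior value comes from an honest metric, at which [moment_descent] would otherwise produce
    a closer value. *)
Lemma moment_map_nearest p s : Sigma_space s -> \sum_e p 0 e = 1 ->
  inner_polytope (Phi s) ->
  (forall s', Sigma_space s' -> dist2 p (Phi s) <= dist2 p (Phi s')) -> Phi s = p.
Proof.
move=> sS p1 /(inner_polytope_preimage sS)[ox sE] min.
set x := component s setT in ox sE.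
have PhiE e : Phi s 0 e = moment w setT (x 0) e.
  by rewrite sE -partial_momentT partial_moment_embedding.
apply/rowP => e; apply/eqP/contraT => pe.
have [|||y y0] := moment_descent f_super f0 wf (simplex_pos ox) (p := p 0) (gap_gt0 core_setT).
- by move=> i j; apply: gapP.
- by rewrite fT.
- by exists e; rewrite -PhiE eq_sym.
have [oy Phiy] := open_simplex_normalize y0.
have := min _ (Sigma_embedding oy); rewrite leNgt => /negP nlt lt; case: nlt.
rewrite /dist2 Phiy (eq_bigr (fun i => (moment w setT y i - p 0 i) ^+ 2)); last first.
  by move=> i _; rewrite mxE.
by apply: lt_le_trans lt _; apply: ler_sum => i _; rewrite PhiE.
Qed.

(** The image point nearest to [p] could lie on the boundary, where no descent is available. Hence
    the segment from the image [q0] of equal lengths to [p], interior before [p]: compactness gives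
    an image point [q] on it nearest to [p], and any [q] other than [p] can be improved. *)
Lemma moment_map_surj p : moment_polytope f p -> exists2 s, Sigma_space s & Phi s = p.
Proof.
move=> [p0 p1 pA].
have [ou _] := open_simplex_normalize (y := fun=> 1) (fun=> ltr01).
set u := \row_e _ in ou; set q0 := Phi (core_embedding u).
have [q00 q0A] := inner_polytope_embedding ou; rewrite -/q0 in q00 q0A.
have [_ q01 _] := moment_polytope_map (Sigma_embedding ou); rewrite -/q0 in q01.
pose seg t : lengths := (1 - t) *: q0 + t *: p.
have segE t e : seg t 0 e = (1 - t) * q0 0 e + t * p 0 e by rewrite !mxE.
have seg1 t : \sum_e seg t 0 e = 1.
  rewrite (eq_bigr (fun e => (1 - t) * q0 0 e + t * p 0 e)) => [|e _]; last exact: segE.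
  by rewrite big_split /= -!mulr_sumr q01 p1; ring.
have seg_inner t : 0 <= t < 1 -> inner_polytope (seg t).
  move=> /andP[t0 t1]; split=> [e|A cA AT].
    rewrite segE; apply: ltr_pwDl; last exact: mulr_ge0.
    by rewrite mulr_gt0 // subr_gt0.
  rewrite (eq_bigr (fun e => (1 - t) * q0 0 e + t * p 0 e)) => [|e _]; last exact: segE.
  rewrite big_split /= -!mulr_sumr.
  have := q0A A cA AT; rewrite -(@ltr_pM2l _ (1 - t)) ?subr_gt0 // => h1.
  have := ler_wpM2l t0 (pA A cA); lra.
have K : compact (Phi @` @Sigma_space R G)%classic.
  apply: continuous_compact; last exact: Sigma_compact.
  exact/continuous_subspaceT/moment_map_continuous.
have Kseg : compact (seg @` `[0, 1])%classic.
  apply: continuous_compact; last exact: segment_compact.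
  apply: continuous_subspaceT; apply: continuous_rV => e.
  rewrite (_ : (fun _ => _) = fun t => (1 - t) * q0 0 e + t * p 0 e); last first.
    by apply/boolp.funext => t; rewrite segE.
  exact: affine_continuous.
have K0 : (Phi @` @Sigma_space R G `&` seg @` `[0, 1] !=set0)%classic.
  exists q0; split; first by exists (core_embedding u) => //; exact: Sigma_embedding.
  exists 0; first by rewrite /= in_itv /= lexx ler01.
  by apply/rowP => e; rewrite segE; ring.
have [q] := compact_EVT_min K0 (compact_closedI K (compact_closed (@norm_hausdorff _ _) Kseg))
  (continuous_subspaceT (dist2_continuous (p := p))).
rewrite in_setE => -[[s sS sq] [t]] /=; rewrite in_itv /= => /andP[t0 t1] tq qmin.
have [<-|qp] := eqVneq q p; first by exists s.
have {}t1 : t < 1.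
  rewrite lt_neqAle t1 andbT; apply: contra_neq qp => t1E.
  by rewrite -tq t1E; apply/rowP => e; rewrite segE; ring.
have [eps eps0 near_q] := inner_polytope_near (seg_inner t (introT andP (conj t0 t1))).
pose V := \sum_e `|p 0 e - q0 0 e|; have V0 : 0 <= V by rewrite sumr_ge0.
(* The next target [seg (t + d)] and its nearest image point [q'] differ by at most [d * V] in each
   coordinate, as do the target and [q]. So [2 * (d * V) < eps] keeps [q'] interior, and [q'] is the
   target by [moment_map_nearest]. *)
pose d := Num.min (1 - t) (eps / (2 * V + 1)).
have V1 : 0 < 2 * V + 1 by lra.
have d0 : 0 < d by rewrite lt_min subr_gt0 t1 divr_gt0.
have dV : 2 * (d * V) < eps.
  have : d <= eps / (2 * V + 1) by rewrite ge_min lexx orbT.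
  by rewrite ler_pdivlMr // mulrDr mulr1; lra.
have td1 : t + d <= 1.
  have : d <= 1 - t by rewrite ge_min lexx.
  lra.
have Kne : (Phi @` @Sigma_space R G !=set0)%classic by case: K0 => z [Kz _]; exists z.
have [q' ] := compact_EVT_min Kne K (continuous_subspaceT (dist2_continuous (p := seg (t + d)))).
rewrite in_setE => -[s' sS' sq'] q'min.
have segd e : `|seg (t + d) 0 e - q 0 e| <= d * V.
  rewrite -tq !segE.
  have -> : (1 - (t + d)) * q0 0 e + (t + d) * p 0 e - ((1 - t) * q0 0 e + t * p 0 e) =
     d * (p 0 e - q0 0 e) by ring.
  rewrite normrM gtr0_norm // ler_pM2l // /V (bigD1 e) //= lerDl sumr_ge0 //.
have sq_sum (h : E -> R) : \sum_e h e ^+ 2 <= (\sum_e `|h e|) ^+ 2.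
  rewrite [leRHS]expr2 mulr_suml; apply: ler_sum => e _.
  rewrite -real_normK ?num_real // expr2 ler_wpM2l //.
  by rewrite (bigD1 e) //= lerDl sumr_ge0.
have q'd e : `|seg (t + d) 0 e - q' 0 e| <= d * V.
  have dV0 : 0 <= d * V by rewrite mulr_ge0 // ltW.
  rewrite -ler_sqr ?nnegrE // real_normK ?num_real //.
  apply: le_trans (_ : dist2 (seg (t + d)) q' <= _).
    rewrite /dist2 (bigD1 e) //= -[leLHS]sqrrN opprB lerDl sumr_ge0 // => i _; exact: sqr_ge0.
  apply: le_trans (q'min q _) _; first by rewrite in_setE; exists s.
  rewrite /dist2; apply: le_trans (sq_sum _) _.
  rewrite ler_sqr ?nnegrE ?sumr_ge0 //.
  rewrite /V mulr_sumr; apply: ler_sum => i _; rewrite -tq !segE.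
  have -> : (1 - t) * q0 0 i + t * p 0 i - ((1 - (t + d)) * q0 0 i + (t + d) * p 0 i) =
     d * (q0 0 i - p 0 i) by ring.
  by rewrite normrM gtr0_norm // distrC.
have q'inner : inner_polytope q'.
  apply: near_q => e; rewrite tq; apply: le_lt_trans dV.
  have := segd e; have := q'd e; rewrite !ler_norml; lra.
have q'E : Phi s' = seg (t + d).
  apply: moment_map_nearest => //; first by rewrite sq'.
  by move=> s'' sS''; rewrite sq'; apply: q'min; rewrite in_setE; exists s''.
have := qmin (seg (t + d)); rewrite in_setE => /(_ _)/= H.
have {H} : dist2 p q <= dist2 p (seg (t + d)).
  apply: H; split; first by exists s'.
  by exists (t + d) => //=; rewrite in_itv /= td1 andbT; lra.
have D r : dist2 p (seg r) = (1 - r) ^+ 2 * dist2 p q0.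
  by rewrite /dist2 mulr_sumr; apply: eq_bigr => e _; rewrite segE; ring.
rewrite -tq !D.
have N0 : 0 < dist2 p q0.
  rewrite lt_neqAle sumr_ge0 ?andbT => [|e _]; last exact: sqr_ge0.
  apply/eqP => /esym/dist2_eq0 q0p; case/eqP: qp.
  by rewrite -tq; apply/rowP => e; rewrite segE q0p; ring.
rewrite ler_pM2r // ler_sqr ?nnegrE; lra.
Qed.

End MomentHomeomorphism.

(** * Connectivity and rank of subgraphs *)

Section Connectivity.
Import mathcomp.boot.fintype mathcomp.boot.finset.
Implicit Type G : graph.

Definition joined G (H : {set 'I_(ne G)}) : rel 'I_(nv G) :=
  connect (adjacent H).

Lemma adjacent_sym G (H : {set 'I_(ne G)}) : symmetric (adjacent H).
Proof. by move=> u v; apply: eq_existsb => e; rewrite orbC. Qed.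

Lemma joined_sym G (H : {set 'I_(ne G)}) : symmetric (joined H).
Proof. exact/sym_connect_sym/adjacent_sym. Qed.

Lemma joined_trans G (H : {set 'I_(ne G)}) : transitive (joined H).
Proof. exact: connect_trans. Qed.

Lemma joined_refl G (H : {set 'I_(ne G)}) : reflexive (joined H).
Proof. exact: connect0. Qed.

Lemma joined_edge G (H : {set 'I_(ne G)}) e : e \in H -> joined H (src e) (tgt e).
Proof. by move=> eH; apply: connect1; apply/existsP; exists e; rewrite eH !eqxx. Qed.

(** Replaces inductions on paths: connectivity is used by exhibiting a quantity that is constant
    along edges. *)
Lemma joined_invariant (T : Type) G (H : {set 'I_(ne G)}) (h : 'I_(nv G) -> T) u v :
  (forall e, e \in H -> h (src e) = h (tgt e)) -> joined H u v -> h u = h v.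
Proof.
move=> hH /connectP[p + ->]; elim: p u => //= w p IH u /andP[+ /IH <-].
by case/existsP=> e /andP[/hH he /orP[]/andP[/eqP<- /eqP<-]].
Qed.

Lemma joined_map G G' (H : {set 'I_(ne G)}) (H' : {set 'I_(ne G')})
    (h : 'I_(nv G) -> 'I_(nv G')) u v :
  (forall e, e \in H -> joined H' (h (src e)) (h (tgt e))) ->
  joined H u v -> joined H' (h u) (h v).
Proof.
move=> hH uv.
rewrite -(joined_invariant (h := fun w => joined H' (h u) (h w)) _ uv).
  exact: joined_refl.
move=> e /hH he; apply/idP/idP => /joined_trans; apply => //.
by rewrite joined_sym.
Qed.

Lemma joined_sub G (H K : {set 'I_(ne G)}) u v :
  H \subset K -> joined H u v -> joined K u v.
Proof.
move=> HK; apply: (joined_map (h := id)) => e eH.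
by apply: joined_edge; exact: (subsetP HK).
Qed.

Lemma joinedD1 G (H : {set 'I_(ne G)}) e u v :
  joined (H :\ e) (src e) (tgt e) -> joined (H :\ e) u v = joined H u v.
Proof.
move=> he; apply/idP/idP; first by apply: joined_sub; exact: subD1set.
apply: (joined_map (h := id)) => e' e'H; have [->//|ne] := eqVneq e' e.
by apply: joined_edge; rewrite !inE ne.
Qed.

Lemma closed_support G (H K : {set 'I_(ne G)}) : K \subset H ->
  fingraph.closed (adjacent K) (support H).
Proof.
move=> KH u v /existsP[e /andP[/(subsetP KH) eH uv]].
have [] : u \in support H /\ v \in support H; last by move=> -> ->.
by rewrite !inE; split; apply/existsP; exists e; rewrite eH /=;
  case/orP: uv => /andP[uE vE]; rewrite ?uE ?vE ?orbT.
Qed.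

(** Roots of [H] map injectively to roots of [H :\ e]. If the ends of [e] are separated, their two
    roots cannot both be hit, as the ends lie in one component of [H]. *)
Lemma componentsD1 G (W : {set 'I_(nv G)}) (H : {set 'I_(ne G)}) e :
  fingraph.closed (adjacent (H :\ e)) W -> src e \in W -> tgt e \in W -> e \in H ->
  (components W (H :\ e) <= components W H)%N =
  joined (H :\ e) (src e) (tgt e).
Proof.
move=> cW sW tW eH; apply/idP/idP; last first.
  move=> he; rewrite /components (eq_n_comp (e' := adjacent H)) // => u v.
  exact: joinedD1 he.
apply: contraLR => nj; rewrite -ltnNge.
have s1 := sym_connect_sym (@adjacent_sym G H).
have s2 := sym_connect_sym (@adjacent_sym G (H :\ e)).
pose r := fingraph.root (adjacent (H :\ e)).
have rW u : u \in W -> r u \in W.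
  by move=> uW; rewrite -(closed_connect cW (connect_root _ u)).
have rj u v : (r u == r v) = joined (H :\ e) u v by rewrite root_connect.
have r_inj : {in [predI roots (adjacent H) & W] &, injective r}.
  move=> u v /andP[ru _] /andP[rv _] /eqP; rewrite rj.
  move/(joined_sub (subD1set _ _)); rewrite /joined -root_connect //.
  by rewrite (eqP ru) (eqP rv) => /eqP.
rewrite /components /n_comp_mem -(card_in_imset r_inj).
apply: proper_card; apply/properP; split.
  apply/subsetP => _ /imsetP[u /andP[_ uW] ->]; rewrite inE /= rW // andbT.
  exact: roots_root.
suff : ~~ ((r (src e) \in r @: [predI roots (adjacent H) & W]) &&
           (r (tgt e) \in r @: [predI roots (adjacent H) & W])).
  by rewrite negb_and => /orP[] nr; eexists; try exact: nr;
    rewrite inE /= roots_root //= rW.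
apply/negP => /andP[/imsetP[u uA su] /imsetP[v vA tv]].
have/eqP := su; rewrite rj => /(joined_sub (subD1set _ _)) ju.
have/eqP := tv; rewrite rj => /(joined_sub (subD1set _ _)) jv.
have uv : joined H u v.
  apply: joined_trans jv; rewrite joined_sym in ju; apply: joined_trans ju _.
  exact: joined_edge.
move: uv; rewrite /joined -root_connect //.
case/andP: uA vA => ru _ /andP[rv _]; rewrite (eqP ru) (eqP rv) => /eqP uv.
by case/negP: nj; rewrite -rj su tv uv.
Qed.

Lemma coreP G (H : {set 'I_(ne G)}) :
  reflect (forall e, e \in H -> joined (H :\ e) (src e) (tgt e)) (core H).
Proof.
apply: (iffP forallP) => h e.
  move=> eH; have := h e; rewrite eH /= componentsD1 //.
  - exact/closed_support/subD1set.
  - by rewrite inE; apply/existsP; exists e; rewrite eH eqxx.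
  - by rewrite inE; apply/existsP; exists e; rewrite eH eqxx orbT.
apply/implyP => eH; rewrite componentsD1 //; first exact: h.
- exact/closed_support/subD1set.
- by rewrite inE; apply/existsP; exists e; rewrite eH eqxx.
- by rewrite inE; apply/existsP; exists e; rewrite eH eqxx orbT.
Qed.

Lemma core_bigcup G (P : pred {set 'I_(ne G)}) :
  (forall A, P A -> core A) -> core (\bigcup_(A | P A) A).
Proof.
move=> cP; apply/coreP => e /bigcupP[A PA eA].
apply: joined_sub (elimT (coreP _) (cP A PA) e eA).
by apply: setSD; exact: bigcup_sup.
Qed.

Lemma components1P G (H : {set 'I_(ne G)}) :
  components [set: 'I_(nv G)] H = 1%N <->
  (0 < nv G)%N /\ forall u v, joined H u v.
Proof.
have cs := sym_connect_sym (@adjacent_sym G H).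
rewrite /components /n_comp_mem; split.
  move=> /eqP/card1P => -[r rP].
  have root_r u : fingraph.root (adjacent H) u = r.
    apply/eqP; have := rP (fingraph.root (adjacent H) u).
    by rewrite !inE /= roots_root // andbT => <-.
  split; first by apply: leq_ltn_trans (ltn_ord r).
  by move=> u v; rewrite /joined -root_connect // !root_r.
move=> [V0 j]; pose u0 := Ordinal V0.
apply/eqP/card1P; exists (fingraph.root (adjacent H) u0) => u.
rewrite !inE andbT /roots; have : fingraph.root (adjacent H) u = fingraph.root (adjacent H) u0.
  by apply/eqP; rewrite root_connect //; exact: j.
by rewrite eq_sym => <-.
Qed.

End Connectivity.

(** * The rank of homology as edges are added *)

Section Nullity.
Import mathcomp.boot.fintype mathcomp.boot.finset.
Variable G : graph.
Local Notation E := 'I_(ne G).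
Implicit Types (A H S T : {set E}) (e : E).

Definition edge_boundary e : 'rV[rat]_(nv G) :=
  \row_v ((tgt e == v)%:R - (src e == v)%:R).

(** The row space of [boundary_mx H] without a numbering of [H], so that adding an edge adds a
    summand. *)
Definition boundary_span H : 'M[rat]_(nv G) := (\sum_(e in H) <<edge_boundary e>>)%MS.

Lemma boundary_mx_span H : \rank (boundary_mx H) = \rank (boundary_span H).
Proof.
have row_b i : row i (boundary_mx H) = edge_boundary (enum_val i).
  by apply/rowP => v; rewrite !mxE.
apply/eqP; rewrite eqn_leq; apply/andP; split; apply: mxrankS.
  apply/row_subP => i; rewrite row_b.
  by rewrite (sumsmx_sup (enum_val i)) ?enum_valP // genmxE.
apply/sumsmx_subP => e eH; rewrite genmxE -(enum_rankK_in eH eH) -row_b.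
exact: row_sub.
Qed.

(** If the ends of [e] are separated, the indicator of the component of [src e] is a functional that
    kills the boundaries from [H] but not that of [e]. *)
Lemma boundary_span_joined H e :
  (edge_boundary e <= boundary_span H)%MS = joined H (src e) (tgt e).
Proof.
apply/idP/idP => [eH|].
  pose c : 'cV[rat]_(nv G) := \col_v (joined H (src e) v)%:R.
  have bc e' : (edge_boundary e' *m c) 0 0 =
      (joined H (src e) (tgt e'))%:R - (joined H (src e) (src e'))%:R.
    rewrite mxE (eq_bigr (fun v => (tgt e' == v)%:R * c v 0 - (src e' == v)%:R * c v 0)).
      rewrite sumrB (bigD1 (tgt e')) //= eqxx mul1r big1 ?addr0; last first.
        by move=> v /negbTE; rewrite eq_sym => ->; rewrite mul0r.
      rewrite (bigD1 (src e')) //= eqxx mul1r big1 ?addr0 ?mxE // => v /negbTE.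
      by rewrite eq_sym => ->; rewrite mul0r.
    by move=> v _; rewrite mxE mulrBl.
  have : (boundary_span H <= kermx c)%MS.
    apply/sumsmx_subP => e' e'H; rewrite genmxE; apply/sub_kermxP.
    apply/matrixP => i j; rewrite (ord1 i) (ord1 j) bc mxE.
    suff -> : joined H (src e) (tgt e') = joined H (src e) (src e') by rewrite subrr.
    have je := joined_edge e'H.
    by apply/idP/idP => /joined_trans; apply => //; rewrite joined_sym.
  move/(submx_trans eH)/sub_kermxP/matrixP/(_ 0 0); rewrite bc mxE joined_refl.
  by case: (joined _ _ _) => // /eqP; rewrite sub0r oppr_eq0 oner_eq0.
pose d u : 'rV[rat]_(nv G) := \row_v ((u == v)%:R - (src e == v)%:R).
move=> j; have -> : edge_boundary e = d (tgt e) by [].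
rewrite -(joined_invariant (h := fun u => (d u <= boundary_span H)%MS) _ j).
  rewrite (_ : d (src e) = 0) ?sub0mx //.
  by apply/rowP => v; rewrite !mxE subrr.
move=> e' e'H; have b' : (edge_boundary e' <= boundary_span H)%MS.
  by rewrite (sumsmx_sup e') // genmxE.
have dE : d (tgt e') = d (src e') + edge_boundary e'.
  by apply/rowP => v; rewrite !mxE; ring.
apply/idP/idP => h; first by rewrite dE addmx_sub.
have -> : d (src e') = d (tgt e') - edge_boundary e' by rewrite dE addrK.
by rewrite addmx_sub // eqmx_opp.
Qed.

Lemma h1_rankE H : h1_rank H = (#|H| - \rank (boundary_span H))%N.
Proof. by rewrite /h1_rank mxrank_ker boundary_mx_span. Qed.

Lemma boundary_span_le H : (\rank (boundary_span H) <= #|H|)%N.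
Proof. by rewrite -boundary_mx_span; exact: rank_leq_row. Qed.

(** The passage from linear algebra to connectivity: ranks of subgraphs are computed below by
    inductions on edges. *)
Lemma h1_rank_setU1 H e : e \notin H ->
  h1_rank (e |: H) = (joined H (src e) (tgt e) + h1_rank H)%N.
Proof.
move=> eH; rewrite !h1_rankE cardsU1 eH add1n.
have spanU : (boundary_span (e |: H) :=: <<edge_boundary e>> + boundary_span H)%MS.
  by rewrite /boundary_span big_setU1.
have := boundary_span_le H; rewrite spanU.
have [j|nj] := boolP (joined H (src e) (tgt e)).
  move: j; rewrite -boundary_span_joined => j.
  have -> : \rank (<<edge_boundary e>> + boundary_span H) = \rank (boundary_span H).
    apply/eqP; rewrite eqn_leq; apply/andP; split; apply: mxrankS.
      by rewrite addsmx_sub genmxE j submx_refl.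
    exact: addsmxSr.
  by move=> le; rewrite subSn.
move: nj; rewrite -boundary_span_joined => nj.
have -> : \rank (<<edge_boundary e>> + boundary_span H) = (\rank (boundary_span H)).+1.
  have := mxrank_sum_cap <<edge_boundary e>>%MS (boundary_span H).
  have b1 : (\rank <<edge_boundary e>> <= 1)%N by rewrite genmxE rank_leq_row.
  have cap : (\rank (<<edge_boundary e>> :&: boundary_span H) < \rank <<edge_boundary e>>)%N.
    rewrite ltnNge; apply: contra nj => h.
    have := mxrank_leqif_sup (capmxSl <<edge_boundary e>>%MS (boundary_span H)).
    move=> [l eqv]; have : \rank (<<edge_boundary e>> :&: boundary_span H) == \rank <<edge_boundary e>>.
      by rewrite eqn_leq l.
    by rewrite eqv sub_capmx => /andP[_]; rewrite genmxE.
  by lia.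
by rewrite subSS.
Qed.

Lemma h1_rank0 : h1_rank (finset.set0 : {set E}) = 0%N.
Proof. by rewrite h1_rankE cards0. Qed.

Lemma h1_rankD1 S e : e \in S ->
  h1_rank S = (joined (S :\ e) (src e) (tgt e) + h1_rank (S :\ e))%N.
Proof. by move=> eS; rewrite -{1}(setD1K eS) h1_rank_setU1 // !inE eqxx. Qed.

Lemma h1_rank_mono S T : S \subset T -> (h1_rank S <= h1_rank T)%N.
Proof.
have [k] := ubnP #|T|; elim: k T => // k IH T; rewrite ltnS => cT ST.
have [->//|ne] := eqVneq S T.
have /properP[_ [e eT eS]] : S \proper T by rewrite properEneq ne.
rewrite (h1_rankD1 eT); apply: leq_trans (leq_addl _ _).
apply: IH; last by rewrite subsetD1 ST eS.
by apply: leq_trans cT; rewrite (cardsD1 e T) eT.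
Qed.

(** Induction on the edges of [S] outside [T]: an edge that closes a cycle in a subgraph also closes
    one in a larger subgraph. *)
Lemma h1_rank_super S T :
  (h1_rank S + h1_rank T <= h1_rank (S :|: T) + h1_rank (S :&: T))%N.
Proof.
have [k] := ubnP #|S :\: T|; elim: k S => // k IH S; rewrite ltnS => cS.
have [|[e]] := set_0Vmem (S :\: T).
  move/eqP; rewrite setD_eq0 => ST.
  by rewrite (setUidPr ST) (setIidPl ST) addnC.
rewrite inE => /andP[eT eS].
have {}IH : (h1_rank (S :\ e) + h1_rank T <=
    h1_rank ((S :\ e) :|: T) + h1_rank (S :&: T))%N.
  have -> : S :&: T = (S :\ e) :&: T.
    by apply/setP=> i; rewrite !inE; case: eqP => // ->; rewrite (negbTE eT) andbF.
  apply: IH; apply: leq_trans cS.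
  by rewrite [X in (_ < X)%N](cardsD1 e) !inE eS eT setDDl finset.setUC -setDDl add1n ltnS.
have eST : e \in S :|: T by rewrite inE eS.
rewrite (h1_rankD1 eS) (h1_rankD1 eST).
have -> : (S :|: T) :\ e = (S :\ e) :|: T.
  by apply/setP=> i; rewrite !inE; case: eqP => // ->; rewrite (negbTE eT).
have : (joined (S :\ e) (src e) (tgt e) <= joined (S :\ e :|: T) (src e) (tgt e))%N.
  case j: (joined (S :\ e) _ _) => //.
  by rewrite (joined_sub (finset.subsetUl _ _) j).
by move=> le; rewrite -!addnA; exact: leq_add le IH.
Qed.

Lemma core_h1_rank A e : core A -> e \in A -> h1_rank A = (h1_rank (A :\ e)).+1.
Proof. by move=> /coreP cA eA; rewrite (h1_rankD1 eA) cA. Qed.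

Lemma noncore_bridge A : ~~ core A ->
  exists2 e, e \in A & ~~ joined (A :\ e) (src e) (tgt e).
Proof.
move=> nA; apply/exists_inP; apply: contraNT nA; rewrite negb_exists_in.
by move=> /forall_inP h; apply/coreP => e /h; rewrite negbK.
Qed.

(** Separating edges are deleted one by one, which does not change the rank. *)
Lemma exists_core S : exists A, [/\ core A, A \subset S & h1_rank A = h1_rank S].
Proof.
have [k] := ubnP #|S|; elim: k S => // k IH S; rewrite ltnS => cS.
have [cS'|/noncore_bridge[e eS nj]] := boolP (core S); first by exists S.
have [|A [cA AS rA]] := IH (S :\ e).
  by apply: leq_trans cS; rewrite (cardsD1 e S) eS.
exists A; split=> //; first by apply: subset_trans AS _; exact: subD1set.
by rewrite (h1_rankD1 eS) (negbTE nj).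
Qed.

End Nullity.

(** * Forests as subgraphs of rank zero *)

Section Forests.
Import mathcomp.boot.fintype mathcomp.boot.finset.
Variable G : graph.
Local Notation dart := ('I_(ne G) * bool)%type.
Implicit Types (A F H : {set 'I_(ne G)}) (p : seq dart).

Lemma epath_joined H u p v : epath u p v -> all (fun d => d.1 \in H) p ->
  joined H u v.
Proof.
elim: p u => [|d p IH] u /=; first by move=> /eqP-> _; exact: joined_refl.
move=> /andP[/eqP<- pv] /andP[dH pH]; apply: joined_trans (IH _ pv pH).
by rewrite /org /dst; case: d.2; [rewrite joined_sym|]; exact: joined_edge.
Qed.

(** The clause on both ends of each dart serves the induction: as the first vertex is not revisited,
    the new dart repeats neither an edge nor an origin. *)
Lemma upath_epath H u q : path (adjacent H) u q -> uniq (u :: q) ->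
  exists p : seq dart, [/\ epath u p (last u q), all (fun d => d.1 \in H) p,
    uniq (map fst p), uniq (map (@org G) p) & last u q \notin map (@org G) p]
  /\ forall d, d \in p -> (org d \in u :: q) && (dst d \in u :: q).
Proof.
elim: q u => [|w q IH] u /=; first by move=> _ _; exists [::]; split=> //; split=> //=.
move=> /andP[uw wq] /andP[uq uniq_q].
have [p [[pv pH pf po vp] ends]] := IH w wq uniq_q.
have [d [dH du dw]] : exists d : dart, [/\ d.1 \in H, org d = u & dst d = w].
  case/existsP: uw => e /andP[eH /orP[]/andP[/eqP a /eqP b]].
    by exists (e, false).
  by exists (e, true).
exists (d :: p); split; first split=> //=.
- by rewrite du eqxx dw.
- by rewrite dH.
- rewrite pf andbT; apply/mapP => -[d' d'p dd'].
  have /andP[d1 d2] := ends d' d'p.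
  have : (org d == org d') || (org d == dst d').
    by rewrite /org /dst dd'; case: d.2; case: d'.2; rewrite eqxx ?orbT.
  by case/orP=> /eqP E; move: uq; rewrite -du E ?d1 ?d2.
- rewrite po andbT; apply/mapP => -[d' d'p dd'].
  have /andP[d1 d2] := ends d' d'p.
  by move: uq; rewrite -du dd' d1.
- rewrite inE negb_or vp andbT du; apply: contraNneq uq => <-.
  exact: mem_last.
- move=> d'; rewrite inE => /predU1P[->|/ends/andP[d1 d2]].
    by rewrite du dw !inE !eqxx ?orbT.
  by rewrite in_cons d1 orbT in_cons d2 orbT.
Qed.

Lemma joined_epath H u v : joined H u v -> exists p,
  [/\ epath u p v, all (fun d => d.1 \in H) p, uniq (map fst p),
      uniq (map (@org G) p) & v \notin map (@org G) p].
Proof.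
case/connectP => q0 /shortenP[q pq uq _] ->.
by have [p [h _]] := upath_epath pq uq; exists p.
Qed.

(** A loop without its first edge joins the ends of that edge and so forces positive rank.
    Conversely, an edge of a nonempty core and a simple path in the core joining its ends without it
    form a loop. *)
Lemma forestP F : forest F <-> h1_rank F = 0%N.
Proof.
split=> [fF|r0 v [|d p]]; last first.
- apply/negP => /and5P[_ /= /andP[/eqP dv pv] /andP[dF pF] /andP[dp _] _].
  have /epath_joined : epath (dst d) p v by [].
  move=> /(_ (F :\ d.1)) j; have : joined (F :\ d.1) (dst d) v.
    apply: j; apply/allP => d' d'p; rewrite !inE (allP pF) // andbT.
    by apply: contraNneq dp => <-; apply: map_f.
  have := h1_rankD1 dF; rewrite r0 -dv /org /dst => /esym/eqP.
  rewrite addn_eq0 => /andP[nj _]; case: d.2 => jd; move: nj; last first.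
    by rewrite joined_sym jd.
  by rewrite jd.
- by rewrite /loop_in.
have [A [cA AF rA]] := exists_core F; rewrite -rA.
have [->|[e eA]] := set_0Vmem A; first exact: h1_rank0.
have [p [pv pA pf po vp]] := joined_epath (elimT (coreP _) cA e eA).
case/negP: (fF (tgt e) ((e, true) :: p)); apply/and5P; split=> //=.
- by rewrite /org /dst /= eqxx.
- rewrite (subsetP AF) //=; apply: sub_all pA => d; rewrite !inE => /andP[_].
  exact: (subsetP AF).
- rewrite pf andbT; apply/mapP => -[d dp de].
  by have := allP pA d dp; rewrite -de !inE eqxx.
- by rewrite po andbT.
Qed.

End Forests.

(** * Forest collapses *)

Section CollapseFacts.
Import mathcomp.boot.fintype mathcomp.boot.finset.
Variables (G H : graph) (k : cmap G H).
Hypothesis kP : forest_collapse k.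
Implicit Types (A : {set 'I_(ne G)}) (C : {set 'I_(ne H)}).

(** The full preimage, collapsed edges included since [all] holds for their empty words. It is right
    adjoint to [image_edges]. *)
Definition preim_edges C : {set 'I_(ne G)} :=
  [set e | all (fun d => d.1 \in C) (fe k e)].

Lemma collapse_edge_ex e' : exists e, e' \in map fst (fe k e).
Proof. by case: kP => _ _ _ _ /(_ e')[e [h _]]; exists e. Qed.

Definition lift_edge e' : 'I_(ne G) := xchoose (collapse_edge_ex e').

Lemma lift_edgeP e' : exists b, fe k (lift_edge e') = [:: (e', b)].
Proof.
have := xchooseP (collapse_edge_ex e'); rewrite -/(lift_edge e').
case: kP => _ _ _ /(_ (lift_edge e')) + _.
by case: (fe k (lift_edge e')) => [|[a b] [|]] //= _; rewrite inE => /eqP->; exists b.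
Qed.

Lemma collapse_edgeP e : e \in collapsed k \/
  exists e' b, fe k e = [:: (e', b)] /\ e = lift_edge e'.
Proof.
case: kP => _ _ _ sz uq; have := sz e; rewrite inE.
case E: (fe k e) => [|[e' b] [|]] //= _; [by left|right; exists e', b; split=> //].
have [e0 [_ u]] := uq e'; have <- : e0 = e by apply: u; rewrite E mem_head.
by apply: u; have [b' ->] := lift_edgeP e'; rewrite mem_head.
Qed.

Lemma lift_edge_inj : injective lift_edge.
Proof.
move=> e1 e2 E; have [b1] := lift_edgeP e1; rewrite E.
by have [b2 ->] := lift_edgeP e2 => -[].
Qed.

Lemma lift_edge_collapsed e' : lift_edge e' \notin collapsed k.
Proof. by have [b E] := lift_edgeP e'; rewrite inE E. Qed.

Lemma lift_edge_ends e' :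
  (fv k (src (lift_edge e')) = src e' /\ fv k (tgt (lift_edge e')) = tgt e') \/
  (fv k (src (lift_edge e')) = tgt e' /\ fv k (tgt (lift_edge e')) = src e').
Proof.
have := fe_path k (lift_edge e'); have [b ->] := lift_edgeP e' => /=.
by rewrite /org /dst /=; case: b => /andP[/eqP<- /eqP<-]; [right|left].
Qed.

Lemma mem_preim_lift C e' : (lift_edge e' \in preim_edges C) = (e' \in C).
Proof. by rewrite inE; have [b ->] := lift_edgeP e'; rewrite /= andbT. Qed.

Lemma collapsed_preim C : collapsed k \subset preim_edges C.
Proof. by apply/subsetP => e; rewrite !inE => /eqP->. Qed.

Lemma preim_edges0 : preim_edges finset.set0 = collapsed k.
Proof.
apply/setP => e; rewrite !inE; case: (fe k e) => //= d p.
by rewrite inE.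
Qed.

Lemma preim_edgesT : preim_edges setT = setT.
Proof. by apply/setP => e; rewrite !inE; apply/allP => d _; rewrite inE. Qed.

Lemma preim_edgesU1 C e' :
  preim_edges (e' |: C) = lift_edge e' |: preim_edges C.
Proof.
apply/setP => e; have [eF|[d [b [E ->]]]] := collapse_edgeP e.
  have eC D : e \in preim_edges D by rewrite (subsetP (collapsed_preim D)).
  by rewrite in_setU1 !eC orbT.
by rewrite in_setU1 !mem_preim_lift in_setU1 (inj_eq lift_edge_inj).
Qed.

Lemma image_edges_sub A C : (image_edges k A \subset C) = (A \subset preim_edges C).
Proof.
apply/subsetP/subsetP => h e; rewrite inE.
  move=> eA; apply/allP => d dk; apply: h; rewrite inE.
  by apply/exists_inP; exists e => //; apply: map_f.
by case/exists_inP => e0 /h; rewrite inE => /allP + /mapP[d dk ->]; exact.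
Qed.

Lemma mem_image_edges A e' : (e' \in image_edges k A) = (lift_edge e' \in A).
Proof.
rewrite inE; apply/exists_inP/idP => [[e eA]|eA].
  have [|[e1 [b [-> eE]]]] := collapse_edgeP e; first by rewrite inE => /eqP->.
  by rewrite inE => /eqP-> /=; rewrite -eE.
by exists (lift_edge e') => //; have [b ->] := lift_edgeP e'; exact: mem_head.
Qed.

Lemma joined_fiber C u v : fv k u = fv k v -> joined (preim_edges C) u v.
Proof.
case: kP => _ + _ _ _ => /(_ u v) /esym uv /eqP kuv; rewrite kuv in uv.
exact: joined_sub (collapsed_preim C) uv.
Qed.

(** Paths lift because vertices with the same image are joined by collapsed edges, which lie in
    every full preimage. *)
Lemma joined_collapse C u v :
  joined (preim_edges C) u v = joined C (fv k u) (fv k v).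
Proof.
apply/idP/idP.
  apply: joined_map => e; rewrite inE; exact: epath_joined (fe_path k e).
have surj v' : exists v, fv k v == v'.
  by case: kP => _ _ /(_ v')[w kw] _ _; exists w; apply/eqP.
pose pre v' := xchoose (surj v').
have preK v' : fv k (pre v') = v' by apply/eqP/(xchooseP (surj v')).
move=> uv; apply: joined_trans (joined_fiber C (preK (fv k v))).
rewrite -(joined_invariant (h := fun w => joined (preim_edges C) u (pre w)) _ uv).
  by apply: joined_fiber; rewrite preK.
move=> e' e'C; have je : joined (preim_edges C) (pre (src e')) (pre (tgt e')).
  have je : joined (preim_edges C) (src (lift_edge e')) (tgt (lift_edge e')).
    by apply: joined_edge; rewrite mem_preim_lift.
  have [[s t]|[s t]] := lift_edge_ends e'.
    apply: (joined_trans (y := src (lift_edge e'))); first by apply: joined_fiber; rewrite preK.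
    by apply: joined_trans je _; apply: joined_fiber; rewrite preK.
  apply: (joined_trans (y := tgt (lift_edge e'))); first by apply: joined_fiber; rewrite preK.
  rewrite joined_sym in je; apply: joined_trans je _.
  by apply: joined_fiber; rewrite preK.
by apply/idP/idP => /joined_trans; apply; rewrite // joined_sym.
Qed.

Lemma joined_lift C e' : joined C (fv k (src (lift_edge e'))) (fv k (tgt (lift_edge e'))) =
  joined C (src e') (tgt e').
Proof. by have [[-> ->]|[-> ->]] := lift_edge_ends e' => //; rewrite joined_sym. Qed.

(** The collapsed set being a forest is the base case; each further edge closes a cycle upstairs
    exactly when it does downstairs. *)
Lemma h1_rank_collapse C : h1_rank (preim_edges C) = h1_rank C.
Proof.
have [m] := ubnP #|C|; elim: m C => // m IH C; rewrite ltnS => cC.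
have [->|[e' e'C]] := set_0Vmem C.
  by rewrite preim_edges0 h1_rank0; apply/forestP; case: kP.
have ne : e' \notin C :\ e' by rewrite !inE eqxx.
rewrite -(setD1K e'C) preim_edgesU1 !h1_rank_setU1 ?mem_preim_lift //.
rewrite joined_collapse joined_lift IH //.
by apply: leq_trans cC; rewrite (cardsD1 e' C) e'C.
Qed.

Lemma core_image A : core A -> core (image_edges k A).
Proof.
move/coreP => cA; apply/coreP => e'; rewrite mem_image_edges => eA.
rewrite -joined_lift -joined_collapse; apply: joined_sub (cA _ eA).
rewrite -image_edges_sub; apply/subsetP => d; rewrite in_setD1 !mem_image_edges in_setD1.
by case/andP=> de ->; rewrite andbT; apply: contraNneq de => ->.
Qed.

Lemma core_collapsed A : iscore A -> ~~ (A \subset collapsed k).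
Proof.
case/andP=> cA; apply: contra => AF; apply/eqP/setP => e; rewrite inE.
apply/negP => eA; have := core_h1_rank cA eA.
have : (h1_rank A <= h1_rank (collapsed k))%N by exact: h1_rank_mono.
case: kP => /forestP-> _ _ _ _; by lia.
Qed.

Lemma iscore_image A : iscore A -> iscore (image_edges k A).
Proof.
move=> cA; rewrite /iscore core_image; last by case/andP: cA.
apply: contra (core_collapsed cA) => /eqP iA.
by rewrite -preim_edges0 -image_edges_sub iA.
Qed.

Section Pull.
Variable R : realType.
Implicit Type y : 'rV[R]_(ne H).

Lemma pull_lift y e' : pull_lengths k y 0 (lift_edge e') = y 0 e'.
Proof. by rewrite mxE; have [b ->] := lift_edgeP e'; rewrite big_seq1. Qed.

Lemma pull_collapsed y e : e \in collapsed k -> pull_lengths k y 0 e = 0.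
Proof. by rewrite inE mxE => /eqP->; rewrite big_nil. Qed.

Lemma sum_pull y A :
  \sum_(e in A) pull_lengths k y 0 e = \sum_(e' in image_edges k A) y 0 e'.
Proof.
rewrite (bigID (fun e => e \in collapsed k)) /= big1 ?add0r; last first.
  by move=> e /andP[_ eF]; exact: pull_collapsed.
rewrite (eq_bigl (fun e => e \in lift_edge @: image_edges k A)); last first.
  move=> e; apply/andP/imsetP => [[eA eF]|[e' e'A ->]]; last first.
    by rewrite -mem_image_edges lift_edge_collapsed.
  have [eF'|[e' [b [_ eE]]]] := collapse_edgeP e; first by rewrite eF' in eF.
  by exists e' => //; rewrite mem_image_edges -eE.
rewrite big_imset /=; last by move=> ? ? _ _; exact: lift_edge_inj.
by apply: eq_bigr => e' _; rewrite pull_lift.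
Qed.

Lemma sum_pull_preim y C :
  \sum_(e in preim_edges C) pull_lengths k y 0 e = \sum_(e' in C) y 0 e'.
Proof.
by rewrite sum_pull; apply: eq_bigl => e'; rewrite mem_image_edges mem_preim_lift.
Qed.

Lemma sum_pullT y : \sum_e pull_lengths k y 0 e = \sum_e' y 0 e'.
Proof.
have := sum_pull_preim y setT; rewrite preim_edgesT.
rewrite (eq_bigl xpredT) => [|e]; last by rewrite inE.
by rewrite [in RHS](eq_bigl xpredT) // => e; rewrite inE.
Qed.

Lemma pull_ge0 y : (forall e', 0 <= y 0 e') -> forall e, 0 <= pull_lengths k y 0 e.
Proof. by move=> y0 e; rewrite mxE sumr_ge0. Qed.

Lemma pull_pos_eq0 y e : (forall e', 0 < y 0 e') ->
  (pull_lengths k y 0 e == 0) = (e \in collapsed k).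
Proof.
move=> y0; have [eF|[e' [b [E ->]]]] := collapse_edgeP e.
  by rewrite eF pull_collapsed // eqxx.
by rewrite pull_lift gt_eqF // (negbTE (lift_edge_collapsed _)).
Qed.

Lemma pull_inj y y' : pull_lengths k y = pull_lengths k y' -> y = y'.
Proof. by move=> E; apply/rowP => e'; rewrite -!pull_lift E. Qed.

End Pull.

End CollapseFacts.

(** * Composition of collapses *)

Section Composition.
Import mathcomp.boot.fintype mathcomp.boot.finset.

Lemma map_fst_inv_word (T : Type) (w : word T) :
  map fst (inv_word w) = rev (map fst w).
Proof. by rewrite /inv_word map_rev -map_comp. Qed.

Lemma inv_word_nil (T : eqType) (w : word T) : (inv_word w == [::]) = (w == [::]).
Proof. by rewrite -!size_eq0 /inv_word size_rev size_map. Qed.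

Lemma mem_fst_fletter G H (f : cmap G H) d :
  map fst (fletter f d) =i map fst (fe f d.1).
Proof. by move=> e; rewrite /fletter; case: d.2 => //; rewrite map_fst_inv_word mem_rev. Qed.

Lemma mem_fst_fword G H (f : cmap G H) w e' :
  (e' \in map fst (fword f w)) = has (fun d => e' \in map fst (fe f d.1)) w.
Proof.
elim: w => //= d w IH.
by rewrite /fword /= -/(fword f w) map_cat mem_cat IH mem_fst_fletter.
Qed.

Lemma fword_nil G H (f : cmap G H) w :
  (fword f w == [::]) = all (fun d => d.1 \in collapsed f) w.
Proof.
elim: w => //= d w IH; rewrite -IH /fword /= -/(fword f w).
have -> : (d.1 \in collapsed f) = (fletter f d == [::]).
  by rewrite inE /fletter; case: d.2; rewrite ?inv_word_nil.
by case: (fletter f d).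
Qed.

Lemma collapsed_comp G H K (f : cmap G H) (g : cmap H K) :
  collapsed (comp_cmap g f) = preim_edges f (collapsed g).
Proof. by apply/setP => e; rewrite inE fword_nil inE. Qed.

Lemma pull_comp (R : realType) G H K (f : cmap G H) (g : cmap H K) (z : 'rV[R]_(ne K)) :
  pull_lengths (comp_cmap g f) z = pull_lengths f (pull_lengths g z).
Proof.
apply/rowP => e; rewrite !mxE /= /fword big_flatten /= big_map.
apply: eq_bigr => d _; rewrite mxE /fletter; case: d.2 => //.
rewrite /inv_word (perm_big (map (@inv_letter _) (fe g d.1))) /=; last first.
  by rewrite perm_rev.
by rewrite big_map.
Qed.

Lemma forest_collapse_comp G H K (f : cmap G H) (g : cmap H K) :
  forest_collapse f -> forest_collapse g -> forest_collapse (comp_cmap g f).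
Proof.
move=> fP gP; have [ff fj fs fz fu] := fP; have [gf gj gs gz gu] := gP; split.
- by rewrite collapsed_comp; apply/forestP; rewrite h1_rank_collapse //; apply/forestP.
- move=> u v; rewrite collapsed_comp /= gj.
  by rewrite -/(joined (preim_edges _ _) _ _) joined_collapse.
- by move=> v'; have [w <-] := gs v'; have [v <-] := fs w; exists v.
- move=> e; have [eF|[e' [b [E _]]]] := collapse_edgeP fP e.
    by move: eF; rewrite inE /= => /eqP->.
  by rewrite /= E /fword /= cats0 /fletter; case: b {E}; rewrite /= ?/inv_word ?size_rev ?size_map gz.
- move=> e''; exists (lift_edge fP (lift_edge gP e'')); split=> [|e].
    have [b /= ->] := lift_edgeP fP (lift_edge gP e''); rewrite mem_fst_fword /= orbF.
    by have [b' ->] := lift_edgeP gP e''; rewrite mem_head.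
  rewrite /= mem_fst_fword => /hasP[d].
  have [eF|[e' [b [-> ->]]]] := collapse_edgeP fP e; first by move: eF; rewrite inE => /eqP->.
  rewrite inE => /eqP-> /=; have [eF|[f'' [b' [-> ->]]]] := collapse_edgeP gP e'.
    by move: eF; rewrite inE => /eqP->.
  by rewrite inE => /eqP->.
Qed.

Lemma homotopic_refl G H (f : cmap G H) : homotopic f f.
Proof. by apply: homotopic_eq => // e; exact: weq_refl. Qed.

Lemma homotopic_sym G H (f g : cmap G H) : homotopic f g -> homotopic g f.
Proof.
move=> [h [hv he]]; exists (fun v => inv_word (h v)); split=> [v|e].
  exact/epath_inv/hv.
have := weq_cat2l (inv_word (h (src e))) (weq_cat2r (inv_word (h (tgt e))) (he e)).
rewrite -[(_ ++ h _) ++ _]catA -[(h _ ++ _) ++ _]catA => E.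
apply: weq_trans (weq_trans (weq_sym E) _).
  rewrite catA -[X in word_eq X _]cat0s; apply/weq_cat2r/weq_sym/weq_mulVl.
rewrite -[X in word_eq _ (_ ++ X)]cats0; do 2!apply: weq_cat2l.
exact: weq_mulV.
Qed.

Lemma mg_collapse_comp n (X Y Z : mgraph n) (f : cmap X Y) (g : cmap Y Z) :
  mg_collapse f -> mg_collapse g -> @mg_collapse n X Z (comp_cmap g f).
Proof.
move=> [fP fh] [gP gh]; split; first exact: forest_collapse_comp.
apply: homotopic_trans (comp_cmapA' _ _ _) _.
exact: homotopic_trans (homotopic_compl _ fh) gh.
Qed.

End Composition.

(** * Uniqueness of the collapse of a given forest *)

Section Uniqueness.
Import mathcomp.boot.fintype mathcomp.boot.finset.
Variables (G H K : graph) (f : cmap G H) (g : cmap G K).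
Hypotheses (fP : forest_collapse f) (gP : forest_collapse g).
Hypothesis fg : collapsed f = collapsed g.

Lemma vertex_lift_ex v' : exists v, fv f v == v'.
Proof. by case: fP => _ _ /(_ v')[v <-] _ _; exists v. Qed.

Let pre v' := xchoose (vertex_lift_ex v').

Lemma fv_pre v : fv g (pre (fv f v)) = fv g v.
Proof.
apply/eqP; have := xchooseP (vertex_lift_ex (fv f v)); rewrite -/(pre _).
by case: fP gP => _ -> _ _ _ [_ -> _ _ _]; rewrite fg.
Qed.

(** If [f] reverses the edge over [e'], its image under [g] is reversed back. The default of [head]
    never occurs, as the word consists of one letter. *)
Definition factor_word e' : word 'I_(ne K) :=
  let e := lift_edge fP e' in
  if (head (e', false) (fe f e)).2 then inv_word (fe g e) else fe g e.

Lemma factor_path e' :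
  epath (fv g (pre (src e'))) (factor_word e') (fv g (pre (tgt e'))).
Proof.
rewrite /factor_word; have [b E] := lift_edgeP fP e'; rewrite E /=.
have := fe_path f (lift_edge fP e'); rewrite E /= /org /dst /=.
case: b {E} => /andP[/eqP E1 /eqP E2]; rewrite E1 E2 !fv_pre; last exact: fe_path.
exact/epath_inv/fe_path.
Qed.

Definition factor_cmap : cmap H K :=
  @CMap H K (fun v' => fv g (pre v')) factor_word factor_path.

Lemma factor_comp_word e : fword factor_cmap (fe f e) = fe g e.
Proof.
have [eF|[e' [b [E eE]]]] := collapse_edgeP fP e.
  by have := eF; rewrite fg; move: eF; rewrite !inE => /eqP-> /eqP->.
rewrite E /fword /= cats0 /fletter /= /factor_word -eE E /=.
by case: b {E}; rewrite ?inv_wordK.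
Qed.

Lemma factor_comp : homotopic (comp_cmap factor_cmap f) g.
Proof.
apply: homotopic_eq => [v|e] /=; first exact: fv_pre.
by rewrite factor_comp_word; exact: weq_refl.
Qed.

Lemma factor_pull (R : realType) (z : 'rV[R]_(ne K)) :
  pull_lengths f (pull_lengths factor_cmap z) = pull_lengths g z.
Proof. by rewrite -pull_comp; apply/rowP => e; rewrite !mxE /= factor_comp_word. Qed.

Lemma factor_mem e' e'' : (e'' \in map fst (factor_word e')) =
  (e'' \in map fst (fe g (lift_edge fP e'))).
Proof. by rewrite /factor_word; case: ifP => // _; rewrite map_fst_inv_word mem_rev. Qed.

Lemma factor_size e' : size (factor_word e') = size (fe g (lift_edge fP e')).
Proof. by rewrite /factor_word; case: ifP => // _; rewrite /inv_word size_rev size_map. Qed.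

Lemma factor_collapsed : collapsed factor_cmap = finset.set0.
Proof.
apply/setP => e'; rewrite !inE -size_eq0 factor_size size_eq0.
by have := lift_edge_collapsed fP e'; rewrite fg inE => /negbTE.
Qed.

Lemma joined0 (L : graph) (u v : 'I_(nv L)) : joined finset.set0 u v = (u == v).
Proof.
apply/idP/eqP => [j|->]; last exact: joined_refl.
by apply: (joined_invariant (h := id)) j => e; rewrite inE.
Qed.

Lemma factor_collapse : forest_collapse factor_cmap.
Proof.
have preK v' : fv f (pre v') = v' by apply/eqP/(xchooseP (vertex_lift_ex v')).
split; rewrite ?factor_collapsed.
- exact: forest0.
- move=> u v; rewrite -/(joined _ u v) joined0 /=.
  by case: gP => _ -> _ _ _; rewrite -fg; case: fP => _ <- _ _ _; rewrite !preK.
- by move=> v'; case: gP => _ _ /(_ v')[v <-] _ _; exists (fv f v); exact: fv_pre.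
- by move=> e'; rewrite /= factor_size; case: gP.
- move=> e''; have := lift_edge_collapsed gP e''; rewrite -fg => nF.
  have [eF|[e' [b [E eE]]]] := collapse_edgeP fP (lift_edge gP e''); first by rewrite eF in nF.
  exists e'; split=> [|d]; rewrite /= factor_mem.
    by rewrite -eE; have [b' ->] := lift_edgeP gP e''; rewrite mem_head.
  have [eF|[f'' [b' [-> fE]]]] := collapse_edgeP gP (lift_edge fP d).
    by move: eF; rewrite inE => /eqP->.
  by rewrite inE => /eqP E2; apply: (@lift_edge_inj _ _ _ fP); rewrite -eE fE E2.
Qed.

End Uniqueness.

(** * The homology rank of a marked graph *)

Section HomologyRank.
Import mathcomp.boot.fintype mathcomp.boot.finset.
(** The cellular 1-chain of a word; cancellations do not change it. *)
Definition abel m (w : word 'I_m) : 'rV[rat]_m :=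
  \sum_(d <- w) (-1) ^+ (d.2 : bool) *: delta_mx 0 d.1.

Lemma abel_cat m (u v : word 'I_m) : abel (u ++ v) = abel u + abel v.
Proof. exact: big_cat. Qed.

Lemma abel_inv m (w : word 'I_m) : abel (inv_word w) = - abel w.
Proof.
rewrite /abel /inv_word (perm_big (map (@inv_letter _) w)) /=; last by rewrite perm_rev.
by rewrite big_map -sumrN; apply: eq_bigr => d _; rewrite signrN scaleNr.
Qed.

Lemma abel_weq m (u v : word 'I_m) : word_eq u v -> abel u = abel v.
Proof.
elim=> // [_ _ [p [d [q [-> ->]]]]|x y z _ -> _ ->] //.
rewrite !abel_cat; congr (_ + _).
by rewrite /abel !big_cons /= signrN scaleNr addrA subrr add0r.
Qed.

Definition chain_mx G H (f : cmap G H) : 'M[rat]_(ne G, ne H) :=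
  \matrix_e abel (fe f e).

Lemma row_chain_mx G H (f : cmap G H) e : delta_mx 0 e *m chain_mx f = abel (fe f e).
Proof. by rewrite -rowE rowK. Qed.

Lemma abel_fword G H (f : cmap G H) w : abel (fword f w) = abel w *m chain_mx f.
Proof.
elim: w => [|d w IH]; first by rewrite /abel !big_nil mul0mx.
rewrite /fword /= -/(fword f w) abel_cat IH [abel (d :: w)]/abel big_cons mulmxDl.
congr (_ + _); rewrite -scalemxAl row_chain_mx /fletter; case: d.2.
  by rewrite abel_inv expr1 scaleN1r.
by rewrite expr0 scale1r.
Qed.

Definition boundary_all G : 'M[rat]_(ne G, nv G) := \matrix_e edge_boundary e.

Lemma abel_epath G u p v : epath u p v ->
  abel p *m boundary_all G = delta_mx 0 v - delta_mx 0 u.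
Proof.
elim: p u => [|d p IH] u /=; first by move=> /eqP->; rewrite /abel big_nil mul0mx subrr.
move=> /andP[/eqP<- pv]; rewrite /abel big_cons mulmxDl -/(abel p) (IH _ pv).
rewrite -scalemxAl -rowE rowK.
have -> : edge_boundary d.1 = delta_mx 0 (tgt d.1) - delta_mx 0 (src d.1).
  by apply/rowP => w; rewrite !mxE eqxx /= ![_ == w]eq_sym.
rewrite /org /dst; case: d.2; rewrite ?expr1 ?expr0 ?scaleN1r ?scale1r ?opprB.
  by rewrite addrC addrA subrK.
by rewrite addrC addrA subrK.
Qed.

(** A homotopy gives a chain homotopy [D], whose contribution factors through the boundary and
    vanishes on cycles. *)
Lemma homotopic_chain G H (f g : cmap G H) m (z : 'M[rat]_(m, ne G)) :
  homotopic f g -> z *m boundary_all G = 0 -> z *m chain_mx f = z *m chain_mx g.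
Proof.
move=> [h [_ hfg]] z0; pose D := \matrix_v abel (h v) : 'M[rat]_(nv G, ne H).
have -> : chain_mx f = chain_mx g - boundary_all G *m D.
  apply/row_matrixP => e; rewrite linearB /= row_mul !rowK.
  have := abel_weq (hfg e); rewrite !abel_cat => /(canRL (addrK _)) ->.
  have -> : edge_boundary e = delta_mx 0 (tgt e) - delta_mx 0 (src e).
    by apply/rowP => w; rewrite !mxE eqxx /= ![_ == w]eq_sym.
  by rewrite mulmxBl -!rowE !rowK opprB addrCA addrA.
by rewrite mulmxBr mulmxA z0 mul0mx subr0.
Qed.

Lemma chain_mx_comp G H K (f : cmap G H) (g : cmap H K) :
  chain_mx (comp_cmap g f) = chain_mx f *m chain_mx g.
Proof. by apply/row_matrixP => e; rewrite row_mul !rowK abel_fword. Qed.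

Lemma chain_mx_id G : chain_mx (id_cmap G) = 1%:M.
Proof.
apply/row_matrixP => e; rewrite rowK row1 /= /abel big_seq1 expr0 scale1r.
by [].
Qed.

Lemma h1_rank_setT_ker G : h1_rank [set: 'I_(ne G)] = \rank (kermx (boundary_all G)).
Proof.
rewrite h1_rankE mxrank_ker cardsT card_ord; congr (_ - _)%N.
apply/eqP; rewrite eqn_leq; apply/andP; split; apply: mxrankS.
  by apply/sumsmx_subP => e _; rewrite genmxE -[edge_boundary e](rowK (@edge_boundary G)) row_sub.
apply/row_subP => e; rewrite rowK.
by rewrite (sumsmx_sup e) ?inE // genmxE.
Qed.

(** In the rose every chain is a cycle, so the marking and its homotopy inverse identify the
    n-dimensional space of its chains with the cycles of [X]. *)
Lemma h1_rank_mgraph n (X : mgraph n) : h1_rank [set: 'I_(ne X)] = n.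
Proof.
rewrite h1_rank_setT_ker; have [g [gf fg]] := mg_heq X.
set f := mg_marking X in gf fg.
have rose0 : boundary_all (rose n) = 0.
  by apply/row_matrixP => e; rewrite rowK; apply/rowP => v; rewrite !mxE subrr.
have fg1 : chain_mx f *m chain_mx g = 1%:M.
  rewrite -chain_mx_comp -[LHS]mul1mx (homotopic_chain gf) ?rose0 ?mulmx0 //.
  by rewrite chain_mx_id mulmx1.
have gf1 : kermx (boundary_all X) *m (chain_mx g *m chain_mx f) = kermx (boundary_all X).
  rewrite -chain_mx_comp (homotopic_chain fg) ?mulmx_ker //.
  by rewrite chain_mx_id mulmx1.
apply/eqP; rewrite eqn_leq; apply/andP; split.
  rewrite -gf1 mulmxA; apply: leq_trans (mxrankM_maxr _ _) _; exact: rank_leq_row.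
rewrite -{1}(@mxrank1 rat n) -fg1; apply: leq_trans (mxrankM_maxl _ _) _.
apply: mxrankS; apply/sub_kermxP; apply/row_matrixP => e; rewrite row_mul rowK.
have E : fv f (@tgt (rose n) e) = fv f (@src (rose n) e) by [].
by rewrite (abel_epath (fe_path f e)) E subrr row0.
Qed.

End HomologyRank.

(** * Collapse of a single edge *)

Section EdgeCollapse.
Import mathcomp.boot.fintype mathcomp.boot.finset.
Variables (G : graph) (e0 : 'I_(ne G)) (s0 : 'I_(nv G).-1).
Hypothesis s0P : src e0 = lift (tgt e0) s0.
Local Notation V := 'I_(nv G).
Local Notation E := 'I_(ne G).

(** The quotient keeps the vertices other than [tgt e0], which is sent to the index [s0] of
    [src e0]. *)
Let vertex_map (v : V) : 'I_(nv G).-1 := odflt s0 (unlift (tgt e0) v).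

Definition edge_quotient : graph :=
  @Graph (nv G).-1 (ne G).-1 (fun e' => vertex_map (src (lift e0 e')))
                             (fun e' => vertex_map (tgt (lift e0 e'))).

Definition quotient_word (e : E) : word 'I_(ne edge_quotient) :=
  if unlift e0 e is Some e' then [:: (e', false)] else [::].

Lemma vertex_map_tgt : vertex_map (tgt e0) = s0.
Proof. by rewrite /vertex_map unlift_none. Qed.

Lemma vertex_map_lift v' : vertex_map (lift (tgt e0) v') = v'.
Proof. by rewrite /vertex_map liftK. Qed.

Lemma lift_vertex_map v : v != tgt e0 -> lift (tgt e0) (vertex_map v) = v.
Proof.
rewrite eq_sym /vertex_map => /unlift_some[v' -> E].
by rewrite E.
Qed.

Lemma quotient_path e :
  @epath edge_quotient (vertex_map (src e)) (quotient_word e) (vertex_map (tgt e)).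
Proof.
rewrite /quotient_word; case: unliftP => [e' ->|->].
  by rewrite /= /org /dst /= !eqxx.
by rewrite /= vertex_map_tgt s0P vertex_map_lift.
Qed.

Definition quotient_map : cmap G edge_quotient :=
  @CMap G edge_quotient vertex_map quotient_word quotient_path.

Lemma collapsed_quotient : collapsed quotient_map = [set e0].
Proof.
apply/setP => e; rewrite !inE /= /quotient_word.
by case: unliftP => [e' ->|->]; rewrite ?eqxx // [RHS]eq_sym (negbTE (neq_lift _ _)).
Qed.

Lemma src_neq_tgt : src e0 != tgt e0.
Proof. by rewrite s0P eq_sym neq_lift. Qed.

Lemma quotient_collapse : forest_collapse quotient_map.
Proof.
split; rewrite ?collapsed_quotient.
- apply/forestP; rewrite -(setU0 [set e0]) h1_rank_setU1 ?inE // h1_rank0.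
  by rewrite joined0 (negbTE src_neq_tgt).
- have je : joined [set e0] (src e0) (tgt e0) by apply: joined_edge; rewrite inE.
  have jl v : joined [set e0] v (lift (tgt e0) (vertex_map v)).
    have [->|nv] := eqVneq v (tgt e0); last by rewrite lift_vertex_map // joined_refl.
    by rewrite vertex_map_tgt -s0P joined_sym.
  move=> u v; rewrite -/(joined _ u v) /=; apply/eqP/idP => [uv|].
    by apply: joined_trans (jl u) _; rewrite uv joined_sym.
  apply: joined_invariant => e; rewrite inE => /eqP->.
  by rewrite vertex_map_tgt s0P vertex_map_lift.
- by move=> v'; exists (lift (tgt e0) v'); exact: vertex_map_lift.
- by move=> e; rewrite /= /quotient_word; case: unlift.
- move=> e'; exists (lift e0 e'); split; first by rewrite /= /quotient_word liftK mem_head.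
  by move=> e; rewrite /= /quotient_word; case: unliftP => // f -> /=; rewrite inE => /eqP->.
Qed.

(** Tracks of the homotopy from the composite through the quotient to the identity: the displaced
    vertex returns along [e0]. *)
Let tail (v : V) : word E := if v == tgt e0 then [:: (e0, false)] else [::].

Lemma tail_path v : epath (lift (tgt e0) (vertex_map v)) (tail v) v.
Proof.
rewrite /tail; case: eqP => [->|/eqP nv] /=; last by rewrite lift_vertex_map.
by rewrite vertex_map_tgt -s0P /org /dst /= !eqxx.
Qed.

Definition section_word (e' : 'I_(ne edge_quotient)) : word E :=
  let e := lift e0 e' in tail (src e) ++ (e, false) :: inv_word (tail (tgt e)).

Lemma section_path e' : epath (lift (tgt e0) (@src edge_quotient e')) (section_word e')
  (lift (tgt e0) (@tgt edge_quotient e')).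
Proof.
apply: epath_cat (tail_path _) _ => /=; rewrite /org /dst /= eqxx /=.
exact: epath_inv (tail_path _).
Qed.

Definition section_map : cmap edge_quotient G :=
  @CMap edge_quotient G (lift (tgt e0)) section_word section_path.

Lemma quotient_tail v : fword quotient_map (tail v) = [::].
Proof.
by rewrite /tail; case: ifP => // _; rewrite /fword /= /fletter /= /quotient_word unlift_none.
Qed.

Lemma quotient_heq : homotopy_equivalence quotient_map.
Proof.
exists section_map; split; last first.
  apply: homotopic_eq => [v|e] /=; first exact: vertex_map_lift.
  rewrite /section_word -cat1s !fword_cat fword_inv !quotient_tail /= cats0.
  by rewrite /fword /= /fletter /= /quotient_word liftK; exact: weq_refl.
exists tail; split=> [v|e]; first exact: tail_path.
rewrite /= /quotient_word; case: unliftP => [e' ->|->].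
  rewrite /fword /= cats0 /fletter /= /section_word -cat1s !catA -catA.
  rewrite -[X in word_eq _ X]cats0; apply: weq_cat2l; exact: weq_mulVl.
by rewrite /= /tail eqxx (negbTE src_neq_tgt); exact: weq_refl.
Qed.

Let dart_lift (d : 'I_(ne G).-1 * bool) : E * bool := (lift e0 d.1, d.2).

Lemma dart_lift_inj : injective dart_lift.
Proof. move=> [e b] [e' b'] E; have /= /lift_inj -> := congr1 fst E.
by have /= -> := congr1 snd E.
Qed.

Lemma org_dart_lift d : @org edge_quotient d = vertex_map (org (dart_lift d)).
Proof. by rewrite /org /=; case: d.2. Qed.

Lemma valence_quotient v' : @valence edge_quotient v' =
  #|[set d : E * bool | (vertex_map (org d) == v') && (d.1 != e0)]|.
Proof.
rewrite /valence -(card_imset _ dart_lift_inj); apply: eq_card => d.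
rewrite inE; apply/imsetP/andP => [[d' + ->]|[dv de]].
  by rewrite inE org_dart_lift => ->; rewrite eq_sym neq_lift.
rewrite eq_sym in de; have [e' E _] := unlift_some de.
exists (e', d.2); last by rewrite /dart_lift /= -E; case: d {dv de E}.
by rewrite inE org_dart_lift /dart_lift /= -E -surjective_pairing.
Qed.

(** A vertex at an end of [e0] has valence at least 3, so the merged vertex keeps at least 2 + 2
    ends of other edges. *)
Lemma valence_quotient_ok : (forall v : V, valence v != 1%N /\ valence v != 2%N) ->
  forall v', @valence edge_quotient v' != 1%N /\ @valence edge_quotient v' != 2%N.
Proof.
move=> val v'; rewrite valence_quotient.
pose D v := [set d : E * bool | org d == v].
have [v's|v's] := eqVneq v' s0; last first.
  have -> : #|[set d : E * bool | (vertex_map (org d) == v') && (d.1 != e0)]| =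
      valence (lift (tgt e0) v').
    apply: eq_card => d; rewrite !inE; apply/andP/eqP => [[/eqP dv de]|].
      rewrite -dv lift_vertex_map //; apply: contraNneq v's => dt.
      by rewrite -dv dt vertex_map_tgt.
    move=> od; rewrite od vertex_map_lift eqxx; split=> //.
    apply: contraNneq v's => de; move: od; rewrite /org de; case: d.2.
      by move/eqP; rewrite (negbTE (neq_lift _ _)).
    by rewrite s0P => /(@lift_inj _ (tgt e0)) ->.
  exact: val.
have val_gt0 d v : d \in D v -> (1 < #|D v :\ d|)%N.
  move=> dv; have [] := val v; rewrite /valence -/(D v) (cardsD1 d) dv.
  by case: #|_| => [|[|]].
have s1 : (e0, false) \in D (src e0) by rewrite inE.
have t1 : (e0, true) \in D (tgt e0) by rewrite inE.
have := leq_add (val_gt0 _ _ s1) (val_gt0 _ _ t1).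
rewrite -cardsUI [X in (_ <= _ + X)%N](_ : _ = 0%N) ?addn0; last first.
  apply/eqP; rewrite cards_eq0; apply/eqP/setP => d; rewrite !inE.
  apply/negP => /andP[/andP[_ /eqP->] /andP[_]].
  by rewrite (negbTE src_neq_tgt).
have sub : (D (src e0) :\ (e0, false)) :|: (D (tgt e0) :\ (e0, true)) \subset
    [set d : E * bool | (vertex_map (org d) == v') && (d.1 != e0)].
  apply/subsetP => -[e b]; rewrite !inE => /orP[/andP[ne /eqP od]|/andP[ne /eqP od]].
    rewrite od s0P vertex_map_lift v's eqxx /=; apply: contraNneq ne => ee0.
    move: od; rewrite ee0 /org /=; case: b; rewrite ?eqxx // => /eqP.
    by rewrite eq_sym (negbTE src_neq_tgt).
  rewrite od vertex_map_tgt v's eqxx /=; apply: contraNneq ne => ee0.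
  move: od; rewrite ee0 /org /=; case: b; rewrite ?eqxx // => /eqP.
  by rewrite (negbTE src_neq_tgt).
move=> c4; have := leq_trans c4 (subset_leq_card sub).
by case: #|_| => [|[|[|]]].
Qed.

End EdgeCollapse.

(** * Collapse of a forest, and the points represented by degenerate metrics *)

Section CollapseExistence.
Import mathcomp.boot.fintype mathcomp.boot.finset.
Variable n : nat.

Lemma admissible_collapse G H (k : cmap G H) : forest_collapse k -> admissible G ->
  (forall v, valence (v : 'I_(nv H)) != 1%N /\ valence v != 2%N) -> admissible H.
Proof.
move=> kP [/components1P[V0 cG] vG eG] vH.
have surj v' : exists v, fv k v = v' by case: kP.
have V'0 : (0 < nv H)%N by apply: leq_ltn_trans (ltn_ord (fv k (Ordinal V0))).
split=> // [|e'].
  apply/components1P; split=> // u' v'.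
  have [[u <-] [v <-]] := (surj u', surj v').
  by rewrite -(joined_collapse kP) preim_edgesT.
apply/components1P; split=> // u' v'.
have [[u <-] [v <-]] := (surj u', surj v').
rewrite -(joined_collapse kP); have /components1P[_] := eG (lift_edge kP e').
move/(_ u v); apply: joined_sub; apply/subsetP => e; rewrite in_setC1 => ee.
have [eF|[f' [b [E eE]]]] := collapse_edgeP kP e.
  exact: (subsetP (collapsed_preim _ _)).
by rewrite eE mem_preim_lift in_setC1; apply: contraNneq ee => <-; rewrite eE.
Qed.

Lemma edge_collapse_exists (X : mgraph n) (e0 : 'I_(ne X)) : src e0 != tgt e0 ->
  exists (Y : mgraph n) (k : cmap X Y), mg_collapse k /\ collapsed k = [set e0].
Proof.
rewrite eq_sym => /unlift_some[s0 sE _].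
have kP := quotient_collapse sE.
have aX := mg_admissible X.
have aY : admissible (edge_quotient e0 s0).
  apply: (admissible_collapse kP aX); apply: (valence_quotient_ok sE).
  by case: aX.
pose Y := MGraph aY (heq_comp (quotient_heq sE) (mg_heq X)).
exists Y, (quotient_map sE); rewrite collapsed_quotient; split=> //; split=> //.
exact: homotopic_refl.
Qed.

(** One edge at a time: an edge of a forest has distinct ends, and the image of [F] is again a
    forest because its full preimage is [F], of rank 0. *)
Lemma collapse_exists (X : mgraph n) (F : {set 'I_(ne X)}) : forest F ->
  exists (Y : mgraph n) (k : cmap X Y), mg_collapse k /\ collapsed k = F.
Proof.
have [m] := ubnP #|F|; elim: m X F => // m IH X F; rewrite ltnS => cF fF.
have [->|[e0 e0F]] := set_0Vmem F.
  exists X, (id_cmap X); rewrite collapsed_id; split=> //; split.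
    exact: forest_collapse_id.
  exact: comp_id_cmap.
have rF : h1_rank F = 0%N by apply/forestP.
have ne0 : src e0 != tgt e0.
  apply/eqP => st; have := h1_rankD1 e0F; rewrite rF st joined_refl.
  by [].
have [Y1 [k1 [k1P k1E]]] := edge_collapse_exists ne0.
have k1f : forest_collapse k1 by case: k1P.
have F1 : preim_edges k1 (image_edges k1 F) = F.
  apply/setP => e; have [|[e' [b [_ ->]]]] := collapse_edgeP k1f e.
    move=> ek; rewrite (subsetP (collapsed_preim _ _)) //.
    by move: ek; rewrite k1E inE => /eqP->.
  by rewrite mem_preim_lift mem_image_edges.
have [||Y [k2 [k2P k2E]]] := IH Y1 (image_edges k1 F).
- apply: leq_trans cF; rewrite (cardsD1 e0) e0F ltnS.
  rewrite -(card_imset _ (@lift_edge_inj _ _ _ k1f)); apply: subset_leq_card.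
  apply/subsetP => _ /imsetP[e' + ->]; rewrite mem_image_edges in_setD1 => ->.
  by have := lift_edge_collapsed k1f e'; rewrite k1E inE => ->.
- by apply/forestP; rewrite -(h1_rank_collapse k1f) F1.
exists Y, (comp_cmap k2 k1); split; first exact: mg_collapse_comp.
by rewrite collapsed_comp k2E.
Qed.

Lemma represents_exists (R : realType) (X : mgraph n) (x : 'rV[R]_(ne X)) :
  simplex_bar x -> exists p, represents x p.
Proof.
move=> [[x0 _ x1] fx]; have [Y [k [kP kE]]] := collapse_exists fx.
have kf : forest_collapse k by case: kP.
pose y := \row_e' x 0 (lift_edge kf e').
have xE : x = pull_lengths k y.
  apply/rowP => e; have [eF|[e' [b [_ ->]]]] := collapse_edgeP kf e.
    by rewrite pull_collapsed //; move: eF; rewrite kE inE => /eqP.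
  by rewrite (pull_lift kf) mxE.
have oy : open_simplex y.
  split=> [e'|].
    rewrite mxE lt_neqAle x0 andbT eq_sym.
    by have := lift_edge_collapsed kf e'; rewrite kE inE.
  rewrite -(sum_pullT kf) -xE -x1; apply: eq_bigl => e; by rewrite inE.
by exists (\pi_(outer_space R n)%qT (MetricMGraph oy)), (MetricMGraph oy), k.
Qed.

(** The zeros of [x] determine the collapsed forest, so the two collapses differ by an isomorphism
    compatible with markings and lengths. *)
Lemma represents_unique (R : realType) (X : mgraph n) (x : 'rV[R]_(ne X)) p q :
  represents x p -> represents x q -> p = q.
Proof.
move=> [Y [k [-> kP xk]]] [Z [l [-> lP xl]]].
have [kf kh] := kP; have [lf lh] := lP.
have kl : collapsed k = collapsed l.
  apply/setP => e; have [y0 _] := mm_open Y; have [z0 _] := mm_open Z.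
  by rewrite -(pull_pos_eq0 kf _ y0) -(pull_pos_eq0 lf _ z0) -xk -xl.
apply/quotP/rst_step; exists (factor_cmap kf lf kl); split.
- split; first exact: factor_collapse.
  apply: homotopic_trans lh.
  apply: homotopic_trans (homotopic_compr _ (factor_comp kf lf kl)).
  apply: homotopic_trans (comp_cmapA _ _ _).
  exact/homotopic_compl/homotopic_sym.
- exact: factor_collapsed.
- by apply: (pull_inj kf); rewrite factor_pull -xk.
Qed.

End CollapseExistence.

(** * The jewel as a moment polytope *)

Section Level.
Import mathcomp.boot.fintype mathcomp.boot.finset.
Variables (R : realType) (n : nat) (c : nat -> R).
Hypothesis n2 : (1 < n)%N.
Hypothesis cP : jewel_constants n 1 c.

(* The paper's c_r, except that the whole graph has total length 1. *)
Definition level (r : nat) : R :=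
  if r == 0%N then 0 else if (r < n)%N then c r else 1.

(** The bottom step is 0 < c_1, the top step 2 c_(n-1) < c_n < 1. *)
Lemma level_double r : (r < n)%N -> 2 * level r < level r.+1.
Proof.
case: cP => c1 cn cS; rewrite /level /=; case: r => [|r] /= rn.
  by rewrite mulr0 n2.
rewrite rn; have [_ h] := cS r.+1 rn; case: ltnP => // rn'.
by have E : n = r.+2; [apply/eqP; rewrite eqn_leq rn' rn|rewrite -E in h; exact: lt_trans h cn].
Qed.

Lemma level_ge0_mono r : 0 <= level r <= level r.+1.
Proof.
elim: r => [|r /andP[r0 rS]].
  by have := level_double (ltnW n2); rewrite {1 2 3}/level /= mulr0 lexx => /ltW.
have rS0 := le_trans r0 rS; rewrite rS0 /=.
have [rn|rn] := ltnP r.+1 n; first by have := level_double rn; lra.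
by rewrite /level /= !ltnNge rn (leq_trans rn).
Qed.

Lemma level_ge0 r : 0 <= level r.
Proof. by have /andP[] := level_ge0_mono r. Qed.

Lemma level_mono r s : (r <= s)%N -> level r <= level s.
Proof.
elim: s => [|s IH]; first by rewrite leqn0 => /eqP->.
rewrite leq_eqVlt => /predU1P[->//|]; rewrite ltnS => /IH /le_trans; apply.
by have /andP[] := level_ge0_mono s.
Qed.

Lemma level_gt0 r : (0 < r)%N -> 0 < level r.
Proof.
move=> r0; apply: lt_le_trans (level_mono r0).
by have := level_double (ltnW n2); rewrite {1}/level /= mulr0.
Qed.

Definition core_level (G : graph) (S : {set 'I_(ne G)}) : R := level (h1_rank S).

Definition core_weight (G : graph) : {set 'I_(ne G)} -> R :=
  projT1 (boolp.cid (mobius_exists (@core_level G))).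

Definition core_gap (G : graph) (A : {set 'I_(ne G)}) : R :=
  level (h1_rank A) - 2 * level (h1_rank A).-1.

Lemma core_weightP G (S : {set 'I_(ne G)}) :
  \sum_(A : {set 'I_(ne G)} | A \subset S) core_weight A = core_level S.
Proof. by rewrite /core_weight; case: boolp.cid => w /= ->. Qed.

Lemma core_level0 G : core_level (finset.set0 : {set 'I_(ne G)}) = 0.
Proof. by rewrite /core_level h1_rank0. Qed.

Lemma core_level_mono G (S T : {set 'I_(ne G)}) : S \subset T ->
  core_level S <= core_level T.
Proof. by move=> ST; apply/level_mono/h1_rank_mono. Qed.

(** If [e] separates [A], its deletion preserves the level, so the weights of the subsets of [A]
    containing [e] sum to 0. The proper ones are not cores either, since [e] still separates, and
    vanish by induction. *)
Lemma core_weight_noncore G (A : {set 'I_(ne G)}) : ~~ iscore A -> core_weight A = 0.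
Proof.
have [m] := ubnP #|A|; elim: m A => // m IH A; rewrite ltnS => cA.
rewrite /iscore negb_and negbK => /orP[/noncore_bridge[e eA nj]|/eqP->]; last first.
  rewrite -(core_level0 G) -core_weightP (big_pred1 finset.set0) // => B /=.
  exact: subset0.
have := mobius_in (@core_weightP G) e A.
rewrite /core_level (h1_rankD1 eA) (negbTE nj) subrr (bigD1 A) //= eA mulr1.
rewrite big1 ?addr0 // => B /andP[BA nBA].
have [eB|] := boolP (e \in B); last by rewrite mulr0.
rewrite IH ?mul0r //.
  by apply: leq_trans cA; apply: proper_card; rewrite properEneq nBA.
rewrite /iscore negb_and; apply/orP; left; apply/negP => /coreP/(_ e eB) j.
by case/negP: nj; apply: joined_sub j; exact: setSD.
Qed.

(** Full preimages preserve rank, so the pushed-forward weights have the same subset sums as those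
    of [H], and Moebius inversion is unique. *)
Lemma core_weight_pull G H (k : cmap G H) (B : {set 'I_(ne H)}) : forest_collapse k ->
  \sum_(A : {set 'I_(ne G)} | image_edges k A == B) core_weight A = core_weight B.
Proof.
move=> kP; pose v B := \sum_(A : {set 'I_(ne G)} | image_edges k A == B) core_weight A.
rewrite -/(v B); apply: mobius_unique => C.
rewrite core_weightP /core_level -(h1_rank_collapse kP).
rewrite -[RHS]/(core_level _) -core_weightP.
rewrite [RHS](partition_big (image_edges k) (fun B => B \subset C)) /=; last first.
  by move=> A; rewrite (image_edges_sub k).
apply: eq_bigr => D DC; apply: eq_bigl => A.
by rewrite andb_idl // => /eqP AD; rewrite -(image_edges_sub k) AD.
Qed.

Section OnGraph.
Variable G : graph.
Hypothesis Gn : h1_rank [set: 'I_(ne G)] = n.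
Hypothesis Gcore : core [set: 'I_(ne G)].
Local Notation E := 'I_(ne G).
Implicit Types (A B S T : {set E}) (x : 'rV[R]_(ne G)).

Lemma h1_rank_le S : (h1_rank S <= n)%N.
Proof. by rewrite -Gn; apply: h1_rank_mono; exact: subsetT. Qed.

(** Let a <= b be the two ranks and d that of the union. If d > b, level d alone exceeds 2 level b
    and so the left side; if d = b, supermodularity of the rank makes the rank of the intersection
    at least a. *)
Lemma core_level_super S T :
  core_level S + core_level T <= core_level (S :|: T) + core_level (S :&: T).
Proof.
have := h1_rank_super S T; have := h1_rank_le (S :|: T).
have := h1_rank_mono (finset.subsetUl S T); have := h1_rank_mono (finset.subsetUr S T).
rewrite /core_level.
move: (h1_rank S) (h1_rank T) (h1_rank (S :|: T)) (h1_rank (S :&: T)) => a b d m.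
wlog : a b / (a <= b)%N.
  move=> H bd ad dn le; have [ab|/ltnW ba] := leqP a b; first exact: H.
  by rewrite [leLHS]addrC; apply: (H b a ba ad bd dn); rewrite addnC.
move=> ab bd ad dn le; have := bd; rewrite leq_eqVlt => /predU1P[E|bd'].
  rewrite -E in le *; have am : (a <= m)%N by lia.
  by have := level_mono am; lra.
have := level_double (leq_trans bd' dn); have := level_mono bd'.
have := level_mono ab; have := level_ge0 m; lra.
Qed.

Lemma core_gap_gt0 A : iscore A -> 0 < core_gap A.
Proof.
case/andP=> cA /set0Pn[e eA]; rewrite /core_gap subr_gt0.
have := core_h1_rank cA eA; have := h1_rank_le A => + E; rewrite E /= => rn.
exact: level_double.
Qed.

Lemma core_gapP A i j : iscore A -> i \in A -> j \in A -> i != j ->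
  core_gap A <= core_level A - core_level (A :\ i) - core_level (A :\ j) +
    core_level (A :\ i :\ j).
Proof.
case/andP=> cA _ iA jA _; rewrite /core_gap /core_level.
have -> : h1_rank (A :\ i) = (h1_rank A).-1 by rewrite (core_h1_rank cA iA).
have -> : h1_rank (A :\ j) = (h1_rank A).-1 by rewrite (core_h1_rank cA jA).
have := level_ge0 (h1_rank (A :\ i :\ j)); lra.
Qed.

Lemma core_level_lt A i : iscore A -> i \in A -> core_level (A :\ i) < core_level A.
Proof.
case/andP=> cA _ iA; rewrite /core_level (core_h1_rank cA iA).
have rn : (h1_rank (A :\ i) < n)%N by rewrite -(core_h1_rank cA iA) h1_rank_le.
have := level_double rn; have := level_ge0 (h1_rank (A :\ i)); lra.
Qed.

Lemma core_levelT : core_level [set: E] = 1.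
Proof. by rewrite /core_level Gn /level ltnn; case: eqP n2 => // ->. Qed.

Lemma iscore_setT : iscore [set: E].
Proof.
rewrite /iscore Gcore; apply/eqP => T0; move: Gn; rewrite T0 h1_rank0 => n0.
by move: n2; rewrite -n0.
Qed.

Lemma iscore_bigcup (P : pred {set E}) : (forall A, P A -> iscore A) ->
  \bigcup_(A | P A) A != finset.set0 -> iscore (\bigcup_(A | P A) A).
Proof.
by move=> cP' U0; rewrite /iscore U0 andbT; apply: core_bigcup => A /cP'/andP[].
Qed.

(** The inequality for [S] follows from that for a core of the same rank inside [S]. *)
Lemma moment_polytopeP x : moment_polytope (@core_level G) x <->
  [/\ forall e, 0 <= x 0 e, \sum_e x 0 e = 1 &
      forall S, core_level S <= \sum_(e in S) x 0 e].
Proof.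
split=> -[x0 x1 xA]; split=> // S.
have [A [cA AS rA]] := exists_core S; rewrite /core_level -rA -/(core_level A).
apply: (@le_trans _ _ (\sum_(e in A) x 0 e)).
  have [->|A0] := eqVneq A finset.set0; first by rewrite core_level0 big_set0.
  by apply: xA; rewrite /iscore cA.
rewrite [leRHS](bigID (fun e => e \in A)) /= (eq_bigl (fun e => (e \in S) && (e \in A))).
  by rewrite lerDl sumr_ge0.
by move=> e; rewrite andb_idl //; exact: (subsetP AS).
Qed.

(** The whole graph being a core, proper subgraphs have smaller rank, where [level] is [c]. For the
    whole graph both conditions follow from total length 1 and [c n < 1]. *)
Lemma jewelP x : jewel c x <-> moment_polytope (@core_level G) x.
Proof.
have [c1 cn cS] := cP.
have TE : \sum_(e in [set: E]) x 0 e = \sum_e x 0 e by apply: eq_bigl => e; rewrite inE.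
have rank_pos A : core A -> A != finset.set0 -> (0 < h1_rank A)%N.
  by move=> cA /set0Pn[e eA]; rewrite (core_h1_rank cA eA).
have rank_lt A : A != setT -> (h1_rank A < n)%N.
  rewrite -finset.subTset => /subsetPn[e _ eA].
  rewrite -Gn (core_h1_rank Gcore (in_setT e)) ltnS; apply: h1_rank_mono.
  by rewrite subsetD1 subsetT eA.
split=> [[[x0 _ x1] xA]|[x0 x1 xA]].
  rewrite TE in x1; split=> // A /andP[cA A0].
  have [->|AT] := eqVneq A setT; first by rewrite core_levelT TE x1.
  rewrite /core_level /level gtn_eqF ?rank_pos // rank_lt //; exact: xA.
split; first by split=> // [e|]; rewrite ?TE // inE.
move=> A cA A0; have [->|AT] := eqVneq A setT; first by rewrite Gn TE x1 ltW.
have := xA A; rewrite /iscore cA A0 /core_level /level gtn_eqF ?rank_pos // rank_lt //.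
by apply.
Qed.

Lemma jewel_simplex_bar x : jewel c x -> simplex_bar x.
Proof.
move=> jx; split; first by case: jx.
have [x0 x1 xS] := iffLR (moment_polytopeP x) (iffLR (jewelP x) jx).
apply/forestP/eqP; rewrite -leqn0 leqNgt; apply/negP => r0.
have := xS [set e | x 0 e == 0]%SET; rewrite leNgt big1 => [/negP|e].
  by apply; exact: level_gt0.
by rewrite inE => /eqP.
Qed.

End OnGraph.

Lemma moment_polytope_pull G H (k : cmap G H) (y : 'rV[R]_(ne H)) : forest_collapse k ->
  moment_polytope (@core_level G) (pull_lengths k y) <-> moment_polytope (@core_level H) y.
Proof.
move=> kP; rewrite !moment_polytopeP; split=> -[y0 y1 yS]; split.
- by move=> e'; rewrite -(pull_lift kP).
- by rewrite -(sum_pullT kP).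
- move=> C; rewrite -(sum_pull_preim kP) /core_level -(h1_rank_collapse kP); exact: yS.
- exact: pull_ge0.
- by rewrite (sum_pullT kP).
- move=> S; rewrite (sum_pull kP); apply: le_trans (yS _).
  rewrite {2}/core_level -(h1_rank_collapse kP); apply: core_level_mono.
  by rewrite -(image_edges_sub k).
Qed.

End Level.

(** * Compatibility of moments with collapses *)

Section Naturality.
Import mathcomp.boot.fintype mathcomp.boot.finset.
Variables (R : realType) (G H : graph) (k : cmap G H).
Hypothesis kP : forest_collapse k.

Definition pull_core (t : core_product R H) : core_product R G :=
  fun A => pull_lengths k (component t (image_edges k (val A))).

Lemma component_pull t A : iscore A ->
  component (pull_core t) A = pull_lengths k (component t (image_edges k A)).
Proof. by move=> cA; rewrite component_core. Qed.

Lemma pull_rescale (y : 'rV[R]_(ne H)) :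
  pull_core (core_embedding y) = core_embedding (pull_lengths k y).
Proof.
apply/boolp.functional_extensionality_dep => -[A cA]; rewrite /pull_core /=.
apply/rowP => e; rewrite [RHS]mxE /= (sum_pull kP).
have [eF|[e' [b [_ ->]]]] := collapse_edgeP kP e.
  by rewrite !pull_collapsed // mul0r if_same.
rewrite !(pull_lift kP) component_embedding ?mem_image_edges //.
exact: iscore_image.
Qed.

Lemma pull_coord_continuous (T : topologicalType) (h : T -> 'rV[R]_(ne H)) u e :
  (forall e', {for u, continuous (fun t => h t 0 e')}) ->
  {for u, continuous (fun t => pull_lengths k (h t) 0 e)}.
Proof.
move=> ch; have [eF|[e' [b [_ ->]]]] := collapse_edgeP kP e.
  rewrite (_ : (fun _ => _) = fun=> 0); first exact: cst_continuous.
  by apply/boolp.funext => t; rewrite pull_collapsed.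
rewrite (_ : (fun _ => _) = fun t => h t 0 e'); first exact: ch.
by apply/boolp.funext => t; rewrite (pull_lift kP).
Qed.

Lemma pull_core_continuous : continuous pull_core.
Proof.
move=> t; apply: continuous_at_product => A; apply: continuous_at_rV => e.
by apply: pull_coord_continuous => e'; exact: component_continuous.
Qed.

(* The collapsed edges get a small positive length. *)
Lemma closure_embedding_pull (y : 'rV[R]_(ne H)) : open_simplex y ->
  closure (@core_embedding R G @` @open_simplex R G)%classic (core_embedding (pull_lengths k y)).
Proof.
move=> [y0 y1] U nU.
pose x := pull_lengths k y.
pose N : R := (ne G)%:R.
pose z (t : R) : 'rV[R]_(ne G) := \row_e (((1 - t) * x 0 e + t * N^-1)).
have x0 e : 0 <= x 0 e by apply: pull_ge0 => // e'; exact: ltW.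
have N0 : 0 < N.
  rewrite ltr0n lt0n; apply/eqP => n0; have := sum_pullT kP y.
  rewrite y1 big1 => [/eqP|e _]; first by rewrite eq_sym oner_eq0.
  by have := ltn_ord e; rewrite [X in (_ < X)%N]n0.
have z0 : z 0 = x by apply/rowP => e; rewrite mxE subr0 mul1r mul0r addr0.
have zc e : continuous (fun t => z t 0 e).
  rewrite (_ : (fun _ => _) = fun t => (1 - t) * x 0 e + t * N^-1).
    exact: affine_continuous.
  by apply/boolp.funext => t; rewrite mxE.
have cz : {for 0, continuous (fun t => core_embedding (z t) : core_product R G)}.
  apply: continuous_at_product => -[A cA]; apply: continuous_at_rV => e.
  have [eA|eA] := boolP (e \in A); last first.
    rewrite (_ : (fun _ => _) = fun=> 0); first exact: cst_continuous.
    by apply/boolp.funext => t; rewrite mxE /= (negbTE eA).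
  rewrite (_ : (fun _ => _) = fun t => z t 0 e / \sum_(i in A) z t 0 i); last first.
    by apply/boolp.funext => t; rewrite [LHS]mxE /= eA.
  apply: (@continuousM _ _ (fun t => z t 0 e) (fun t => (\sum_(i in A) z t 0 i)^-1)).
    exact: zc.
  apply: (@continuousV _ _ (fun t => \sum_(i in A) z t 0 i)); last first.
    by apply: continuous_bigsum => i _; exact: zc.
  (* The denominator is nonzero at t = 0: a core is not contained in the collapsed forest, so its
     image has edges. *)
  rewrite z0 (sum_pull kP) gt_eqF //.
  have /set0Pn[e' e'A] : image_edges k A != finset.set0 by case/andP: (iscore_image kP cA).
  exact: (sum_pos_gt0 y0 e'A).
have nU' : nbhs (0 : R) (fun t => U (core_embedding (z t))) by apply: cz; rewrite z0.
have /nbhs_ballP[d /= d0 dU] := nU'.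
pose t := Num.min (d / 2) 1.
have t0 : 0 < t by rewrite lt_min ltr01 andbT divr_gt0.
have t1 : t <= 1 by rewrite ge_min lexx orbT.
exists (core_embedding (z t)); split.
  exists (z t) => //; split=> [e|].
    by rewrite mxE ltr_wpDl // ?mulr_gt0 ?invr_gt0 // mulr_ge0 // subr_ge0.
  rewrite (eq_bigr (fun e => (1 - t) * x 0 e + t * N^-1)) => [|e _]; last by rewrite mxE.
  rewrite big_split /= -mulr_sumr (sum_pullT kP) y1 sumr_const card_ord -mulr_natr.
  by rewrite -mulrA mulVf ?gt_eqF //; ring.
apply: dU; rewrite /ball /= sub0r normrN gtr0_norm // /t.
by rewrite gt_min; apply/orP; left; lra.
Qed.

Lemma Sigma_pull t : Sigma_space t -> Sigma_space (pull_core t).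
Proof.
move=> tS; split.
  move=> [A cA] /=; have cB := iscore_image kP cA; split.
  - by apply: pull_ge0 => // e'; exact: component_ge0.
  - move=> e eA; have [eF|[e' [b [_ eE]]]] := collapse_edgeP kP e.
      by rewrite /pull_core pull_collapsed.
    rewrite /pull_core eE (pull_lift kP) component_out //.
    by rewrite (mem_image_edges kP) -eE.
  - by rewrite (sum_pull kP) component_sum.
have cl : closed (pull_core @^-1` closure (@core_embedding R G @` @open_simplex R G))%classic.
  exact: (iffLR (continuous_closedP _) pull_core_continuous _ (@closed_closure _ _)).
case: tS => _; rewrite {1}closureEbigcap => /(_ _ (conj cl _)); apply.
move=> _ [y oy <-] /=; rewrite pull_rescale; exact: closure_embedding_pull.
Qed.

Variables (n : nat) (c : nat -> R).

(** Cores with the same image [B] carry the same pulled-back metric, and their weights add up to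
    that of [B]. *)
Lemma moment_map_pull t :
  moment_map (core_weight n c (G := G)) (pull_core t) =
  pull_lengths k (moment_map (core_weight n c (G := H)) t).
Proof.
apply/rowP => e; rewrite mxE.
rewrite (eq_bigr (fun A => core_weight n c A *
    pull_lengths k (component t (image_edges k A)) 0 e)); last first.
  move=> A _; have [cA|cA] := boolP (iscore A); first by rewrite component_pull.
  by rewrite core_weight_noncore // !mul0r.
rewrite (partition_big (image_edges k) xpredT) //=.
rewrite (eq_bigr (fun B => core_weight n c B * pull_lengths k (component t B) 0 e)).
  have [eF|[e' [b [_ ->]]]] := collapse_edgeP kP e.
    rewrite pull_collapsed // big1 // => B _; by rewrite pull_collapsed // mulr0.
  by rewrite (pull_lift kP) mxE; apply: eq_bigr => B _; rewrite (pull_lift kP).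
move=> B _; rewrite -(core_weight_pull _ _ _ kP) mulr_suml.
by apply: eq_bigr => A /eqP->.
Qed.

End Naturality.

(** * Gluing *)

Section Global.
Local Open Scope classical_set_scope.
Local Open Scope quotient_scope.
Variables (R : realType) (n : nat) (c : nat -> R).
Hypothesis n2 : (1 < n)%N.
Hypothesis cP : jewel_constants n 1 c.
Implicit Types (X Y : mgraph n) (p q : outer_space R n) (b : bordification R n).

Definition phi X : core_product R X -> 'rV[R]_(ne X) :=
  moment_map (core_weight n c (G := X)).

Definition piece X (s : set_type (@Sigma_space R X)) : bord_pieces R n :=
  existT (fun X : mgraph n => set_type (@Sigma_space R X)) X s.

Lemma Sigma_val X (s : set_type (@Sigma_space R X)) : Sigma_space (val s).
Proof. exact: set_mem (valP s). Qed.

Lemma mgraph_core X : core [set: 'I_(ne X)]%SET.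
Proof.
have [_ _ eX] := mg_admissible X; apply/coreP => e _.
have /components1P[_ j] := eX e.
have -> : ([set: 'I_(ne X)] :\ e = [set~ e])%SET.
  by apply/setP => i; rewrite !inE andbT.
exact: j.
Qed.

Lemma phi_inj X (s s' : core_product R X) :
  Sigma_space s -> Sigma_space s' -> phi s = phi s' -> s = s'.
Proof.
have Xn := h1_rank_mgraph X; have Xc := mgraph_core X.
apply: (moment_map_inj (core_level_super n2 cP Xn Xc) (@core_weightP _ n c _)
  (@core_weight_noncore _ n c _) (core_gap_gt0 n2 cP Xn)
  (@core_gapP _ _ _ n2 cP _) (iscore_setT n2 Xn Xc)).
by move=> P; exact: iscore_bigcup.
Qed.

Lemma phi_jewel X (s : core_product R X) : Sigma_space s -> jewel c (phi s).
Proof.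
have Xn := h1_rank_mgraph X; have Xc := mgraph_core X.
move=> sS; apply/(jewelP n2 cP Xn Xc); apply: (moment_polytope_map
  (core_level_super n2 cP Xn Xc) _ _ (core_levelT c n2 Xn) (@core_weightP _ n c _)
  (@core_weight_noncore _ n c _)) sS; first exact: core_level0.
by move=> S; exact: level_ge0.
Qed.

Lemma phi_surj X x : jewel c x -> exists2 s : core_product R X, Sigma_space s & phi s = x.
Proof.
have Xn := h1_rank_mgraph X; have Xc := mgraph_core X.
move/(jewelP n2 cP Xn Xc); apply: (moment_map_surj
  (core_level_super n2 cP Xn Xc) _ _ (core_levelT c n2 Xn) (@core_weightP _ n c _)
  (@core_weight_noncore _ n c _) (core_gap_gt0 n2 cP Xn)
  (@core_gapP _ _ _ n2 cP _) (@core_level_lt _ _ _ n2 cP _ Xn) (iscore_setT n2 Xn Xc)).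
- exact: core_level0.
- by move=> S; exact: level_ge0.
- by move=> P; exact: iscore_bigcup.
Qed.

Lemma jewel_pull X Y (k : cmap X Y) (y : 'rV[R]_(ne Y)) : forest_collapse k ->
  jewel c (pull_lengths k y) <-> jewel c y.
Proof.
move=> kP.
rewrite (jewelP n2 cP (h1_rank_mgraph X) (mgraph_core X)).
rewrite (jewelP n2 cP (h1_rank_mgraph Y) (mgraph_core Y)).
exact: moment_polytope_pull.
Qed.

Lemma bord_glueP X Y (s : set_type (@Sigma_space R X)) (t : set_type (@Sigma_space R Y)) :
  bord_glue (piece s) (piece t) <->
  exists2 k : cmap X Y, mg_collapse k & val s = pull_core k (val t).
Proof.
split=> [[k [kP st]]|[k kP st]].
  exists k => //; apply/boolp.functional_extensionality_dep => A.
  have cB := iscore_image (proj1 kP) (valP A).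
  pose B : cores Y := exist _ (image_edges k (val A)) cB.
  by rewrite /pull_core (component_core _ cB); exact: (st A B).
exists k; split=> // A B AB; rewrite /= st /pull_core AB.
by rewrite (component_core _ (valP B)); congr (pull_lengths k (val t _)); exact: val_inj.
Qed.

Lemma represents_pull X Y (k : cmap X Y) (y : 'rV[R]_(ne Y)) p : mg_collapse k ->
  represents y p -> represents (pull_lengths k y) p.
Proof.
move=> kP [Z [l [-> lP ->]]]; exists Z, (comp_cmap l k); split=> //.
  exact: mg_collapse_comp.
by rewrite pull_comp.
Qed.

Lemma phi_represented X (s : core_product R X) : Sigma_space s ->
  exists p, represents (phi s) p.
Proof.
move=> sS; apply: represents_exists.
exact: (jewel_simplex_bar n2 cP (h1_rank_mgraph X) (mgraph_core X) (phi_jewel sS)).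
Qed.

(** For a gluing along a collapse only the passage from [t] to [s] is direct. The converse uses that
    [t] represents some point, which must be [p] by uniqueness at [s]. *)
Lemma represents_glue (s t : bord_pieces R n) p :
  clos_refl_sym_trans _ (@bord_glue R n) s t ->
  represents (phi (val (tagged s))) p <-> represents (phi (val (tagged t))) p.
Proof.
elim=> {s t} [[X s] [Y t]|s|s t _ [st ts]|s t u _ [st ts] _ [tu ut]] //; last first.
  by split=> [/st/tu|/ut/ts].
move/bord_glueP => [k kP st] /=.
have E : phi (val s) = pull_lengths k (phi (val t)).
  by rewrite st /phi (moment_map_pull (proj1 kP)).
split=> [sp|tp]; last by rewrite E; exact: represents_pull.
have [q tq] := phi_represented (Sigma_val t).
suff -> : p = q by [].
by apply: represents_unique sp _; rewrite E; exact: represents_pull.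
Qed.

Definition lies_over X (x : 'rV[R]_(ne X)) b : Prop :=
  exists2 s : set_type (@Sigma_space R X), phi (val s) = x &
    b = \pi_(bordification R n) (piece s).

Lemma lies_over_exists X x : jewel c x -> exists b, @lies_over X x b.
Proof.
move/phi_surj => [s sS <-]; pose s' : set_type (@Sigma_space R X) := SigSub (mem_set sS).
by exists (\pi_(bordification R n) (piece s')), s'.
Qed.

Lemma lies_over_unique X x b b' : @lies_over X x b -> lies_over x b' -> b = b'.
Proof.
move=> [s sx ->] [s' sx' ->]; congr (\pi_(bordification R n) (piece _)).
by apply: val_inj; apply: phi_inj; rewrite ?sx ?sx' //; exact: Sigma_val.
Qed.

Lemma lies_over_pull X Y (k : cmap X Y) (y : 'rV[R]_(ne Y)) b : mg_collapse k ->
  lies_over (pull_lengths k y) b <-> lies_over y b.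
Proof.
move=> kP; have kf : forest_collapse k by case: kP.
have sub (t : set_type (@Sigma_space R Y)) : phi (val t) = y ->
    lies_over (pull_lengths k y) (\pi_(bordification R n) (piece t)).
  move=> ty; pose s : set_type (@Sigma_space R X) :=
    SigSub (mem_set (Sigma_pull kf (Sigma_val t))).
  exists s; first by rewrite /= /phi (moment_map_pull kf) -ty.
  apply/esym/quotP; apply: rst_step; apply/bord_glueP; by exists k.
split=> [sb|[t ty ->]]; last exact: sub.
have jy : jewel c y.
  by apply/(jewel_pull y kf); case: sb => s <- _; apply: phi_jewel; exact: Sigma_val.
have [t tS ty] := phi_surj jy.
pose t' : set_type (@Sigma_space R Y) := SigSub (mem_set tS).
by exists t' => //; apply: lies_over_unique sb (sub t' ty).
Qed.

(** The graph of the homeomorphism, kept as a relation so that maps on quotients are formed only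
    after existence and uniqueness. By [point_overP] the chosen representative is immaterial. *)
Definition point_over p b : Prop := lies_over (mm_length (repr p)) b.

Lemma point_overP X (x : 'rV[R]_(ne X)) p b : represents x p ->
  lies_over x b <-> point_over p b.
Proof.
move=> [Y [k [-> kP ->]]]; rewrite lies_over_pull // /point_over.
have := quot_repr (@isometric R n) Y; move: (repr _) => Z.
elim=> {Y k kP Z} [Z Y|Z|Z Y _ [ZY YZ]|Z Y W _ [ZY YZ] _ [YW WY]] //.
- by move=> [k [kP _ ->]]; rewrite lies_over_pull.
- by split=> [/YW/ZY|/YZ/WY].
Qed.

Lemma represents_repr p : represents (mm_length (repr p)) p.
Proof.
exists (repr p), (id_cmap _); rewrite reprK pull_id; split=> //; split.
  exact: forest_collapse_id.
exact: comp_id_cmap.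
Qed.

Lemma point_over_represents p X (s : set_type (@Sigma_space R X)) :
  point_over p (\pi_(bordification R n) (piece s)) -> represents (phi (val s)) p.
Proof.
move=> [t tp /quotP ts]; apply/(represents_glue p ts) => /=.
by rewrite tp; exact: represents_repr.
Qed.

Lemma point_over_inj p q b : point_over p b -> point_over q b -> p = q.
Proof.
have -> : b = \pi_(bordification R n) (piece (tagged (repr b))).
  by rewrite /piece -[LHS]reprK; case: (repr b).
by move=> /point_over_represents rp /point_over_represents; exact: represents_unique.
Qed.

Lemma point_over_unique p b b' : point_over p b -> point_over p b' -> b = b'.
Proof. exact: lies_over_unique. Qed.

Lemma point_over_piece X (s : set_type (@Sigma_space R X)) p :
  represents (phi (val s)) p -> point_over p (\pi_(bordification R n) (piece s)).
Proof. by move/point_overP => <-; exists s. Qed.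

Lemma point_over_jewel p : jewel_set c p <-> exists b, point_over p b.
Proof.
split=> [[X [x [jx xp]]]|[b [s sp _]]].
  by have [b xb] := lies_over_exists jx; exists b; apply/(point_overP _ xp).
exists (repr p), (mm_length (repr p)); split; last exact: represents_repr.
by rewrite -sp; apply: phi_jewel; exact: Sigma_val.
Qed.

Lemma jewel_to_bord_ex (p : jewel_space n c) : exists b, point_over (val p) b.
Proof. by apply/point_over_jewel; exact: set_mem (valP p). Qed.

Definition jewel_to_bord (p : jewel_space n c) : bordification R n :=
  projT1 (boolp.cid (jewel_to_bord_ex p)).

Lemma jewel_to_bordP (p : jewel_space n c) : point_over (val p) (jewel_to_bord p).
Proof. by rewrite /jewel_to_bord; case: boolp.cid. Qed.

Lemma bord_to_jewel_ex b : exists p, point_over p b.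
Proof.
have -> : b = \pi_(bordification R n) (piece (tagged (repr b))).
  by rewrite /piece -[LHS]reprK; case: (repr b).
have [p sp] := phi_represented (Sigma_val (tagged (repr b))).
by exists p; exact: point_over_piece.
Qed.

Definition bord_to_jewel b : jewel_space n c :=
  let p := boolp.cid (bord_to_jewel_ex b) in
  SigSub (mem_set (iffRL (point_over_jewel (projT1 p)) (ex_intro _ b (projT2 p)))).

Lemma bord_to_jewelP b : point_over (val (bord_to_jewel b)) b.
Proof. by rewrite /bord_to_jewel /=; case: boolp.cid. Qed.

Lemma jewel_to_bordK : cancel jewel_to_bord bord_to_jewel.
Proof.
move=> p; apply: val_inj.
exact: point_over_inj (bord_to_jewelP _) (jewel_to_bordP p).
Qed.

Lemma bord_to_jewelK : cancel bord_to_jewel jewel_to_bord.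
Proof.
move=> b; exact: point_over_unique (jewel_to_bordP _) (bord_to_jewelP b).
Qed.

Lemma bord_to_jewel_continuous : continuous bord_to_jewel.
Proof.
apply/quotient_continuous/continuousP => _ [U oU <-].
apply/sigT_openP => X; have [W oW UW] := oU X.
rewrite (_ : _ @^-1` _ = (fun s : set_type (@Sigma_space R X) => phi (val s)) @^-1` W).
  apply: open_comp oW => s _; apply: continuous_comp.
    exact: initial_continuous.
  exact: moment_map_continuous.
have h s : U (val (bord_to_jewel (\pi_(bordification R n) (piece s)))) <-> W (phi (val s)).
  apply: UW; last exact/point_over_represents/bord_to_jewelP.
  exact: (jewel_simplex_bar n2 cP (h1_rank_mgraph X) (mgraph_core X) (phi_jewel (Sigma_val s))).
by apply/seteqP; split=> s /=; move/h.
Qed.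

Lemma jewel_to_bord_continuous : continuous jewel_to_bord.
Proof.
apply/continuousP => U oU.
(* The subspace topology asks for an open set of outer space, so [V] contains all points outside the
   jewel. In each cell its complement is then the image of a closed part of the compact
   [Sigma_space]. *)
pose V : set (outer_space R n) := [set p | jewel_set c p -> exists2 b, point_over p b & U b].
exists V; last first.
  apply/seteqP; split=> p /=.
    move=> Vp; have [b pb Ub] := Vp (set_mem (valP p)).
    by rewrite (point_over_unique (jewel_to_bordP p) pb).
  by move=> Up _; exists (jewel_to_bord p) => //; exact: jewel_to_bordP.
move=> X; have /sigT_openP/(_ X)[D oD DE] := oU.
have DU (s : set_type (@Sigma_space R X)) :
    D (val s) <-> U (\pi_(bordification R n) (piece s)).
  by rewrite -[D _]/((val @^-1` D) s) DE.
exists (~` (@phi X @` (@Sigma_space R X `&` ~` D))).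
  apply: closed_openC; apply: compact_closed; first exact: norm_hausdorff.
  apply: continuous_compact.
    exact/continuous_subspaceT/moment_map_continuous.
  by apply: compact_closedI; [exact: Sigma_compact|exact: open_closedC].
move=> x p bx xp; split=> [Vp [s [sS nD] sx]|Wx /point_over_jewel[b pb]].
  pose s' : set_type (@Sigma_space R X) := SigSub (mem_set sS).
  have sp : point_over p (\pi_(bordification R n) (piece s')).
    by apply: point_over_piece; rewrite /= sx.
  have [|b pb Ub] := Vp; first by apply/point_over_jewel; eexists; exact: sp.
  by apply: nD; apply/(DU s'); rewrite (point_over_unique sp pb).
exists b => //; have [s sx bE] := iffRL (point_overP b xp) pb.
rewrite bE; apply/DU; apply: contrapT => nD; apply: Wx; exists (val s) => //.
by split=> //; exact: Sigma_val.
Qed.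

Lemma point_over_act p b (w : out n) : point_over p b ->
  point_over (outer_act p w) (bord_act b w).
Proof.
move=> [s sp ->].
rewrite -[w in bord_act _ w]reprK bord_actE.
apply/(point_overP (x := mm_length (mm_act (repr p) (repr w)))); last by exists s.
exists (mm_act (repr p) (repr w)), (id_cmap _); rewrite pull_id; split=> //; split.
  exact: forest_collapse_id.
exact: comp_id_cmap.
Qed.

Lemma jewel_to_bord_act (p : jewel_space n c) (w : out n) :
  jewel_to_bord (jewel_act p w) = bord_act (jewel_to_bord p) w.
Proof.
apply: (point_over_unique (p := outer_act (val p) w)).
  exact: (jewel_to_bordP (jewel_act p w)).
exact/point_over_act/jewel_to_bordP.
Qed.

End Global.

Theorem theorem7p13 (R : realType) (n : nat) (hn : (2 <= n)%N) :
  exists2 eps : R, 0 < eps &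
    forall c : nat -> R, jewel_constants n eps c ->
      exists h : jewel_space n c -> bordification R n,
        homeomorphism h /\
        forall (p : jewel_space n c) (w : out n),
          h (jewel_act p w) = bord_act (h p) w.
Proof.
(* The bound 1 is the total length, the value of [level] at rank n, which [c n] has to stay
   below. *)
exists 1 => // c cP; exists (jewel_to_bord hn cP); split; last exact: jewel_to_bord_act.
split; first exact: jewel_to_bord_continuous.
exists (bord_to_jewel hn cP); split.
- exact: bord_to_jewel_continuous.
- exact: jewel_to_bordK.
- exact: bord_to_jewelK.
Qed.
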